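(* The set $\mathscr C$ has the following properties: (i) $\mathscr C\subset\mathscr U$. (ii) $\mathscr C$ is uncountable and has no isolated points. (iii) $\dim_H\mathscr C=0$.
   Context: Fix an integer $M\ge1$ and let $\Omega_M=\{0,1,\ldots,M\}^{\mathbb N}$, with left shift $\sigma$. Sequences, and words of equal length, are compared lexicographically ($\prec,\preccurlyeq$). For a word or sequence $c$ over $\{0,\ldots,M\}$, $\overline c$ denotes its reflection, obtained by replacing each digit $c_i$ by $M-c_i$. For a word $c=c_1\ldots c_n$ with $c_n<M$ put $c^+:=c_1\ldots c_{n-1}(c_n+1)$. $c^\infty=ccc\cdots$. $\overline c^{\,+}$ means $(\overline c)^+$. For $q\in(1,M+1]$, a $q$-expansion of $x$ is a sequence $(d_i)\in\Omega_M$ with $x=\sum_{i\ge1}d_iq^{-i}$. $\mathscr U$ is the set of $q\in(1,M+1]$ for which $1$ has a unique $q$-expansion, and $q_{KL}=\min\mathscr U$ (the Komornik–Loreti constant). $\alpha(q)$ is the lexicographically largest $q$-expansion of $1$ not ending with $0^\infty$. The map $q\mapsto\alpha(q)$ is strictly increasing and bijective from $(1,M+1]$ onto the set of sequences $(a_i)\in\Omega_M$ not ending with $0^\infty$ with $\sigma^n((a_i))\preccurlyeq(a_i)$ for all $n\ge0$. $\widetilde{\mathbf U}_q:=\{(d_i)\in\Omega_M:\overline{\alpha(q)}\prec\sigma^n((d_i))\prec\alpha(q)\ \forall n\ge0\}$. For $X\subset\Omega_M$, $h(X):=\liminf_{n\to\infty}\frac1n\log\#B_n(X)$, where $B_n(X)$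 is the set of length-$n$ words occurring in sequences of $X$. Relative plateaus: a word $\mathbf a=a_1\ldots a_m$ with $m\ge2$ is admissible if $\overline{a_1\ldots a_{m-i}}\preccurlyeq a_{i+1}\ldots a_m\prec a_1\ldots a_{m-i}$ for all $1\le i<m$; when $M\ge2$, a single digit $a_1$ is admissible if $\overline{a_1}\le a_1<M$. An admissible word $\mathbf a$ generates the basic interval $[q_L,q_R]$ given by $\alpha(q_L)=\mathbf a^\infty$, $\alpha(q_R)=\mathbf a^+(\overline{\mathbf a})^\infty$. For the basic interval $I$ generated by $\mathbf a=a_1\ldots a_m$, the number $q_c(I)$ is defined by $\alpha(q_c(I))=(\theta_i)$, where $\theta_1\ldots\theta_m=\mathbf a^+$ and $\theta_{2^{k-1}m+1}\ldots\theta_{2^km}=\overline{\theta_1\ldots\theta_{2^{k-1}m}}^{\,+}$ for $k=1,2,\ldots$. An entropy plateau is a maximal interval $[p_L,p_R]\subset(1,M+1]$ on which $q\mapsto h(\widetilde{\mathbf U}_q)$ is constant and positive (these are known to be exactly the maximal basic intervals lying completely to the right of $q_{KL}$). The relative plateaus are the intervals $J_{\mathbf i}$, $\mathbf i\in\bigcup_{n\ge0}\{1,2,\ldots\}^n$, defined recursively: $J_\emptyset=[1,M+1]$; $J_1,J_2,\ldots$ is an enumeration of the entropy plateaus; and for $\mathbf i\in\{1,2,\ldots\}^n$, $n\ge1$, with $J_{\mathbf i}=[q_L,q_R]$, the intervals $J_{\mathbf i1},J_{\mathbf i2},\ldots$ enumerate the maximal basic intervals contained in $[q_c(J_{\mathbf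 i}),q_R]$. Put $q_c(J_\emptyset):=q_{KL}$. $\mathscr C:=\mathscr C_0\cup\mathscr C_\infty$, where $\mathscr C_0:=\{q_c(J_{\mathbf i}):\mathbf i\in\bigcup_{n\ge0}\{1,2,\ldots\}^n\}$ and $\mathscr C_\infty:=\bigcap_{n\ge1}\bigcup_{\mathbf i\in\{1,2,\ldots\}^n}J_{\mathbf i}$. *)

(* Defs.v *)
From HB Require Import structures.
From mathcomp Require Import all_boot all_order all_algebra.
From mathcomp Require Import all_classical all_reals all_analysis.
Import numFieldNormedType.Exports.

Set Implicit Arguments.
Unset Strict Implicit.
Unset Printing Implicit Defensive.

Import Order.TTheory GRing.Theory Num.Theory.

Local Open Scope classical_set_scope.
Local Open Scope ring_scope.

(* All sequences and words are indexed from 0: the digit written c_i with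
   i >= 1 is [c i.-1] for a sequence and [nth ord0 c i.-1] for a word. *)

Section Words.
Variable M : nat.

Definition digit := 'I_M.+1.

(* [big_lexi_order] carries the lexicographic order on sequences. *)
Definition Omega := big_lexi_order (fun _ : nat => digit).

(* Alias of [seq digit] carrying the lexicographic order on words. *)
Definition word := seqlexi digit.

(* [rev_ord c = M - c]. *)
Definition refl_word (w : word) : word := map (@rev_ord M.+1) w.

Definition refl_seq (d : Omega) : Omega := fun i => rev_ord (d i).

Definition shift_seq (n : nat) (d : Omega) : Omega := fun i => d (n + i)%N.

(* The operation c |-> c^+; only meaningful for nonempty words whose last
   digit is < M ([inord] returns 0 out of range). *)
Definition incr_last (w : word) : word :=
  set_nth ord0 w (size w).-1 (inord (last ord0 w).+1).

Definition periodic (w : word) : Omega := fun i => nth ord0 w (i %% size w).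

Definition prepend (w : word) (d : Omega) : Omega :=
  fun i => if (i < size w)%N then nth ord0 w i else d (i - size w)%N.

Definition ends_with_zeros (d : Omega) : Prop :=
  exists N : nat, forall i : nat, (N <= i)%N -> d i = ord0.

Definition admissible (a : word) : Prop :=
  ((2 <= size a)%N /\
   forall i : nat, (1 <= i < size a)%N ->
     (refl_word (take (size a - i) a) <= (drop i a : word))%O /\
     ((drop i a : word) < (take (size a - i) a : word))%O)
  \/
  ((2 <= M)%N /\
   exists a1 : digit, [/\ a = [:: a1], (rev_ord a1 <= a1)%N & (a1 < M)%N]).

(* theta_1 ... theta_{2^k m}, where m is the length of [a]. *)
Fixpoint theta_word (a : word) (k : nat) : word :=
  if k is k'.+1 then
    let w := theta_word a k' in (w ++ incr_last (refl_word w) : word)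
  else incr_last a.

(* The words [theta_word a k] extend each other and [theta_word a i] has
   length 2^i m > i as soon as [a] is nonempty. *)
Definition theta (a : word) : Omega := fun i => nth ord0 (theta_word a i) i.

Definition occurs (X : set Omega) (n : nat) (w : n.-tuple digit) : Prop :=
  exists (d : Omega) (k : nat), X d /\ forall i : 'I_n, tnth w i = d (k + i)%N.

Definition num_words (X : set Omega) (n : nat) : nat :=
  #|[pred w : n.-tuple digit | `[< occurs X w >]]|.

End Words.

Section Expansions.
Variables (R : realType) (M : nat).

Definition bases : set R := `]1, M.+1%:R].

Definition is_expansion (q x : R) (d : Omega M) : Prop :=
  series (fun i : nat => (d i : nat)%:R / q ^+ i.+1 : R) @ \oo --> x.

Definition univoque : set R :=
  [set q | bases q /\ exists! d : Omega M, is_expansion q 1 d].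

Definition q_KL : R := xget 0 [set q | univoque q /\ lbound univoque q].

Definition alpha (q : R) : Omega M :=
  let E := [set d : Omega M | is_expansion q 1 d /\ ~ ends_with_zeros d] in
  xget (fun=> ord0) [set d | E d /\ ubound E d].

Definition Utilde (q : R) : set (Omega M) :=
  [set d | forall n : nat,
    (refl_seq (alpha q) < shift_seq n d)%O /\ (shift_seq n d < alpha q)%O].

Definition entropy (X : set (Omega M)) : \bar R :=
  limn_einf (fun n : nat => (n%:R^-1)%:E * lne (num_words X n)%:R%:E)%E.

(* A closed interval is represented by the pair of its endpoints. *)
Definition itv (I : R * R) : set R := `[I.1, I.2].

Definition generates (a : word M) (I : R * R) : Prop :=
  [/\ bases I.1, bases I.2, alpha I.1 = periodic a &
      alpha I.2 = prepend (incr_last a) (periodic (refl_word a))].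

Definition basic_interval (I : R * R) : Prop :=
  exists a : word M, admissible a /\ generates a I.

Definition maximal_basic_in (D : set R) : set (R * R) :=
  [set I | [/\ basic_interval I, itv I `<=` D &
    forall I', basic_interval I' -> itv I' `<=` D ->
      itv I `<=` itv I' -> I' = I]].

Definition entropy_constant_pos (I : R * R) : Prop :=
  exists2 c : \bar R, (0 < c)%E &
    forall q, itv I q -> entropy (Utilde q) = c.

(* Plateaus are nondegenerate: without [I.1 < I.2] every base at which the
   entropy is positive and not locally constant would yield an interval
   reduced to a point. *)
Definition entropy_plateau : set (R * R) :=
  [set I | [/\ I.1 < I.2, itv I `<=` bases, entropy_constant_pos I &
    forall I', itv I' `<=` bases -> entropy_constant_pos I' ->
      itv I `<=` itv I' -> I' = I]].

Definition J_empty : R * R := (1, M.+1%:R).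

(* [J_empty] is not a basic interval since 1 is not in [bases]. *)
Definition q_c (I : R * R) : R :=
  if I == J_empty then q_KL else
  xget 0 [set q | bases q /\
    exists a : word M, [/\ admissible a, generates a I & alpha q = theta a]].

(* The set of all J_i with i of length n. *)
Fixpoint relative_plateaus (n : nat) : set (R * R) :=
  match n with
  | 0 => [set J_empty]
  | 1 => entropy_plateau
  | n'.+1 =>
      \bigcup_(I in relative_plateaus n') maximal_basic_in `[q_c I, I.2]
  end.

Definition C0 : set R := \bigcup_n (q_c @` relative_plateaus n).

Definition Cinfty : set R :=
  \bigcap_(n in [set n : nat | (1 <= n)%N])
    \bigcup_(I in relative_plateaus n) itv I.

Definition Cset : set R := C0 `|` Cinfty.

End Expansions.

Section HausdorffDimension.
Variable R : realType.

Definition diam (A : set R) : \bar R :=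
  ereal_sup [set `|p.1 - p.2|%:E | p in A `*` A].

(* The empty set has weight 0 for every s, including s = 0. *)
Definition hausdorff_weight (s : R) (A : set R) : \bar R :=
  if `[< A = set0 >] then 0%E else (diam A `^ s)%E.

Definition hausdorff_premeasure (s delta : R) (A : set R) : \bar R :=
  ereal_inf [set (\sum_(0 <= k <oo) hausdorff_weight s (U k))%E |
    U in [set U : nat -> set R |
      A `<=` \bigcup_k U k /\ forall k, (diam (U k) <= delta%:E)%E]].

Definition hausdorff_measure (s : R) (A : set R) : \bar R :=
  ereal_sup [set hausdorff_premeasure s delta A |
    delta in [set delta : R | 0 < delta]].

Definition hausdorff_dim (A : set R) : \bar R :=
  ereal_inf [set s%:E |
    s in [set s : R | 0 <= s /\ hausdorff_measure s A = 0%E]].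

End HausdorffDimension.

(* Main.v *)
Require Import Defs.
From mathcomp Require Import all_boot all_order all_algebra.
From mathcomp Require Import all_classical all_reals all_analysis.
From mathcomp Require Import zify ring lra.
Import numFieldNormedType.Exports.

(** The quasi-greedy expansion [alpha q] of every [q] in [Cset] is [nested]: it
    lies in the basic intervals of arbitrarily long admissible words.  For
    [q_c I] this holds because [theta a] is also the limit sequence of all
    doublings of [a]; for the points of [Cinfty] it holds because the words of
    the relative plateaus get longer from one level to the next.  The initial
    segments of such a sequence separate its shifts strictly from the sequence
    and from its reflection, which is the lexicographic criterion for a unique
    expansion of 1 ([univoque_alpha], [nested_univoque]).

    Inside the basic interval of [a] all relevant sequences are concatenations
    of [a], [a^+] and their reflections, chosen by a 0-1 sequence ([code],
    [decode]).  So every block of [size a] digits carries one binary choice, and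
    the points of [univoque] in the interval are covered by [2^n] sets of
    diameter of order [q^(- n * size a)].  Words of all large sizes being
    available for [Cinfty], its Hausdorff dimension is 0 ([coded_null]), and
    [C0] is countable.

    The intervals of the next level accumulate at [q_c I] from the right
    ([plateaus_near_q_c]): the basic intervals of [trip (iter k dbl a)] approach
    [q_c I], and so do the maximal intervals that meet them, because [theta a]
    is not periodic and agrees on many digits only with sequences of long
    period.  Hence no point of [Cset] is isolated, and for any enumeration of
    points one finds nested relative plateaus that avoid them one by one
    ([uncountable_Cinfty]).

    For the first level this requires that entropy plateaus are basic intervals
    and that there are plateaus near [q_KL].  Replace a digit [c] by [2 c - M]
    and let [phi b] be the value in base [b].  The entropy of [Utilde q] is
    [log b] exactly when [alpha q] lies between the smallest and the largest
    expansion of 1 whose tails stay in [[-1, 1]] ([entropy_lower_one_le],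
    [entropy_level]): the number of words of length [n] is of order [b^n] since
    points at distance [b^-n] have different prefixes.  When these two
    expansions differ they are the ends of a basic interval ([first_return]);
    the period [m] satisfies [b^m >= 2] ([return_time_ge2]), which keeps the
    entropy from growing within the interval ([level_interval]).  The entropy
    is not positive at [q_KL] ([entropy_q_KL]), so that plateaus lie to the
    right of [q_KL], and it is positive at the left ends of the basic intervals of
    [trip (iter k dbl root_word)], so that plateaus exist there. *)

Set Implicit Arguments.
Unset Strict Implicit.
Unset Printing Implicit Defensive.

Import Order.TTheory GRing.Theory Num.Theory.

Local Open Scope classical_set_scope.
Local Open Scope ring_scope.

Local Notation periodic := Defs.periodic.

(** * Digit sequences and the lexicographic order *)

Section Sequences.
Variable M : nat.
Implicit Types d e f : Omega M.

Definition agree n d e := forall i, (i < n)%N -> d i = e i.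

Lemma agree_sym n d e : agree n d e -> agree n e d.
Proof. by move=> h i /h. Qed.

Lemma agree_trans n d e f : agree n d e -> agree n e f -> agree n d f.
Proof. by move=> h k i ni; rewrite h ?k. Qed.

Lemma agreeW n m d e : (m <= n)%N -> agree n d e -> agree m d e.
Proof. by move=> mn h i im; apply: h; exact: leq_trans mn. Qed.

Lemma agree_eq d e : (forall n, agree n d e) -> d = e.
Proof. by move=> h; apply/funext => i; exact: (h i.+1). Qed.

(** A strict inequality decided within the first [n] digits survives any
    change of the later digits. *)
Definition lt_within n d e :=
  exists2 k, (k < n)%N & agree k d e /\ (d k < e k)%N.

Lemma ltOP d e : (d < e)%O <-> exists n, lt_within n d e.
Proof.
rewrite lt_def leEbig_lexi_order; split.
- move=> /andP[/eqP ned]; case E: first_diff => [k|]; last first.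
    by move/first_diff_NoneP : E => E; case: ned.
  move/first_diff_SomeP : E => [pre dk] le.
  exists k.+1, k => //; split; first exact: pre.
  by rewrite ltn_neqAle -val_eqE/= in dk *; rewrite dk.
- move=> [_ [k _ [pre dk]]].
  have E : first_diff d e = Some k.
    apply/first_diff_SomeP; split; first exact: pre.
    by rewrite -val_eqE/=; move: dk; rewrite ltn_neqAle => /andP[].
  rewrite E; apply/andP; split; last exact: ltnW.
  by apply/eqP => ed; move: dk; rewrite ed ltnn.
Qed.

Lemma lt_withinW n m d e : (m <= n)%N -> lt_within m d e -> lt_within n d e.
Proof. by move=> mn [k km h]; exists k => //; exact: leq_trans mn. Qed.

Lemma lt_within_lt n d e : lt_within n d e -> (d < e)%O.
Proof. by move=> h; apply/ltOP; exists n. Qed.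

Lemma lt_within_agree n d d' e e' : agree n d d' -> agree n e e' ->
  lt_within n d e -> lt_within n d' e'.
Proof.
move=> dd' ee' [k kn [pre lt]]; exists k => //; split; last by rewrite -dd' -?ee'.
by move=> i ik; rewrite -dd' ?pre ?ee'//; exact: ltn_trans kn.
Qed.

Lemma agree_or n d e : agree n d e \/ lt_within n d e \/ lt_within n e d.
Proof.
have [->|/eqP] := eqVneq d e; first by left.
move=> /eqP; rewrite neq_lt => /orP[] /ltOP[_ [k _ [pre lt]]].
- have [nk|kn] := leqP n k; first by left; exact: agreeW pre.
  by right; left; exists k.
- have [nk|kn] := leqP n k.
    by left; apply: agreeW nk _; exact: agree_sym.
  by right; right; exists k.
Qed.

Lemma le_agree_or n d e : (d <= e)%O -> agree n d e \/ lt_within n d e.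
Proof.
move=> de; have [|[|/lt_within_lt]] := agree_or n d e; [by left|by right|].
by rewrite ltNge de.
Qed.

Lemma shift_seqE n d i : shift_seq n d i = d (n + i)%N.
Proof. by []. Qed.

Lemma shift_seq0 d : shift_seq 0 d = d.
Proof. by apply/funext => i. Qed.

Lemma shift_seqD m n d : shift_seq m (shift_seq n d) = shift_seq (n + m) d.
Proof. by apply/funext => i; rewrite !shift_seqE addnA. Qed.

Lemma lt_shift n d e : agree n d e ->
  (shift_seq n d < shift_seq n e)%O = (d < e)%O.
Proof.
move=> de; apply/idP/idP => /ltOP[_ [k _ [pre lt]]]; apply/ltOP.
- exists (n + k).+1, (n + k)%N => //; split => // i ik.
  have [ni|/de//] := leqP n i.
  by have := pre (i - n)%N; rewrite !shift_seqE subnKC//; apply; lia.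
- have nk : (n <= k)%N by rewrite leqNgt; apply/negP => /de E; rewrite E ltnn in lt.
  exists (k - n).+1, (k - n)%N => //; rewrite !shift_seqE subnKC//; split => // i ik.
  by rewrite !shift_seqE; apply: pre; lia.
Qed.

Lemma le_shift n d e : agree n d e ->
  (shift_seq n d <= shift_seq n e)%O = (d <= e)%O.
Proof. by move=> de; rewrite !leNgt lt_shift//; exact: agree_sym. Qed.

Lemma agree_squeeze n d e f : (d <= e)%O -> (e <= f)%O -> agree n d f ->
  agree n d e.
Proof.
move=> de ef df; have [//|h] := le_agree_or n de.
have [h'|h'] := le_agree_or n ef.
  by apply: agree_trans df _; exact: agree_sym.
have : (d < d)%O.
  apply: (@lt_trans _ _ e); first exact: (@lt_within_lt n).
  by apply: (@lt_within_lt n); apply: lt_within_agree h' => //; exact: agree_sym.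
by rewrite ltxx.
Qed.

Lemma refl_seqE d i : refl_seq d i = rev_ord (d i).
Proof. by []. Qed.

Lemma refl_seqK d : refl_seq (refl_seq d) = d.
Proof. by apply/funext => i; rewrite !refl_seqE rev_ordK. Qed.

Lemma shift_refl n d : shift_seq n (refl_seq d) = refl_seq (shift_seq n d).
Proof. by []. Qed.

Lemma rev_digitE (c : 'I_M.+1) : (rev_ord c : nat) = (M - c)%N.
Proof. by rewrite /= subSS. Qed.

Lemma agree_refl_seq n d e : agree n d e -> agree n (refl_seq d) (refl_seq e).
Proof. by move=> h i /h; rewrite !refl_seqE => ->. Qed.

Lemma lt_within_refl n d e :
  lt_within n d e -> lt_within n (refl_seq e) (refl_seq d).
Proof.
move=> [k kn [pre lt]]; exists k => //; split.
  by apply/agree_refl_seq/agree_sym.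
by rewrite !rev_digitE; have := ltn_ord (e k); lia.
Qed.

Lemma refl_lt d e : (refl_seq d < refl_seq e)%O = (e < d)%O.
Proof.
apply/idP/idP => /ltOP[n] /lt_within_refl; rewrite ?refl_seqK; exact: lt_within_lt.
Qed.

Lemma refl_le d e : (refl_seq d <= refl_seq e)%O = (e <= d)%O.
Proof. by rewrite !leNgt refl_lt. Qed.

Lemma refl_ltC d e : (refl_seq d < e)%O = (refl_seq e < d)%O.
Proof. by rewrite -{1}(refl_seqK e) refl_lt. Qed.

Lemma refl_leC d e : (refl_seq d <= e)%O = (refl_seq e <= d)%O.
Proof. by rewrite -{1}(refl_seqK e) refl_le. Qed.

Lemma le_reflC d e : (d <= refl_seq e)%O = (e <= refl_seq d)%O.
Proof. by rewrite -{1}(refl_seqK d) refl_le. Qed.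

Lemma lt_head d e : (d 0%N < e 0%N)%N -> (d < e)%O.
Proof. by move=> h; apply/ltOP; exists 1%N, 0%N. Qed.

Lemma le_head d e : (d <= e)%O -> (d 0%N <= e 0%N)%N.
Proof. by move=> de; rewrite leqNgt; apply/negP => /lt_head; rewrite ltNge de. Qed.

End Sequences.

(** * Values of digit sequences in a real base *)

(** A bounded quantity that is always non-positive or dominated by a fixed
    fraction of another of its values is non-positive: otherwise its supremum
    would be at most that fraction of itself.  Every estimate below that
    compares a tail of a sequence with a later tail goes through this lemma. *)
Lemma contraction_le0 (R : realType) (u : nat -> R) (B rho : R) :
  0 <= rho < 1 -> (forall n, u n <= B) ->
  (forall n, u n <= 0 \/ exists k r, [/\ 0 <= r, r <= rho & u n <= r * u k]) ->
  forall n, u n <= 0.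
Proof.
move=> /andP[rho0 rho1] uB h n.
have su : has_sup (range u).
  by split; [exists (u 0%N), 0%N|exists B => _ [k _ <-]].
have lesup k : u k <= sup (range u) by apply: ub_le_sup; [case: su|exists k].
apply: le_trans (lesup n) _.
rewrite leNgt; apply/negP => s0.
have : sup (range u) <= rho * sup (range u).
  apply: ge_sup; first by case: su.
  move=> _ [k _ <-]; have [uk0|[j [r [r0 rr ukj]]]] := h k.
    by rewrite (le_trans uk0)// mulr_ge0// ltW.
  apply: le_trans ukj _; apply: (@le_trans _ _ (r * sup (range u))).
    by rewrite ler_wpM2l.
  by rewrite ler_wpM2r// ltW.
by rewrite leNgt gtr_pMl// rho1.
Qed.

Lemma contraction_bound (R : realType) (u : nat -> R) (A B rho : R) :
  0 <= rho < 1 -> (forall n, u n <= B) -> (forall n, u n <= A + rho * u n.+1) ->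
  forall n, u n <= A / (1 - rho).
Proof.
move=> /andP[rho0 rho1] uB h n; rewrite -subr_le0.
apply: (@contraction_le0 _ (fun n => u n - A / (1 - rho)) (B - A / (1 - rho)) rho).
- by rewrite rho0.
- by move=> k; rewrite lerB.
- move=> k; right; exists k.+1, rho; split => //.
  rewrite lerBlDr (le_trans (h k))//.
  have : A = A / (1 - rho) - rho * (A / (1 - rho)).
    by field; lra.
  by rewrite mulrBr; lra.
Qed.

Section Values.
Variables (R : realType) (M : nat).
Implicit Types (q x : R) (d e : Omega M) (n : nat).

Definition qval q d : R :=
  limn (series (fun i : nat => (d i : nat)%:R / q ^+ i.+1 : R)).

Lemma digit_le (c : 'I_M.+1) : (c : nat)%:R <= M%:R :> R.
Proof. by rewrite ler_nat -ltnS. Qed.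

Lemma is_cvg_qval q d : 1 < q ->
  cvgn (series (fun i : nat => (d i : nat)%:R / q ^+ i.+1 : R)).
Proof.
move=> q1; have q0 : 0 < q by lra.
apply: (@series_le_cvg _ _ (geometric (M%:R / q) q^-1)).
- by move=> n; rewrite divr_ge0// exprn_ge0// ltW.
- by move=> n; rewrite /= mulr_ge0 ?divr_ge0 ?exprn_ge0 ?invr_ge0// ltW.
- move=> n; rewrite /= exprS invfM mulrA exprVn.
  by rewrite ler_wpM2r ?invr_ge0 ?exprn_ge0 ?ler_wpM2r ?invr_ge0 ?digit_le// ltW.
- by apply: is_cvg_geometric_series; rewrite ger0_norm ?invr_ge0 ?invf_lt1// ltW.
Qed.

Lemma expansionP q x d : 1 < q -> is_expansion q x d <-> qval q d = x.
Proof.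
move=> q1; split; first by move/(cvg_lim (@Rhausdorff R)).
by move=> <-; exact: is_cvg_qval.
Qed.

Lemma qval_rec q d : 1 < q -> q * qval q d = (d 0%N : nat)%:R + qval q (shift_seq 1 d).
Proof.
move=> q1; have q0 : q != 0 by rewrite gt_eqF; lra.
pose u d := fun i : nat => (d i : nat)%:R / q ^+ i.+1 : R.
have E n : q * series (u d) n.+1 = (d 0%N : nat)%:R + series (u (shift_seq 1 d)) n.
  rewrite !seriesEord/= big_ord_recl mulrDr; congr (_ + _).
    by rewrite /u expr1 mulrC divfK.
  rewrite mulr_sumr; apply: eq_bigr => i _; rewrite /u shift_seqE add1n lift0.
  by rewrite [q ^+ i.+2]exprS invfM mulrCA mulVKf.
have h1 : (fun n => q * series (u d) n.+1) @ \oo --> q * qval q d.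
  apply: cvgMl_tmp; have := @is_cvg_qval q d q1; rewrite -cvg_shiftS; exact.
have h2 : (fun n => q * series (u d) n.+1) @ \oo -->
    (d 0%N : nat)%:R + qval q (shift_seq 1 d).
  by under eq_fun do rewrite E; apply: cvgD; [exact: cvg_cst|exact: is_cvg_qval].
exact: (cvg_unique (@Rhausdorff R) h1 h2).
Qed.

Lemma qval_ge0 q d : 1 < q -> 0 <= qval q d.
Proof.
move=> q1; apply: limr_ge; first exact: is_cvg_qval.
near=> n; apply: sumr_ge0 => i _.
by rewrite divr_ge0// exprn_ge0//; lra.
Unshelve. all: by end_near. Qed.

Lemma qval_le q d : 1 < q -> qval q d <= M%:R / (q - 1).
Proof.
move=> q1; have q0 : 0 < q by lra.
have bnd k : \sum_(i < k) (d i : nat)%:R / q ^+ i.+1 + M%:R / (q - 1) / q ^+ k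
    <= M%:R / (q - 1).
  elim: k => [|k ih]; first by rewrite big_ord0 add0r expr0 divr1.
  apply: le_trans _ ih; rewrite big_ord_recr/= -addrA lerD2l.
  rewrite exprS invfM; have : (d k : nat)%:R <= M%:R :> R by exact: digit_le.
  have : 0 <= (q ^+ k)^-1 by rewrite invr_ge0 exprn_ge0// ltW.
  move: (q ^+ k)^-1 (_%:R) => z c z0 cM.
  have -> : M%:R / (q - 1) * (q^-1 * z) = M%:R / (q - 1) * z - M%:R * (q^-1 * z).
    by field; lra.
  have : c * (q^-1 * z) <= M%:R * (q^-1 * z).
    by rewrite ler_wpM2r// mulr_ge0// invr_ge0 ltW.
  lra.
apply: limr_le; first exact: is_cvg_qval.
near=> k; rewrite seriesEord/=; apply: le_trans (bnd k); rewrite lerDl.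
by rewrite !mulr_ge0// ?invr_ge0 ?exprn_ge0//; lra.
Unshelve. all: by end_near. Qed.

Lemma qval_agree q d e n : 1 < q -> agree n d e ->
  qval q d - qval q e = (qval q (shift_seq n d) - qval q (shift_seq n e)) / q ^+ n.
Proof.
move=> q1; have q0 : q != 0 by rewrite gt_eqF; lra.
elim: n => [_|n ih de]; first by rewrite !shift_seq0 expr0 divr1.
rewrite ih; last exact: agreeW de.
have := qval_rec (shift_seq n d) q1; have := qval_rec (shift_seq n e) q1.
rewrite !shift_seqD !addn1 !shift_seqE !addn0 de// exprSr.
move: (qval _ _) (qval _ _) (qval _ _) (qval _ _) => a b c f ha hb.
have qn : q ^+ n != 0 by rewrite expf_neq0.
apply: (@mulIf _ (q ^+ n * q)); first by rewrite mulf_neq0.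
rewrite divfK ?mulf_neq0// mulrA divfK//.
lra.
Qed.

(** The recursion expands differences by the factor [q], so it has only one
    bounded solution.  This is how the digits produced by an algorithm are
    shown to expand the number that the algorithm started from. *)
Lemma orbit_qval q d (y : nat -> R) B : 1 < q -> (forall n, `|y n| <= B) ->
  (forall n, q * y n = (d n : nat)%:R + y n.+1) ->
  forall n, qval q (shift_seq n d) = y n.
Proof.
move=> q1 yB yS n; apply/eqP; rewrite -subr_eq0 -normr_le0.
set u := fun n => `|qval q (shift_seq n d) - y n|; rewrite -[`|_|]/(u n).
have -> : 0 = 0 / (1 - q^-1) by rewrite mul0r.
apply: (@contraction_bound _ u 0 (M%:R / (q - 1) + B)).
- by rewrite invr_ge0 invf_lt1 ?q1 ?andbT; lra.
- move=> k; apply: le_trans (ler_normB _ _) _; apply: lerD => //.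
  by rewrite ger0_norm ?qval_ge0// qval_le.
- move=> k; rewrite add0r ler_pdivlMl; last by lra.
  rewrite /u -[X in X * _]gtr0_norm -?normrM ?mulrBr; last by lra.
  rewrite qval_rec// yS shift_seqD addn1 shift_seqE addn0.
  by rewrite [X in `|X| <= _](_ : _ = qval q (shift_seq k.+1 d) - y k.+1)//; ring.
Qed.

(** The difference of the values satisfies the recursion of [qval_rec] up to an
    error [|q - q'|] times a value. *)
Lemma qval_lipschitz q0 q q' d : 1 < q0 -> q0 <= q -> q0 <= q' ->
  `|qval q d - qval q' d| <= M%:R / (q0 - 1) ^+ 2 * `|q - q'|.
Proof.
move=> q01 qq qq'.
set u := fun n => `|qval q (shift_seq n d) - qval q' (shift_seq n d)|.
have -> : `|qval q d - qval q' d| = u 0%N by rewrite /u !shift_seq0.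
have qle e x : q0 <= x -> qval x e <= M%:R / (q0 - 1).
  move=> qx; apply: (le_trans (qval_le _ _)); first by lra.
  by rewrite ler_wpM2l// lef_pV2 ?posrE; lra.
have -> : M%:R / (q0 - 1) ^+ 2 * `|q - q'| =
   (q0^-1 * (M%:R / (q0 - 1) * `|q - q'|)) / (1 - q0^-1) by field; lra.
apply: (@contraction_bound _ u _ (M%:R / (q0 - 1) + M%:R / (q0 - 1))).
- by rewrite invr_ge0 invf_lt1 ?q01 ?andbT; lra.
- move=> k; apply: le_trans (ler_normB _ _) _.
  by apply: lerD; rewrite ger0_norm ?qval_ge0 ?qle//; lra.
- move=> k; rewrite -mulrDr ler_pdivlMl; last by lra.
  set e := shift_seq k d.
  have hq : q * (qval q e - qval q' e) = (q' - q) * qval q' e +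
     (qval q (shift_seq k.+1 d) - qval q' (shift_seq k.+1 d)).
    have h1 : q * qval q e = (d k : nat)%:R + qval q (shift_seq k.+1 d).
      by rewrite qval_rec; [rewrite /e shift_seqD addn1 shift_seqE addn0|lra].
    have h2 : q' * qval q' e = (d k : nat)%:R + qval q' (shift_seq k.+1 d).
      by rewrite qval_rec; [rewrite /e shift_seqD addn1 shift_seqE addn0|lra].
    lra.
  apply: (@le_trans _ _ (q * `|qval q e - qval q' e|)); first by apply: ler_wpM2r; rewrite ?normr_ge0.
  rewrite -[X in X * _]gtr0_norm; last by lra.
  rewrite -normrM hq; apply: le_trans (ler_normD _ _) _; rewrite lerD2r normrM.
  rewrite distrC mulrC ler_wpM2r//.
  by rewrite ger0_norm ?qle ?qval_ge0 ?(lt_le_trans q01)//; lra.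
Qed.

End Values.

Section QuasiGreedy.
Variables (R : realType) (M : nat).
Implicit Types (q x y : R) (d e : Omega M) (n : nat).

(** The points visited when [D] chooses the next digit of the expansion of [y];
    both the quasi-greedy expansions of 1 and the greedy expansions with
    symmetric digits are of this form. *)
Definition orbit_point (D : R -> 'I_M.+1) q y n : R :=
  iter n (fun y => q * y - (D y : nat)%:R) y.

Definition orbit_digits (D : R -> 'I_M.+1) q y : Omega M :=
  fun n => D (orbit_point D q y n).

Lemma shift_orbit_digits (D : R -> 'I_M.+1) q y n :
  shift_seq n (orbit_digits D q y) = orbit_digits D q (orbit_point D q y n).
Proof.
apply/funext => i; rewrite shift_seqE /orbit_digits; congr D.
by rewrite /orbit_point addnC iterD.
Qed.

Lemma orbit_digitsP (D : R -> 'I_M.+1) q (P : set R) (B : R) : 1 < q -> (forall y, P y -> `|y| <= B) ->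
  (forall y, P y -> P (q * y - (D y : nat)%:R)) ->
  forall y, P y -> qval q (orbit_digits D q y) = y /\
    forall n, P (orbit_point D q y n).
Proof.
move=> q1 PB PD y Py.
have Pn n : P (orbit_point D q y n) by elim: n => // n ih; apply: PD.
split => //; rewrite -[LHS](congr1 (qval q) (shift_seq0 _)).
rewrite (@orbit_qval _ _ _ _ (orbit_point D q y) B)// => n; first exact: PB.
by rewrite /orbit_digits /= addrC subrK.
Qed.

Lemma qval_zero q : 1 < q -> qval q ((fun=> ord0) : Omega M) = 0.
Proof.
move=> q1; rewrite -(shift_seq0 (fun=> ord0)).
by rewrite (@orbit_qval _ _ _ _ (fun=> 0) 0)// => n; rewrite ?normr0// mulr0 add0r.
Qed.

Lemma qval_digit q d n : 1 < q -> d n != ord0 -> (q ^+ n.+1)^-1 <= qval q d.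
Proof.
move=> q1; have q0 : 0 < q by lra.
elim: n d => [|n ih] d dn; have := qval_rec d q1.
- have := qval_ge0 (shift_seq 1 d) q1.
  have : 1 <= (d 0%N : nat)%:R :> R by rewrite ler1n lt0n; move: dn; rewrite -val_eqE.
  rewrite expr1 -[q^-1]mul1r ler_pdivrMr// [qval q d * q]mulrC; lra.
- have := ih (shift_seq 1 d) dn; have : 0 <= (d 0%N : nat)%:R :> R by [].
  rewrite [q ^+ n.+2]exprS invfM ler_pdivrMl//; lra.
Qed.

Lemma qval_gt0 q d n : 1 < q -> ~ ends_with_zeros d -> 0 < qval q (shift_seq n d).
Proof.
move=> q1 nz; have q0 : 0 < q by lra.
apply: contrapT => v0; apply: nz; exists n => i ni; apply: contrapT => /eqP di.
apply: v0; apply: (@lt_le_trans _ _ (q ^+ (i - n).+1)^-1).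
  by rewrite invr_gt0 exprn_gt0.
by apply: qval_digit; rewrite // shift_seqE subnKC.
Qed.

Lemma not_ends_with_zeros q d : 1 < q -> (forall n, 0 < qval q (shift_seq n d)) ->
  ~ ends_with_zeros d.
Proof.
move=> q1 h [N dN]; have := h N.
rewrite (_ : shift_seq N d = (fun=> ord0)) ?qval_zero ?ltxx//.
by apply/funext => i; rewrite shift_seqE dN// leq_addr.
Qed.

(** One step of every lexicographic comparison: at the first difference the
    digits differ by at least one, and the rest is decided by the tails. *)
Lemma qval_first_diff q d e k : 1 < q -> agree k d e -> (d k < e k)%N ->
  qval q d - qval q e <=
  (qval q (shift_seq k.+1 d) - qval q (shift_seq k.+1 e) - 1) / q ^+ k.+1.
Proof.
move=> q1 pre lt; have q0 : 0 < q by lra.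
rewrite (qval_agree q1 pre) exprS invfM mulrA ler_pM2r; last first.
  by rewrite invr_gt0 exprn_gt0.
rewrite ler_pdivlMr// mulrC mulrBr !qval_rec// !shift_seqD !addn1 !shift_seqE !addn0.
have : (d k : nat)%:R + 1 <= (e k : nat)%:R :> R by rewrite natr1 ler_nat.
lra.
Qed.

Lemma le_qval q d e : 1 < q -> (forall n, qval q (shift_seq n d) <= 1) ->
  (d <= e)%O -> qval q d <= qval q e.
Proof.
move=> q1 d1; rewrite le_eqVlt => /predU1P[->//|/ltOP[_ [k _ [pre lt]]]].
rewrite -subr_le0; apply: le_trans (qval_first_diff q1 pre lt) _.
have q0 : 0 < q by lra.
rewrite pmulr_lle0 ?invr_gt0 ?exprn_gt0//.
have := d1 k.+1; have := qval_ge0 (shift_seq k.+1 e) q1; lra.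
Qed.

Lemma lt_qval q d e : 1 < q -> (forall n, qval q (shift_seq n d) <= 1) ->
  (forall n, 0 < qval q (shift_seq n e)) -> (d < e)%O -> qval q d < qval q e.
Proof.
move=> q1 d1 e0 /ltOP[_ [k _ [pre lt]]].
rewrite -subr_lt0; apply: le_lt_trans (qval_first_diff q1 pre lt) _.
have q0 : 0 < q by lra.
rewrite pmulr_llt0 ?invr_gt0 ?exprn_gt0//.
have := d1 k.+1; have := e0 k.+1; lra.
Qed.

(** A tail of value above 1 exceeds [e] in value although it is below [e] in
    order, so a later tail exceeds 1 by more, by a factor of at least [q]. *)
Lemma tails_le1 q d e : 1 < q -> qval q e <= 1 ->
  (forall n, (shift_seq n d <= e)%O) -> forall n, qval q (shift_seq n d) <= 1.
Proof.
move=> q1 e1 de n; rewrite -subr_le0.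
have [q0 qi1] : 0 < q /\ q^-1 < 1 by split; [|rewrite invf_lt1]; lra.
apply: (@contraction_le0 _ (fun n => qval q (shift_seq n d) - 1)
  (M%:R / (q - 1) - 1) q^-1).
- by rewrite qi1 invr_ge0 ltW.
- by move=> k; rewrite lerB// qval_le.
- move=> k; move: (de k); rewrite le_eqVlt => /predU1P[->|].
    by left; rewrite subr_le0.
  move=> /ltOP[_ [j _ [pre lt]]]; right; exists (k + j.+1)%N, (q ^+ j.+1)^-1; split.
  + by rewrite invr_ge0 exprn_ge0// ltW.
  + rewrite lef_pV2 ?posrE ?exprn_gt0// -{1}[q]mulr1 exprS ler_pM2l//.
    by rewrite exprn_ege1// ltW.
  + have := qval_first_diff q1 pre lt; rewrite shift_seqD => h.
    apply: (@le_trans _ _ (qval q (shift_seq k d) - qval q e)); first by rewrite lerB.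
    apply: le_trans h _; rewrite mulrC ler_wpM2l ?invr_ge0 ?exprn_ge0//; try exact: ltW.
    by have := qval_ge0 (shift_seq j.+1 e) q1; lra.
Qed.

Lemma qval_ltr q q' d : 1 < q -> q <= q' ->
  qval q d * (q' - q) / q' <= qval q d - qval q' d.
Proof.
move=> q1 qq; have q0 : 0 < q by lra. have q'1 : 1 < q' by lra.
have q'0 : 0 < q' by lra.
have step e : qval q e * (q' - q) / q' <= qval q e - qval q' e +
   (qval q' (shift_seq 1 e) - qval q (shift_seq 1 e)) / q'.
  have := qval_rec e q1; have := qval_rec e q'1 => h' h.
  rewrite -(ler_pM2r q'0) mulfVK ?gt_eqF// mulrDl mulfVK ?gt_eqF//; lra.
have low n : qval q' (shift_seq n d) - qval q (shift_seq n d) <= 0.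
  apply: (@contraction_le0 _ (fun n => qval q' (shift_seq n d) - qval q (shift_seq n d))
    (M%:R / (q' - 1)) q'^-1).
  - by rewrite invr_ge0 invf_lt1// q'1 ltW.
  - move=> k; have := qval_le (shift_seq k d) q'1; have := qval_ge0 (shift_seq k d) q1.
    lra.
  - move=> k; right; exists k.+1, q'^-1; split; rewrite /= ?invr_ge0 ?(ltW q'0)//.
    have := step (shift_seq k d); rewrite shift_seqD addn1 [_ / q' in X in _ <= X]mulrC.
    have : 0 <= qval q (shift_seq k d) * (q' - q) / q'.
      by rewrite !mulr_ge0 ?invr_ge0 ?qval_ge0//; lra.
    lra.
have := step d; have := low 1%N; rewrite -(pmulr_lle0 _ (_ : 0 < q'^-1)) ?invr_gt0//.
lra.
Qed.

Lemma basesP q : @bases R M q <-> 1 < q <= M.+1%:R.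
Proof. by rewrite /bases /= in_itv. Qed.

Lemma bases_gt1 q : @bases R M q -> 1 < q.
Proof. by move/basesP => /andP[]. Qed.

Lemma bases_le q : @bases R M q -> q <= M.+1%:R.
Proof. by move/basesP => /andP[]. Qed.

Lemma alpha_unique q d : @bases R M q ->
  (forall n, 0 < qval q (shift_seq n d) <= 1) -> qval q d = 1 -> alpha M q = d.
Proof.
move=> bq dt d1; have q1 := bases_gt1 bq.
pose E := [set d : Omega M | is_expansion q 1 d /\ ~ ends_with_zeros d].
have Ed : E d.
  split; first by apply/expansionP.
  by apply: (@not_ends_with_zeros q) => // n; case/andP: (dt n).
have ub : ubound E d.
  move=> e [/expansionP e1 ez]; rewrite leNgt; apply/negP => /lt_qval => /(_ q q1).
  rewrite d1 e1// ltxx => h; suff : false by [].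
  by apply: h => n; [case/andP: (dt n)|exact: qval_gt0].
rewrite /alpha -/E; case: (xgetP (fun=> ord0) _) => [x _ [Ex ux]|/(_ d)[]]; last by split.
by apply/eqP; rewrite eq_le ux// ub.
Qed.

(** Always taking the largest digit that keeps the remainder positive keeps
    all remainders in [(0, 1]], because [q <= M + 1]. *)
Lemma alpha_spec q : @bases R M q ->
  qval q (alpha M q) = 1 /\ forall n, 0 < qval q (shift_seq n (alpha M q)) <= 1.
Proof.
move=> bq; have q1 := bases_gt1 bq; have qM := bases_le bq.
pose D y : 'I_M.+1 := [arg max_(i > ord0 | (i : nat)%:R < q * y) (i : nat)].
pose P := [set y : R | 0 < y <= 1].
have PD y : P y -> P (q * y - (D y : nat)%:R).
  move=> /= /andP[y0 y1]; rewrite /D; case: arg_maxnP => [|c cy cmax].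
    by rewrite mulr_gt0//; lra.
  apply/andP; rewrite subr_gt0; split => //; have [cM|Mc] := ltnP c M.
    have := cmax (Ordinal (n:=M.+1) (m:=c.+1) cM) => /=.
    have [lt /(_ isT)|ge _] := ltP (c.+1%:R) (q * y); first by rewrite ltnn.
    by rewrite lerBlDr -natr1 addrC in ge *.
  have -> : (c : nat) = M by apply/eqP; rewrite eqn_leq Mc -ltnS ltn_ord.
  rewrite lerBlDr addrC natr1; apply: le_trans qM.
  by rewrite -[leRHS]mulr1 ler_wpM2l//; lra.
have PB y : P y -> `|y| <= 1 by move=> /andP[y0 y1]; rewrite gtr0_norm.
have Dval y : P y -> qval q (orbit_digits D q y) = y.
  by move=> /(orbit_digitsP q1 PB PD)[].
have P1 : P 1 by rewrite /P/= ltr01 lexx.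
have [_ Pn] := orbit_digitsP q1 PB PD P1.
have tl n : P (qval q (shift_seq n (orbit_digits D q 1))).
  by rewrite shift_orbit_digits Dval.
suff -> : alpha M q = orbit_digits D q 1 by split => //; rewrite Dval.
by apply: alpha_unique; rewrite ?Dval.
Qed.

Lemma alpha_val q : @bases R M q -> qval q (alpha M q) = 1.
Proof. by case/alpha_spec. Qed.

Lemma alpha_tail_le1 q n : @bases R M q -> qval q (shift_seq n (alpha M q)) <= 1.
Proof. by case/alpha_spec => _ /(_ n) /andP[]. Qed.

Lemma alpha_tail_gt0 q n : @bases R M q -> 0 < qval q (shift_seq n (alpha M q)).
Proof. by case/alpha_spec => _ /(_ n) /andP[]. Qed.

Lemma shift_alpha_le q n : @bases R M q -> (shift_seq n (alpha M q) <= alpha M q)%O.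
Proof.
move=> bq; rewrite leNgt; apply/negP => lt.
have : qval q (alpha M q) < qval q (shift_seq n (alpha M q)).
  apply: lt_qval lt; rewrite ?(bases_gt1 bq)// => k; first exact: alpha_tail_le1.
  by rewrite shift_seqD alpha_tail_gt0.
by rewrite alpha_val// ltNge alpha_tail_le1.
Qed.

Lemma alpha_mono q q' : @bases R M q -> @bases R M q' ->
  q < q' -> (alpha M q < alpha M q')%O.
Proof.
move=> bq bq' qq; rewrite ltNge; apply/negP => le.
have q1 := bases_gt1 bq; have q'1 := bases_gt1 bq'.
have : qval q' (alpha M q') <= qval q' (alpha M q).
  by apply: le_qval => // n; exact: alpha_tail_le1.
have := qval_ltr (alpha M q) q1 (ltW qq); rewrite !alpha_val// mul1r.
have : 0 < (q' - q) / q' by rewrite divr_gt0; lra.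
lra.
Qed.

Lemma alpha_lt q q' : @bases R M q -> @bases R M q' ->
  (alpha M q < alpha M q')%O = (q < q').
Proof.
move=> bq bq'; apply/idP/idP => [|/alpha_mono]; last exact.
by apply: contraTT; rewrite -!leNgt le_eqVlt => /predU1P[->//|/alpha_mono h]; rewrite ltW// h.
Qed.

Lemma alpha_le q q' : @bases R M q -> @bases R M q' ->
  (alpha M q <= alpha M q')%O = (q <= q').
Proof. by move=> bq bq'; rewrite !leNgt alpha_lt. Qed.

Lemma alpha_inj q q' : @bases R M q -> @bases R M q' ->
  alpha M q = alpha M q' -> q = q'.
Proof. by move=> bq bq' e; apply/le_anti; rewrite -!alpha_le// e lexx. Qed.

(** In the larger base [q'] the expansion of 1 in base [q] has a value close to 1,
    since it agrees with [alpha q'], but also less than 1 by at least a constant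
    times [q' - q]. *)
Lemma alpha_dist q0 q q' n : 1 < q0 -> @bases R M q -> @bases R M q' ->
  q0 <= q -> q0 <= q' -> agree n (alpha M q) (alpha M q') ->
  `|q - q'| <= M.+1%:R * (M%:R / (q0 - 1)) / q0 ^+ n.
Proof.
move=> q01; wlog qq : q q' / q <= q'.
  move=> h bq bq' q0q q0q' ag; have [qq|/ltW qq] := leP q q'; first exact: h.
  by rewrite distrC; apply: h => //; exact: agree_sym.
move=> bq bq' q0q q0q' ag; have q1 := bases_gt1 bq; have q'1 := bases_gt1 bq'.
rewrite distrC ger0_norm ?subr_ge0//.
have := qval_ltr (alpha M q) q1 qq; rewrite alpha_val// mul1r ler_pdivrMr; last by lra.
move/le_trans; apply; rewrite mulrC -mulrA; apply: ler_pM => //; first by lra.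
- have := @tails_le1 q' (alpha M q) (alpha M q') q'1.
  rewrite alpha_val// => /(_ (lexx _)) /(_ _ 0%N).
  rewrite shift_seq0 => h; rewrite subr_ge0 h// => k.
  by apply: (le_trans (shift_alpha_le k bq)); rewrite alpha_le.
- exact: bases_le.
- rewrite -[X in X - _](alpha_val bq') (qval_agree q'1 (agree_sym ag)).
  have q0n : 0 < q0 ^+ n by rewrite exprn_gt0; lra.
  have qn : 0 < q' ^+ n by rewrite exprn_gt0; lra.
  apply: (@le_trans _ _ (M%:R / (q0 - 1) / q' ^+ n)).
    rewrite ler_wpM2r ?invr_ge0 ?(ltW qn)//.
    apply: (@le_trans _ _ (qval q' (shift_seq n (alpha M q')))).
      by rewrite gerBl qval_ge0.
    apply: (le_trans (qval_le _ q'1)).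
    by rewrite ler_wpM2l// lef_pV2 ?posrE; lra.
  rewrite ler_wpM2l// ?divr_ge0//; first by lra.
  by rewrite lef_pV2 ?posrE//; apply: lerXn2r; rewrite ?nnegrE; lra.
Qed.

Lemma qval_continuous d q : 1 < q -> {for q, continuous (fun x => qval x d)}.
Proof.
move=> q1; pose q0 := (1 + q) / 2; have q01 : 1 < q0 by rewrite /q0; lra.
apply/cvgrPdist_le => /= e e0.
pose L := M%:R / (q0 - 1) ^+ 2 + 1; have L0 : 0 < L.
  by rewrite /L ltr_wpDl// divr_ge0// exprn_ge0//; lra.
near=> t.
have h0 : `|q - t| <= e / L.
  by near: t; apply: (@cvgr_dist_le _ _ _ (nbhs q) _ id q) => //; rewrite divr_gt0.
have h1 : `|q - t| <= q - q0.
  near: t; apply: (@cvgr_dist_le _ _ _ (nbhs q) _ id q) => //; rewrite /q0; lra.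
apply: (le_trans (@qval_lipschitz _ _ q0 _ _ _ _ _ _)) => //; first by rewrite /q0; lra.
  by have := ler_norm (q - t); lra.
apply: (@le_trans _ _ (L * `|q - t|)).
  by rewrite ler_wpM2r// /L; lra.
by rewrite mulrC -ler_pdivlMr.
Unshelve. all: by end_near. Qed.

Lemma alpha_eq q d : @bases R M q -> ~ ends_with_zeros d ->
  (forall n, (shift_seq n d <= d)%O) -> qval q d = 1 -> alpha M q = d.
Proof.
move=> bq nz dd d1; have q1 := bases_gt1 bq; apply: alpha_unique => // n.
by rewrite qval_gt0//=; apply: tails_le1 dd n; rewrite ?d1.
Qed.

(** Self-maximal sequences are exactly the quasi-greedy expansions of one: the
    value of the sequence is at most 1 in base [M + 1] and at least 1 in bases
    close to 1, since it has two non-zero digits. *)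
Lemma alpha_surj d : ~ ends_with_zeros d ->
  (forall n, (shift_seq n d <= d)%O) -> exists2 q, @bases R M q & alpha M q = d.
Proof.
move=> nz dd.
have nonz n : exists2 i, (n <= i)%N & d i != ord0.
  apply: contrapT => h; apply: nz; exists n => i ni; apply: contrapT => /eqP di.
  by apply: h; exists i.
have d0 : d 0%N != ord0.
  have [i _ di] := nonz 0%N; have [ag|lt] := le_agree_or 1 (dd i).
    by rewrite -ag// shift_seqE addn0.
  case: lt => j j1 [_]; have -> : j = 0%N by lia.
  by rewrite -val_eqE/= -lt0n; apply: leq_trans.
have [i i0 di] := nonz 1%N.
pose q1 : R := 2 `^ (i.+1%:R^-1).
have q1i : q1 ^+ i.+1 = 2.
  by rewrite -powR_mulrn ?powR_ge0// -powRrM mulVf ?powRr1// pnatr_eq0.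
have q10 : 0 < q1 by rewrite powR_gt0.
have q11 : 1 < q1.
  rewrite ltNge; apply/negP => le; have : q1 ^+ i.+1 <= 1 by rewrite exprn_ile1// ltW.
  by rewrite q1i; lra.
have q12 : q1 <= 2.
  by rewrite -q1i -{1}[q1]mulr1 exprS ler_pM2l// exprn_ege1 ?ltW.
have M0 : (0 < M)%N by have := ltn_ord (d 0%N); move: d0; rewrite -val_eqE/=; lia.
have M2 : 2 <= M.+1%:R :> R by rewrite ler_nat.
have v1 : 1 <= qval q1 d.
  have := qval_rec d q11.
  have : (q1 ^+ i)^-1 <= qval q1 (shift_seq 1 d).
    by rewrite -(prednK i0); apply: qval_digit => //; rewrite shift_seqE add1n prednK.
  have -> : (q1 ^+ i)^-1 = q1 / 2 by rewrite -q1i exprS invfM mulVKf ?gt_eqF.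
  have : 1 <= (d 0%N : nat)%:R :> R by rewrite ler1n lt0n; move: d0; rewrite -val_eqE.
  move: (qval _ _) (qval _ _) => a b c1 b1 h.
  have : q1 * 1 <= q1 * a by lra.
  by rewrite ler_pM2l.
have vM : qval (M.+1%:R : R) d <= 1.
  have h1 : 1 < M.+1%:R :> R by lra.
  have := qval_le d h1; have -> : M.+1%:R - 1 = M%:R :> R by rewrite -natr1 addrK.
  have M0R : M%:R != 0 :> R by rewrite pnatr_eq0 -lt0n.
  by rewrite divff.
have cont : {within `[q1, M.+1%:R], continuous (fun x : R => qval x d)}.
  apply: continuous_in_subspaceT => x; rewrite inE/= in_itv/= => /andP[x1 _].
  by apply: qval_continuous; lra.
have [|q] := @IVT _ _ _ _ 1 (le_trans q12 M2) cont.
  by rewrite ge_min vM orbT le_max v1.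
rewrite in_itv/= => /andP[qq qM] qd.
have bq : bases M q by apply/basesP; rewrite qM andbT; lra.
by exists q => //; apply: alpha_eq.
Qed.

End QuasiGreedy.

(** * Unique expansions of one *)

Section Univoque.
Variables (R : realType) (M : nat).
Implicit Types (q x y : R) (d e : Omega M) (n : nat).

Lemma qval_refl q d : 1 < q -> qval q (refl_seq d) = M%:R / (q - 1) - qval q d.
Proof.
move=> q1; rewrite -{1}(shift_seq0 (refl_seq d)) -{2}(shift_seq0 d).
pose y n := M%:R / (q - 1) - qval q (shift_seq n d).
rewrite (@orbit_qval _ _ _ _ y (M%:R / (q - 1)))// => n; rewrite /y.
  rewrite ger0_norm ?subr_ge0 ?qval_le//.
  by have := qval_ge0 (shift_seq n d) q1; lra.
have := qval_rec (shift_seq n d) q1; rewrite shift_seqD addn1 shift_seqE addn0.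
rewrite refl_seqE rev_digitE natrB; last by rewrite -ltnS ltn_ord.
have -> : q * (M%:R / (q - 1) - qval q (shift_seq n d)) =
  M%:R + M%:R / (q - 1) - q * qval q (shift_seq n d) by field; lra.
lra.
Qed.

Lemma expansion_exists q x : @bases R M q -> 0 <= x <= M%:R / (q - 1) ->
  exists d : Omega M, qval q d = x.
Proof.
move=> bq x0; have q1 := bases_gt1 bq; have qM := bases_le bq.
pose D y : 'I_M.+1 := [arg max_(i > ord0 | (i : nat)%:R <= q * y) (i : nat)].
pose P := [set y : R | 0 <= y <= M%:R / (q - 1)].
exists (orbit_digits D q x).
apply: (proj1 (@orbit_digitsP _ _ D q P (M%:R / (q - 1)) q1 _ _ x x0)).
  by move=> y /andP[y0 yM]; rewrite ger0_norm.
move=> y /= /andP[y0 yM]; rewrite /D; case: arg_maxnP => [|c cy cmax].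
  by rewrite mulr_ge0//; lra.
apply/andP; split; first by rewrite subr_ge0.
have [cM|Mc] := ltnP c M.
  have := cmax (Ordinal (n:=M.+1) (m:=c.+1) cM) => /=.
  have [lt /(_ isT)|ge _] := leP (c.+1%:R) (q * y); first by rewrite ltnn.
  apply: (@le_trans _ _ 1); first by rewrite lerBlDr addrC natr1 ltW.
  by rewrite ler_pdivlMr ?mul1r ?subr_gt0// lerBlDr natr1.
have -> : (c : nat) = M by apply/eqP; rewrite eqn_leq Mc -ltnS ltn_ord.
have : q * y <= q * (M%:R / (q - 1)) by rewrite ler_wpM2l//; lra.
have -> : q * (M%:R / (q - 1)) = M%:R + M%:R / (q - 1) by field; lra.
lra.
Qed.

(** Two expansions of 1 that differ at digit [k] have tails there differing by
    at least 1.  If the other expansion has the larger digit, the tail of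
    [alpha q] would be at least 1; if it has the smaller one, the reflected tail
    of [alpha q] would be at least 1.  Both tails have all their shifts below
    [alpha q], so their values are less than 1. *)
Lemma univoque_alpha q : @bases R M q ->
  (forall n, (0 < n)%N ->
     (refl_seq (alpha M q) < shift_seq n (alpha M q))%O /\
     (shift_seq n (alpha M q) < alpha M q)%O) ->
  univoque M q.
Proof.
move=> bq h; have q1 := bases_gt1 bq; split=> //; exists (alpha M q); split.
  by apply/expansionP => //; exact: alpha_val.
move=> e /expansionP => /(_ q1) e1; apply: contrapT => /eqP.
have below d : (forall n, (shift_seq n d < alpha M q)%O) -> qval q d < 1.
  move=> dl; rewrite -(alpha_val bq); apply: lt_qval => //.
  - by apply: tails_le1 (fun n => ltW (dl n)) => //; rewrite alpha_val.
  - by move=> n; exact: alpha_tail_gt0.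
  - by rewrite -(shift_seq0 d).
have diff k d d' : agree k d d' -> qval q d = qval q d' ->
    (d k : nat)%:R + qval q (shift_seq k.+1 d) =
    (d' k : nat)%:R + qval q (shift_seq k.+1 d').
  move=> ag dd; have := qval_agree q1 ag; rewrite dd subrr => /esym/eqP.
  rewrite mulf_eq0 invr_eq0 expf_eq0 (gt_eqF (lt_trans ltr01 q1)) andbF orbF.
  rewrite subr_eq0 => /eqP E; have := qval_rec (shift_seq k d) q1.
  have := qval_rec (shift_seq k d') q1; rewrite -E => ->.
  by rewrite !shift_seqD !addn1 !shift_seqE !addn0.
rewrite neq_lt => /orP[] /ltOP[_ [k _ [ag lt]]];
  have := diff k _ _ ag; rewrite alpha_val// e1 => /(_ erefl) E.
- have : qval q (shift_seq k.+1 (alpha M q)) < 1.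
    by apply: below => n; rewrite shift_seqD; case: (h (k.+1 + n)%N).
  have : (alpha M q k : nat)%:R + 1 <= (e k : nat)%:R :> R by rewrite natr1 ler_nat.
  by have := qval_ge0 (shift_seq k.+1 e) q1; lra.
- have : qval q (refl_seq (shift_seq k.+1 (alpha M q))) < 1.
    apply: below => n; rewrite shift_refl shift_seqD refl_ltC.
    by case: (h (k.+1 + n)%N).
  rewrite qval_refl//.
  have : (e k : nat)%:R + 1 <= (alpha M q k : nat)%:R :> R by rewrite natr1 ler_nat.
  by have := qval_le (shift_seq k.+1 e) q1; lra.
Qed.

Lemma alpha_head_gt0 q : @bases R M q -> (0 < alpha M q 0%N)%N.
Proof.
move=> bq; rewrite lt0n; apply/eqP => a0.
have q1 := bases_gt1 bq.
have := @not_ends_with_zeros _ _ q (alpha M q) q1; apply.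
  by move=> n; exact: alpha_tail_gt0.
exists 0%N => i _; apply/val_inj => /=; apply/eqP; rewrite -leqn0 -a0.
by have := le_head (shift_alpha_le i bq); rewrite shift_seqE addn0.
Qed.

(** If some tail of [alpha q] is at most the reflection of [alpha q], then
    decreasing a non-zero digit just before such a tail can be compensated by
    increasing the value of the tail by 1, which gives a second expansion. *)
Lemma univoque_refl_lt q n : univoque M q -> (0 < n)%N ->
  (refl_seq (alpha M q) < shift_seq n (alpha M q))%O.
Proof.
move=> [bq [d0 [_ uniq]]]; have q1 := bases_gt1 bq.
have exp1 d : qval q d = 1 -> d = alpha M q.
  move=> d1; rewrite -(uniq d) ?(uniq (alpha M q))//; apply/expansionP => //.
  exact: alpha_val.
have a0 := alpha_head_gt0 bq; have aval := alpha_val bq.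
have adec m : (shift_seq m (alpha M q) <= alpha M q)%O by exact: shift_alpha_le.
have tl1 m : qval q (shift_seq m (alpha M q)) <= 1 by exact: alpha_tail_le1.
case: n => // n _; rewrite ltNge le_reflC; apply/negP.
move: (alpha M q) exp1 a0 aval adec tl1 => a exp1 a0 aval adec tl1.
have main k : (0 < a k)%N -> (a <= refl_seq (shift_seq k.+1 a))%O -> False.
  move=> ak le; have v1 : 1 <= M%:R / (q - 1) - qval q (shift_seq k.+1 a).
    by rewrite -qval_refl// -[leLHS]aval; exact: le_qval.
  have [|e ev] := @expansion_exists q (qval q (shift_seq k.+1 a) + 1) bq.
    by have := qval_ge0 (shift_seq k.+1 a) q1; lra.
  pose f : Omega M := fun i => if (i < k)%N then a i
    else if i == k then inord (a k).-1 else e (i - k.+1)%N.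
  have fk : (f k : nat) = (a k).-1.
    by rewrite /f ltnn eqxx inordK//; have := ltn_ord (a k); lia.
  have sf : shift_seq k.+1 f = e.
    apply/funext => i; rewrite shift_seqE /f.
    by rewrite ifN ?ifN ?addKn//; lia.
  have f1 : qval q f = 1.
    have ag : agree k f a by move=> i ik; rewrite /f ik.
    have := qval_agree q1 ag; have := qval_rec (shift_seq k a) q1.
    have := qval_rec (shift_seq k f) q1.
    rewrite !shift_seqD !addn1 !shift_seqE !addn0 sf ev fk.
    have -> : (a k : nat)%:R = (a k).-1%:R + 1 :> R by rewrite natr1 prednK.
    move=> E1 E2; have : q * qval q (shift_seq k f) = q * qval q (shift_seq k a).
      by rewrite E1 E2; lra.
    have q0 : q != 0 by rewrite gt_eqF; lra.
    by move/(mulfI q0) => ->; rewrite subrr mul0r aval => /eqP; rewrite subr_eq0 => /eqP.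
  by have := fk; rewrite (exp1 _ f1); move: ak; case: (nat_of_ord _) => //= m _; lia.
elim: n => [|k ih] le; first exact: main le.
have [ak|ak] := ltnP 0 (a k.+1); first exact: main le.
apply: ih; have [aM|aM] := ltnP (a 0%N) M.
  apply/ltW/lt_head; rewrite refl_seqE rev_digitE shift_seqE addn0; lia.
rewrite -(@le_shift _ 1); last first.
  move=> i; rewrite ltnS leqn0 => /eqP->; apply/ord_inj.
  rewrite refl_seqE rev_digitE shift_seqE addn0.
  by have := ltn_ord (a 0%N); lia.
by rewrite shift_refl shift_seqD addn1; apply: le_trans (adec _) le.
Qed.

End Univoque.

(** * Admissible words and sequences made of their blocks *)

Section Words.
Variable M : nat.
Implicit Types (d e : Omega M) (a u v : word M) (st : nat -> bool) (n k : nat).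

Lemma word_ltP u v : size u = size v ->
  (u < v)%O <-> lt_within (size u) (nth ord0 u) (nth ord0 v).
Proof.
elim: u v => [|x u ih] [|y v]//.
  by move=> _; rewrite ltxx; split => // -[k].
move=> /= [suv]; rewrite ltxi_cons; split.
- move=> /andP[]; rewrite le_eqVlt => /predU1P[<-|xy _].
    rewrite lexx/= => /(ih _ suv) [k ku [pre lt]].
    exists k.+1 => //; split => //= -[|i]//= ik; exact: pre.
  by exists 0%N.
- move=> [[|k] ku [pre /= lt]].
    have xy : (x < y)%O by rewrite ltEord.
    by rewrite ltW//= leNgt xy.
  have /= xy := pre 0%N (ltn0Sn _); rewrite xy lexx/=.
  by apply/(ih _ suv); exists k => //; split => // i ik; exact: (pre i.+1).
Qed.

Lemma nth_refl_word u i : (i < size u)%N ->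
  nth ord0 (refl_word u) i = rev_ord (nth ord0 u i).
Proof. by move=> iu; rewrite (nth_map ord0). Qed.

Lemma size_refl_word u : size (refl_word u) = size u.
Proof. by rewrite size_map. Qed.

Lemma refl_wordK u : refl_word (refl_word u) = u.
Proof. by rewrite /refl_word -map_comp map_id_in// => x _ /=; rewrite rev_ordK. Qed.

Lemma size_incr_last u : (0 < size u)%N -> size (incr_last u) = size u.
Proof. by move=> u0; rewrite size_set_nth prednK// maxnn. Qed.

Lemma nth_incr_last u i : (0 < size u)%N -> (nth ord0 u (size u).-1 < M)%N ->
  (i < size u)%N ->
  (nth ord0 (incr_last u) i : nat) = (nth ord0 u i + (i == (size u).-1))%N.
Proof.
move=> u0 uM iu; rewrite nth_set_nth/=; case: eqVneq => [->|_]; last by rewrite addn0.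
by rewrite -nth_last inordK ?addn1// ltnS.
Qed.

Lemma incr_last_cat u v : (0 < size v)%N -> incr_last (u ++ v) = u ++ incr_last v.
Proof.
case: v => // y v _; rewrite /incr_last.
have -> : (size (u ++ y :: v)).-1 = (size u + (size (y :: v)).-1)%N.
  by rewrite size_cat /= addnS.
rewrite last_cat; move: (inord _) => z /=.
by elim: u => [|x u ih] //=; rewrite ih.
Qed.

Lemma shift_periodic u : shift_seq (size u) (periodic u) = periodic u.
Proof. by apply/funext => i; rewrite shift_seqE /periodic modnDl. Qed.

Lemma periodic_agree u : agree (size u) (periodic u) (nth ord0 u).
Proof. by move=> i iu; rewrite /periodic modn_small. Qed.

Lemma iter_shift_eq n k d : shift_seq n d = d -> shift_seq (k * n) d = d.
Proof.
move=> dn; elim: k => [|k ih]; first by rewrite mul0n shift_seq0.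
by rewrite mulSn addnC -shift_seqD ih.
Qed.

Lemma periodic_eq u d : (0 < size u)%N -> agree (size u) d (nth ord0 u) ->
  shift_seq (size u) d = d -> d = periodic u.
Proof.
move=> u0 ag sd; apply/funext => i; rewrite {1}(divn_eq i (size u)).
by rewrite -shift_seqE iter_shift_eq// ag// ltn_mod.
Qed.

Lemma periodic_refl_word u : (0 < size u)%N ->
  periodic (refl_word u) = refl_seq (periodic u).
Proof.
move=> u0; apply/funext => i; rewrite refl_seqE /periodic size_refl_word.
by rewrite nth_refl_word// ltn_mod.
Qed.

Definition plus_seq a : Omega M := prepend (incr_last a) (periodic (refl_word a)).

Lemma prepend_agree u d : agree (size u) (prepend u d) (nth ord0 u).
Proof. by move=> i iu; rewrite /prepend iu. Qed.

Lemma shift_prepend u d : shift_seq (size u) (prepend u d) = d.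
Proof.
by apply/funext => i; rewrite shift_seqE /prepend ltnNge leq_addr /= addKn.
Qed.

(** The comparisons in the definition of admissibility, as statements about
    the periodic sequence; they also cover one-digit words. *)
Record adm_spec a : Prop := AdmSpec {
  adm_size : (0 < size a)%N;
  adm_last : (nth ord0 a (size a).-1 < M)%N;
  adm_first : (M <= nth ord0 a 0 + nth ord0 a (size a).-1)%N;
  adm_upper : forall i, (0 < i < size a)%N ->
    lt_within (size a - i) (shift_seq i (periodic a)) (periodic a);
  adm_lower : forall i, (0 < i < size a)%N ->
    agree (size a - i) (refl_seq (periodic a)) (shift_seq i (periodic a)) \/
    lt_within (size a - i) (refl_seq (periodic a)) (shift_seq i (periodic a)) }.

Lemma drop_agree a i : agree (size a - i) (nth ord0 (drop i a)) (shift_seq i (periodic a)).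
Proof.
move=> j ji; rewrite nth_drop shift_seqE periodic_agree//.
lia.
Qed.

Lemma take_agree a n : (n <= size a)%N -> agree n (nth ord0 (take n a)) (periodic a).
Proof.
by move=> na j jn; rewrite nth_take// periodic_agree//; exact: leq_trans na.
Qed.

Lemma refl_take_agree a n : (n <= size a)%N ->
  agree n (nth ord0 (refl_word (take n a))) (refl_seq (periodic a)).
Proof.
move=> na j jn; rewrite nth_refl_word ?size_takel// refl_seqE take_agree//.
Qed.

Lemma admissible_spec a : admissible a -> adm_spec a.
Proof.
move=> [[s2 h]|[M2 [a1 [-> le lt]]]].
  have s0 : (0 < size a)%N by exact: leq_trans s2.
  have up i : (0 < i < size a)%N ->
      lt_within (size a - i) (shift_seq i (periodic a)) (periodic a).
    move=> /[dup] /h[_ +] /andP[i0 ia].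
    have [ss le] : size (drop i a) = size (take (size a - i) a) /\
        (size a - i <= size a)%N.
      by rewrite size_drop size_takel leq_subr.
    move/(word_ltP ss); rewrite size_drop; apply: lt_within_agree.
      exact: drop_agree.
    exact: take_agree.
  have low i : (0 < i < size a)%N ->
      agree (size a - i) (refl_seq (periodic a)) (shift_seq i (periodic a)) \/
      lt_within (size a - i) (refl_seq (periodic a)) (shift_seq i (periodic a)).
    move=> /[dup] /h[+ _] /andP[i0 ia].
    have le : (size a - i <= size a)%N by rewrite leq_subr.
    have ss : size (refl_word (take (size a - i) a)) = size (drop i a).
      by rewrite size_refl_word size_drop size_takel.
    rewrite le_eqVlt => /predU1P[E|/(word_ltP ss)].
      left; apply: agree_trans _ (@drop_agree a i); rewrite -E.
      by apply: agree_sym; exact: refl_take_agree.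
    rewrite ss size_drop => lt; right; apply: lt_within_agree lt.
      exact: refl_take_agree.
    exact: drop_agree.
  have last1 : (0 < (size a).-1 < size a)%N by lia.
  have sub1 : (size a - (size a).-1 = 1)%N by lia.
  have nthE : shift_seq (size a).-1 (periodic a) 0%N = nth ord0 a (size a).-1.
    by rewrite shift_seqE addn0 periodic_agree//; lia.
  have nth0 : periodic a 0%N = nth ord0 a 0 by rewrite periodic_agree.
  split => //.
  - have := up _ last1; rewrite sub1 => -[j j1 [_]]; have -> : j = 0%N by lia.
    by rewrite nthE nth0 => /leq_trans; apply; rewrite -ltnS ltn_ord.
  - have := low _ last1; rewrite sub1 => -[/(_ 0%N isT)|[j j1 [_]]].
      by rewrite nthE refl_seqE nth0 => <-; rewrite rev_digitE; lia.
    have -> : j = 0%N by lia.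
    by rewrite nthE refl_seqE nth0 rev_digitE; lia.
split => //=; [by move: le; rewrite rev_digitE; lia|lia|lia].
Qed.

(** It suffices to compare the shifts of the periodic sequence: they are
    strictly below the sequence, and the strictness must show up before the
    wrap-around, since otherwise the remainder would compare the wrong way. *)
Lemma periodic_admissible a d : (2 <= size a)%N ->
  agree (size a).-1 d (periodic a) ->
  (forall i, (0 < i < size a)%N -> (shift_seq i (periodic a) < periodic a)%O /\
     (refl_seq d <= shift_seq i (periodic a))%O) -> admissible a.
Proof.
move=> s2 dag h; left; split => // i ia.
have [up low] := h i ia; have /andP[i0 iL] := ia.
have le : (size a - i <= size a)%N by rewrite leq_subr.
have si : (size a - i <= (size a).-1)%N by lia.
split.
- have ss : size (refl_word (take (size a - i) a)) = size (drop i a).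
    by rewrite size_refl_word size_drop size_takel.
  have ag : agree (size a - i) (refl_seq d) (nth ord0 (refl_word (take (size a - i) a))).
    apply: agree_trans (agree_sym (refl_take_agree le)).
    by apply: agree_refl_seq; exact: agreeW dag.
  have [E|lt] := le_agree_or (size a - i) low.
    rewrite le_eqVlt; apply/orP; left; apply/eqP/(@eq_from_nth _ ord0) => //.
    rewrite ss size_drop => j ji; rewrite -ag// E// drop_agree//.
  apply/ltW/(word_ltP ss); rewrite ss size_drop.
  by apply: lt_within_agree lt => //; apply: agree_sym; exact: drop_agree.
- have ss : size (drop i a) = size (take (size a - i) a).
    by rewrite size_drop size_takel.
  apply/(word_ltP ss); rewrite size_drop.
  have [E|lt] := le_agree_or (size a - i) (ltW up); last first.
    apply: lt_within_agree lt; apply: agree_sym; first exact: drop_agree.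
    exact: take_agree.
  have := up; rewrite -(lt_shift E) shift_seqD subnKC; last exact: ltnW.
  rewrite shift_periodic => /lt_trans.
  have /h[up' _] : (0 < size a - i < size a)%N by lia.
  by move=> /(_ _ up'); rewrite ltxx.
Qed.

End Words.

(** Every sequence met inside the basic interval of an admissible word [a] is
    a concatenation of the blocks [a], [a^+] and their reflections.  It is read
    off a walk [st : nat -> bool]: the [k]-th block is reflected when [st k]
    holds, and it is incremented (before reflection) when the walk changes
    state.  The lexicographic order of such sequences is that of the walks, so
    that all comparisons between [a^oo] (the constant walk), [a^+ refl(a)^oo]
    (the walk [0 1 1 1 ...]), [theta a] (the Thue-Morse walk) and other words
    built from [a] become comparisons of short 0-1 words. *)
Section Codes.
Local Open Scope nat_scope.
Variables (M : nat) (a : word M).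
Hypothesis adm : adm_spec a.
Implicit Types (d e : Omega M) (st : nat -> bool) (n k i : nat).

Let m := size a.
Let A i : 'I_M.+1 := nth ord0 a i.
Let P i : 'I_M.+1 := nth ord0 (incr_last a) i.
Let w := periodic a.

Lemma size_a_gt0 : (0 < m)%N. Proof. exact: adm_size. Qed.
Hint Resolve size_a_gt0 : core.

Lemma size_plus : size (incr_last a) = m.
Proof. exact: size_incr_last. Qed.

Lemma plusE i : (i < m)%N -> (P i : nat) = (A i + (i == m.-1))%N.
Proof. by move=> im; apply: nth_incr_last => //; exact: adm_last. Qed.

Lemma plus_agree : agree m.-1 P A.
Proof.
move=> i im; apply/ord_inj; rewrite plusE; last by lia.
by rewrite ltn_eqF// addn0.
Qed.

Definition block_digit (s b : bool) i : 'I_M.+1 :=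
  let c := if b then P i else A i in if s then rev_ord c else c.

Definition code st : Omega M := fun n =>
  block_digit (st (n %/ m)) (st (n %/ m) (+) st (n %/ m).+1) (n %% m).

Lemma code_block st k i : (i < m)%N ->
  code st (k * m + i) = block_digit (st k) (st k (+) st k.+1) i.
Proof.
by move=> im; rewrite /code divnMDl// divn_small// addn0 modnMDl modn_small.
Qed.

Lemma code_refl st : refl_seq (code st) = code (fun k => ~~ st k).
Proof.
apply/funext => i; rewrite refl_seqE /code /block_digit.
by case: (st _); case: (st _) => //=; rewrite rev_ordK.
Qed.

Lemma shift_code st k : shift_seq (k * m) (code st) = code (fun j => st (k + j)%N).
Proof.
apply/funext => i; rewrite shift_seqE {1}/code divnMDl// modnMDl.
by rewrite /code addnS.
Qed.

Lemma code_const : code (fun=> false) = w.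
Proof. by apply/funext => i. Qed.

(** The first block of a walk that starts in state 0 agrees with [a] except
    possibly in its last digit. *)
Lemma code_head st : st 0%N = false -> agree m.-1 (code st) A.
Proof.
move=> s0 i im; have := @code_block st 0 i; rewrite mul0n add0n => ->; last by lia.
by rewrite s0 /block_digit; case: (st _) => //=; rewrite plus_agree.
Qed.

Lemma lt_within_code st st' n : (forall i, (i <= n)%N -> st i = st' i) ->
  st n.+1 = false -> st' n.+1 = true -> lt_within (n.+1 * m) (code st) (code st').
Proof.
move=> ss f t; have m0 := size_a_gt0; exists (n * m + m.-1)%N; first by rewrite mulSn; lia.
have lt : (A m.-1 < P m.-1)%N by rewrite plusE ?eqxx; lia.
split=> [i|]; last first.
  rewrite !code_block; try lia.
  rewrite ss// f t /block_digit; case: (st' n) => //=.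
  by have := ltn_ord (P m.-1); lia.
have [im|im] := ltnP i (n * m).
  move=> _; rewrite (divn_eq i m) !code_block ?ltn_mod//.
  have ik : (i %/ m < n)%N by rewrite ltn_divLR.
  by rewrite !ss//; lia.
move=> iL; have -> : i = (n * m + (i - n * m))%N by lia.
rewrite !code_block; try lia.
rewrite ss// /block_digit f t.
by case: (st' n) => /=; rewrite plus_agree//; lia.
Qed.

Lemma lt_code st st' n : (forall i, (i <= n)%N -> st i = st' i) ->
  st n.+1 = false -> st' n.+1 = true -> (code st < code st')%O.
Proof. by move=> ss f t; exact/lt_within_lt/(lt_within_code ss f t). Qed.

Lemma le_code st st' : st 0%N = st' 0%N ->
  (forall n, (forall i, (i <= n)%N -> st i = st' i) ->
     st n.+1 = true -> st' n.+1 = true) -> (code st <= code st')%O.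
Proof.
move=> s0 h.
have [[n ne]|/forallNP eqs] := pselect (exists n, st n != st' n); last first.
  suff -> : st = st' by [].
  by apply/funext => n; apply/eqP; have /negP/negPn := eqs n.
have ex : exists n, st n != st' n by exists n.
case: (ex_minnP ex) => -[|k] nek mink; first by rewrite s0 eqxx in nek.
have eqs i : (i <= k)%N -> st i = st' i.
  by move=> ik; apply/eqP/negPn/negP => /mink; rewrite ltnNge ik.
move: nek (h k eqs); case sk : (st k.+1); case sk' : (st' k.+1) => // _.
  by move=> /(_ isT).
by move=> _; apply/ltW/(lt_code eqs).
Qed.

Lemma refl_le_periodic : (refl_seq w <= w)%O.
Proof.
have [m1|m1] := leqP m 1.
  have m1' : m = 1%N by have := size_a_gt0; lia.
  have wE i : w i = A 0 by rewrite /w /periodic -/m m1' modn1.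
  have : (rev_ord (A 0%N) <= A 0%N)%N.
    by have := adm_first adm; rewrite -/m m1' rev_digitE -/(A 0); lia.
  rewrite leq_eqVlt => /predU1P[/ord_inj e|lt].
    suff -> : refl_seq w = w by [].
    by apply/funext => i; rewrite refl_seqE wE.
  by apply/ltW/lt_head; rewrite refl_seqE wE.
apply/ltW/lt_head; rewrite refl_seqE rev_digitE.
have w0 : w 0%N = A 0 by rewrite /w periodic_agree.
have mm : (0 < m.-1 < m)%N by lia.
have := adm_upper adm mm; rewrite -/m -/w; have -> : (m - m.-1 = 1)%N by lia.
move=> [j j1 [_]]; have -> : j = 0%N by lia.
rewrite shift_seqE addn0 w0 /w periodic_agree -/(A m.-1); last by rewrite -/m; lia.
by have := adm_first adm; rewrite -/m -/(A 0) -/(A m.-1); lia.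
Qed.

(** Walks starting in state 1 give sequences below those starting in state 0;
    equality can only occur for constant walks, when [a] is its own reflection. *)
Lemma le_code01 st st' : st 0%N = true -> st' 0%N = false ->
  (code st <= refl_seq w)%O /\ (w <= code st')%O.
Proof.
move=> s1 s0; rewrite -code_const; split; last exact: le_code.
by rewrite code_refl; apply: le_code.
Qed.

Lemma lt_code01 st st' : st 0%N = true -> st' 0%N = false ->
  st' 1%N = true -> (code st < code st')%O.
Proof.
move=> s1 s0 t1; have [le _] := le_code01 s1 s0.
apply: le_lt_trans le _; apply: le_lt_trans refl_le_periodic _.
by rewrite -code_const; apply: (@lt_code _ _ 0) => // i; rewrite leqn0 => /eqP->.
Qed.

Lemma plus_seq_code : plus_seq a = code (fun k => k != 0%N).
Proof.
apply/funext => i; rewrite /plus_seq /prepend size_plus.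
have [im|im] := ltnP i m.
  by have := @code_block (fun k => k != 0%N) 0 i im; rewrite mul0n add0n => ->.
rewrite periodic_refl_word// -/w -code_const code_refl.
have := shift_code (fun k => k != 0%N) 1; rewrite mul1n => /(congr1 (fun f => f (i - m)%N)).
by rewrite shift_seqE subnKC// => ->.
Qed.

(** The suffix of [a] is at least the reflected prefix, and raising its last
    digit leaves no room for equality. *)
Lemma plus_gt i : (0 < i < m)%N -> lt_within (m - i) (refl_seq w) (shift_seq i P).
Proof.
move=> /[dup] im /(adm_lower adm); rewrite -/m -/w => low.
have lastlt k : (m - i <= k.+1)%N -> (k < m - i)%N -> (w (i + k) < P (i + k)%N)%N.
  move=> k1 k2; have -> : (i + k = m.-1)%N by lia.
  by rewrite plusE ?eqxx /w ?periodic_agree -/m -/(A _); lia.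
have shP k : (k.+1 < m - i)%N -> shift_seq i w k = shift_seq i P k.
  move=> kL; rewrite !shift_seqE plus_agree; last by lia.
  by rewrite /w periodic_agree// -/m; lia.
case: low => [ag|[k kL [pre lt]]].
  exists (m - i).-1; first by lia.
  split; last by rewrite ag ?shift_seqE; [apply: lastlt; lia|lia].
  by move=> j jL; rewrite ag ?shP//; lia.
exists k => //; split; first by move=> j jk; rewrite pre// shP//; lia.
have [kL'|kL'] := ltnP k.+1 (m - i); first by rewrite -shP.
by apply: ltn_trans lt _; rewrite !shift_seqE; exact: lastlt.
Qed.

Lemma plus_le i : (0 < i < m)%N ->
  agree (m - i) (shift_seq i P) w \/ lt_within (m - i) (shift_seq i P) w.
Proof.
move=> /[dup] im /(adm_upper adm); rewrite -/m -/w => -[k kL [pre lt]].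
have shP j : (j.+1 < m - i)%N -> shift_seq i w j = shift_seq i P j.
  move=> jL; rewrite !shift_seqE plus_agree; last by lia.
  by rewrite /w periodic_agree// -/m; lia.
have pre' : agree k (shift_seq i P) w.
  by move=> j jk; rewrite -shP ?pre//; lia.
have [kL'|kL'] := ltnP k.+1 (m - i); first by right; exists k; rewrite -?shP.
have kE : (i + k = m.-1)%N by lia.
have Pk : (shift_seq i P k : nat) = (w (i + k)%N).+1.
  rewrite shift_seqE kE plusE ?eqxx ?addn1; last by lia.
  by rewrite /w periodic_agree// -/m; lia.
move: lt; rewrite shift_seqE -Pk leq_eqVlt => /orP[/eqP e|lt]; last by right; exists k.
left => j jL; have [jk|jk] := ltnP j k; first exact: pre'.
by have -> : j = k by [lia]; apply/ord_inj.
Qed.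

Lemma lt_within_cat n k d e : agree n d e ->
  lt_within k (shift_seq n d) (shift_seq n e) -> lt_within (n + k) d e.
Proof.
move=> ag [j jk [pre lt]]; exists (n + j)%N; first by rewrite ltn_add2l.
split=> // i ij; have [/ag//|ni] := ltnP i n.
by have := pre (i - n)%N; rewrite !shift_seqE subnKC//; apply; lia.
Qed.

Lemma code_inner0 st i : st 0%N = false -> (0 < i < m)%N ->
  lt_within m (shift_seq i (code st)) P /\ lt_within m (refl_seq P) (shift_seq i (code st)).
Proof.
move=> s0 im; have := shift_code st 1; rewrite mul1n => sh.
have im' : (0 < m - i < m)%N by lia.
have mi : (m - i <= m.-1)%N by lia.
have i1 : (i <= m.-1)%N by lia.
have mm : m = (m - i + i)%N by lia.
have Pw : agree m.-1 P w.
  by apply: agree_trans plus_agree _ => j jm; rewrite /w periodic_agree// -/m; lia.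
have Pgt := plus_gt im'; rewrite subKn in Pgt; last by lia.
have tailE : shift_seq (m - i) (shift_seq i (code st)) = code (fun j => st (1 + j)%N).
  by rewrite shift_seqD subnKC ?sh//; lia.
have wA : agree m w A by exact: periodic_agree.
case s1 : (st 1%N).
- have ag : agree (m - i) (shift_seq i P) (shift_seq i (code st)).
    move=> j jL; rewrite !shift_seqE.
    by have := @code_block st 0 (i + j); rewrite mul0n add0n s0 s1 => -> //; lia.
  have ag1 : agree i (refl_seq w) (code (fun j => st (1 + j)%N)).
    rewrite -[code _]refl_seqK code_refl; apply: agree_refl_seq.
    apply: agree_sym; apply: agreeW i1 _; apply: agree_trans (code_head _) _ => //=.
      by rewrite s1.
    by apply: agree_sym; apply: agreeW wA; lia.
  split.
  + have [ag'|lt] := plus_le im.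
      rewrite {1}mm; apply: lt_within_cat.
        apply: agree_trans (agree_sym ag) _; apply: agree_trans ag' _.
        by apply: agree_sym; exact: agreeW Pw.
      by rewrite tailE; apply: lt_within_agree Pgt.
    apply: (@lt_withinW _ _ (m - i)); first by lia.
    by apply: lt_within_agree lt => //; apply: agree_sym; exact: agreeW Pw.
  + have lt := plus_gt im.
    apply: (@lt_withinW _ _ (m - i)); first by lia.
    apply: lt_within_agree lt => //; apply: agree_refl_seq.
    by apply: agree_sym; exact: agreeW Pw.
- have ag : agree (m - i) (shift_seq i w) (shift_seq i (code st)).
    move=> j jL; rewrite !shift_seqE wA; last by lia.
    by have := @code_block st 0 (i + j); rewrite mul0n add0n s0 s1 => -> //; lia.
  split.
  + have := adm_upper adm im; rewrite -/m -/w => lt.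
    apply: (@lt_withinW _ _ (m - i)); first by lia.
    by apply: lt_within_agree lt => //; apply: agree_sym; exact: agreeW Pw.
  + have := adm_lower adm im; rewrite -/m -/w => -[ag'|lt]; last first.
      apply: (@lt_withinW _ _ (m - i)); first by lia.
      apply: lt_within_agree lt => //; apply: agree_refl_seq.
      by apply: agree_sym; exact: agreeW Pw.
    rewrite {1}mm; apply: lt_within_cat.
      apply: agree_trans ag; apply: agree_trans _ ag'; apply: agree_refl_seq.
      exact: agreeW Pw.
    rewrite tailE shift_refl; move/lt_within_refl: Pgt; rewrite refl_seqK.
    apply: lt_within_agree => //; apply: agreeW i1 _.
    apply: (agree_trans (agreeW (leq_pred _) wA)).
    by apply: agree_sym; exact: code_head.
Qed.

(** Inside a block admissibility alone decides, whatever the walk: the rest of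
    the block and the beginning of the next one fill a window of length [m]. *)
Lemma code_inner st k i e : (0 < i < m)%N -> agree m e P ->
  (shift_seq (k * m + i) (code st) < e)%O /\
  (refl_seq e < shift_seq (k * m + i) (code st))%O.
Proof.
move=> im eP; rewrite -shift_seqD shift_code.
have key st' : st' 0%N = false -> (shift_seq i (code st') < e)%O /\
    (refl_seq e < shift_seq i (code st'))%O.
  move=> s0; have [lt1 lt2] := code_inner0 s0 im.
  split; apply/(@lt_within_lt _ m).
    by apply: lt_within_agree lt1 => //; exact: agree_sym.
  by apply: lt_within_agree lt2 => //; apply/agree_refl_seq/agree_sym.
case s0 : (st k); last by apply: key; rewrite addn0.
have := key (fun j => ~~ st (k + j)%N); rewrite addn0 s0 => /(_ erefl).
by rewrite -code_refl shift_refl refl_lt refl_ltC => -[? ?]; split.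
Qed.

Lemma code_start st : st 0%N = false -> st 1%N = true -> agree m (code st) P.
Proof.
move=> s0 s1 i im; have := @code_block st 0 i im.
by rewrite mul0n add0n s0 s1 => ->.
Qed.

(** Combines the two kinds of positions: inside a block and at its start. *)
Lemma code_tails st st' n : st' 0%N = false -> st' 1%N = true ->
  (forall k, st k = false -> (code (fun j => st (k + j)%N) <= code st')%O) ->
  (shift_seq n (code st) <= code st')%O.
Proof.
move=> s0 s1 h; have [i0|i0] := posnP (n %% m).
  rewrite (divn_eq n m) i0 addn0 shift_code; case sk : (st (n %/ m)); last exact: h.
  by apply/ltW/lt_code01 => //; rewrite addn0.
rewrite (divn_eq n m); apply/ltW.
by case: (@code_inner st (n %/ m) (n %% m) (code st')) => //;
  [rewrite i0 ltn_mod|exact: code_start].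
Qed.

Lemma shift_plus_seq : shift_seq m (plus_seq a) = refl_seq w.
Proof. by rewrite -[in LHS]size_plus shift_prepend periodic_refl_word. Qed.

Lemma plus_seq_agree : agree m (plus_seq a) P.
Proof. by have := @prepend_agree _ (incr_last a) (periodic (refl_word a)); rewrite size_plus. Qed.

Lemma decode_step d : (w <= d)%O -> (d <= plus_seq a)%O ->
  (agree m d A /\ (w <= shift_seq m d)%O) \/
  (agree m d P /\ (shift_seq m d <= refl_seq w)%O).
Proof.
move=> wd dR; have m0 := size_a_gt0.
have wA : agree m w A by exact: periodic_agree.
have RP := plus_seq_agree.
have wR : agree m.-1 w (plus_seq a).
  apply: (agree_trans (agreeW (leq_pred _) wA)); apply: agree_trans (agree_sym plus_agree) _.
  by apply: agree_sym; apply: agreeW RP; exact: leq_pred.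
have wd' := agree_squeeze wd dR wR.
have dR' : agree m.-1 d (plus_seq a) by apply: agree_trans (agree_sym wd') wR.
have h1 : (w m.-1 <= d m.-1)%N.
  have : (shift_seq m.-1 w <= shift_seq m.-1 d)%O by rewrite le_shift.
  by move/le_head; rewrite !shift_seqE addn0.
have h2 : (d m.-1 <= plus_seq a m.-1)%N.
  have : (shift_seq m.-1 d <= shift_seq m.-1 (plus_seq a))%O by rewrite le_shift.
  by move/le_head; rewrite !shift_seqE addn0.
have ext f : agree m.-1 d f -> (d m.-1 : nat) = f m.-1 -> agree m d f.
  move=> ag e i im; have [/ag//|i1] := ltnP i m.-1.
  by have -> : i = m.-1 by [lia]; apply/ord_inj.
rewrite wA in h1; last by lia.
rewrite RP in h2; last by lia.
have Pm : (P m.-1 : nat) = (A m.-1).+1 by rewrite plusE ?eqxx ?addn1//; lia.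
have [e|lt] : (d m.-1 : nat) = A m.-1 \/ (d m.-1 : nat) = P m.-1 by lia.
- have ag : agree m d w by apply: ext => //; [exact: agree_sym|rewrite wA//; lia].
  left; split; first exact: agree_trans ag wA.
  by rewrite -[w in leLHS]shift_periodic -/m le_shift//; exact: agree_sym.
- have ag : agree m d (plus_seq a) by apply: ext => //; rewrite RP//; lia.
  right; split; first exact: agree_trans ag RP.
  by rewrite -shift_plus_seq le_shift.
Qed.

(** By [decode_step] such a sequence starts with [a] or [a^+], and what follows
    lies between the same bounds or between their reflections; so the blocks
    can be read off one after the other. *)
Lemma decode d : (w <= d)%O -> (d <= plus_seq a)%O ->
  (forall n, (refl_seq d <= shift_seq n d)%O /\ (shift_seq n d <= d)%O) ->
  exists2 st, st 0%N = false & d = code st.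
Proof.
move=> wd dR dd; have m0 := size_a_gt0.
pose st := fix st k := if k is j.+1 then
  st j (+) (d (j * m + m.-1)%N != (if st j then rev_ord (A m.-1) else A m.-1)) else false.
have stS k : st k.+1 = st k (+)
    (d (k * m + m.-1)%N != (if st k then rev_ord (A m.-1) else A m.-1)) by [].
have AP : A m.-1 != P m.-1 by rewrite -val_eqE/= plusE ?eqxx//; lia.
have inv k : if st k then (refl_seq (plus_seq a) <= shift_seq (k * m) d)%O /\
      (shift_seq (k * m) d <= refl_seq w)%O
    else (w <= shift_seq (k * m) d)%O /\ (shift_seq (k * m) d <= plus_seq a)%O.
  elim: k => [|k ih]; first by rewrite mul0n shift_seq0.
  have R1 n : (shift_seq n d <= plus_seq a)%O by apply: le_trans dR; case: (dd n).
  have R2 n : (refl_seq (plus_seq a) <= shift_seq n d)%O.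
    by apply: (@le_trans _ _ (refl_seq d)); [rewrite refl_le|case: (dd n)].
  have sE : shift_seq m (shift_seq (k * m) d) = shift_seq (k.+1 * m) d.
    by rewrite shift_seqD mulSn addnC.
  have dE e : agree m (shift_seq (k * m) d) e -> d (k * m + m.-1)%N = e m.-1.
    by move=> <-; rewrite ?shift_seqE//; lia.
  rewrite stS; case: (st k) ih => -[h1 h2].
    have := @decode_step (refl_seq (shift_seq (k * m) d)).
    rewrite le_reflC refl_leC => /(_ h2 h1); rewrite shift_refl sE.
    move=> [][ag le].
      rewrite (dE (refl_seq A)); last first.
        by rewrite -[shift_seq _ _]refl_seqK; exact: agree_refl_seq.
      by rewrite refl_seqE eqxx/=; split; [|rewrite le_reflC].
    rewrite (dE (refl_seq P)); last first.
      by rewrite -[shift_seq _ _]refl_seqK; exact: agree_refl_seq.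
    rewrite refl_seqE (inj_eq rev_ord_inj) eq_sym AP/=; split; last exact: R1.
    by rewrite -refl_le.
  case: (decode_step h1 h2) => -[ag le]; rewrite sE in le.
    by rewrite (dE _ ag) eqxx/=.
  by rewrite (dE _ ag) eq_sym AP/=.
exists st => //; apply/funext => i; rewrite (divn_eq i m); set k := (i %/ m)%N.
have im : (i %% m < m)%N by rewrite ltn_mod.
rewrite code_block// stS addbA addbb addFb.
have := inv k; rewrite -shift_seqE.
have dE e : agree m (shift_seq (k * m) d) e -> d (k * m + m.-1)%N = e m.-1.
  by move=> <-; rewrite ?shift_seqE//; lia.
case: (st k) => -[h1 h2].
  have := @decode_step (refl_seq (shift_seq (k * m) d)).
  rewrite le_reflC refl_leC => /(_ h2 h1) [][/agree_refl_seq ag _];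
    rewrite refl_seqK in ag; rewrite ag// (dE _ ag) !refl_seqE /block_digit.
    by rewrite eqxx.
  by rewrite (inj_eq rev_ord_inj) eq_sym AP.
case: (decode_step h1 h2) => -[ag le]; rewrite ag// (dE _ ag) /block_digit.
  by rewrite eqxx.
by rewrite eq_sym AP.
Qed.

End Codes.

(** ** Words made of blocks and the limit sequence [theta] *)

Section Renormalization.
Local Open Scope nat_scope.
Variable M : nat.
Implicit Types (a u v : word M) (d e : Omega M) (st : nat -> bool) (n k i : nat).

Definition block a (s b : bool) : word M :=
  let u := if b then incr_last a else a in if s then refl_word u else u.

(** The finite counterpart of [code], for a walk that starts at [s0] and goes on
    through [s]. *)
Fixpoint blocks a (s0 : bool) (s : seq bool) : word M :=
  if s is s1 :: s' then block a s0 (s0 (+) s1) ++ blocks a s1 s' else [::].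

Lemma size_block a s b : 0 < size a -> size (block a s b) = size a.
Proof. by case: s; case: b => a0; rewrite /block ?size_refl_word ?size_incr_last. Qed.

Lemma nth_block a s b i : 0 < size a -> i < size a ->
  nth ord0 (block a s b) i = block_digit a s b i.
Proof.
move=> a0 ia; rewrite /block /block_digit.
by case: s; case: b => //; rewrite nth_refl_word// size_incr_last.
Qed.

Lemma size_blocks a s0 s : 0 < size a -> size (blocks a s0 s) = size s * size a.
Proof.
move=> a0; elim: s s0 => //= s1 s ih s0.
by rewrite size_cat size_block// ih mulSn.
Qed.

Lemma blocks_code a s0 s st : adm_spec a ->
  (forall i, i <= size s -> st i = nth false (s0 :: s) i) ->
  agree (size s * size a) (nth ord0 (blocks a s0 s)) (code a st).
Proof.
move=> adm; have a0 := adm_size adm.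
elim: s s0 st => [|s1 s ih] s0 st h i; first by rewrite mul0n.
rewrite /= mulSn nth_cat size_block// => iL.
case: ltnP => ia.
  rewrite nth_block//; have := @code_block _ a adm st 0 i ia.
  by rewrite mul0n add0n => ->; rewrite (h 0)//= (h 1).
rewrite (ih _ (fun j => st (1 + j))); first last.
- by rewrite ltn_subLR.
- by move=> j js; rewrite (h (1 + j)).
by rewrite -(shift_code adm _ 1) shift_seqE mul1n subnKC.
Qed.

Lemma prepend_blocks a s0 s st : adm_spec a -> st 0 = last s0 s ->
  prepend (blocks a s0 s) (code a st) =
  code a (fun i => if i <= size s then nth false (s0 :: s) i else st (i - size s)).
Proof.
move=> adm st0; have a0 := adm_size adm; set st' := fun i => _; apply/funext => i; rewrite /prepend.
case: ltnP; rewrite size_blocks// => iL.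
  by rewrite (@blocks_code _ _ _ st')// => j js; rewrite /st' js.
have -> : i = (size s * size a + (i - size s * size a)) by lia.
rewrite addKn -shift_seqE shift_code//.
suff -> : st = fun j => st' (size s + j) by [].
apply/funext => j; rewrite /st'; case: j => [|j]; first by rewrite addn0 leqnn nth_last /= st0.
by rewrite addnS ltnNge leq_addr /= -addnS addKn.
Qed.

(** [dbl a] is [a^+ refl(a^+)] and generates the next basic interval in the
    period doubling cascade that leads to [theta a].  [trip a] is
    [a^+ refl(a) refl(a^+)]; its basic interval lies just to the right of
    [theta a], and replacing [a] by its doublings moves it towards [theta a]. *)
Definition dbl a : word M := blocks a false [:: true; false].
Definition trip a : word M := blocks a false [:: true; true; false].

Lemma size_dbl a : 0 < size a -> size (dbl a) = 2 * size a.
Proof. by move=> a0; rewrite size_blocks. Qed.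

Lemma size_trip a : 0 < size a -> size (trip a) = 3 * size a.
Proof. by move=> a0; rewrite size_blocks. Qed.

Lemma incr_refl_incr a : adm_spec a -> incr_last (refl_word (incr_last a)) = refl_word a.
Proof.
move=> adm; have a0 := adm_size adm; have al := adm_last adm.
have t0 : size (refl_word (incr_last a)) = size a by rewrite size_refl_word size_incr_last.
apply: (@eq_from_nth _ ord0); first by rewrite size_incr_last ?t0// size_refl_word.
rewrite size_incr_last ?t0// => i ia; apply/ord_inj.
have lastE : (nth ord0 (refl_word (incr_last a)) (size a).-1 : nat) =
    (M - (nth ord0 a (size a).-1).+1).
  rewrite nth_refl_word ?size_incr_last; [|lia..].
  by rewrite rev_digitE nth_incr_last ?eqxx ?addn1//; lia.
rewrite nth_incr_last ?t0//; last by rewrite lastE; lia.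
rewrite !nth_refl_word ?size_incr_last// !rev_digitE nth_incr_last//.
case: eqP => [->|_]; last by rewrite !addn0.
by lia.
Qed.

Lemma incr_refl_refl a : incr_last (refl_word (refl_word a)) = incr_last a.
Proof. by rewrite refl_wordK. Qed.

Lemma incr_last_dbl a : adm_spec a ->
  incr_last (dbl a) = blocks a false [:: true; true].
Proof.
move=> adm; have a0 := adm_size adm.
rewrite /dbl /= cats0 incr_last_cat ?size_refl_word ?size_incr_last//.
by rewrite /= incr_refl_incr// cats0.
Qed.

Lemma incr_last_trip a : adm_spec a ->
  incr_last (trip a) = blocks a false [:: true; true; true].
Proof.
move=> adm; have a0 := adm_size adm.
rewrite /trip /= !cats0 !incr_last_cat ?size_cat ?size_refl_word ?size_incr_last ?addn_gt0 ?a0//.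
by rewrite /= incr_refl_incr.
Qed.

Lemma periodic_dbl a : adm_spec a -> periodic (dbl a) = code a odd.
Proof.
move=> adm; have a0 := adm_size adm; apply/esym/periodic_eq.
- by rewrite size_dbl// muln_gt0.
- by rewrite size_dbl//; apply: agree_sym; apply: (@blocks_code a false [:: true; false]) => // -[|[|[]]].
- rewrite size_dbl// shift_code//; congr (code a _); apply/funext => j.
  by rewrite oddD.
Qed.

Lemma periodic_trip a : adm_spec a -> periodic (trip a) = code a (fun k => k %% 3 != 0).
Proof.
move=> adm; have a0 := adm_size adm; apply/esym/periodic_eq.
- by rewrite size_trip// muln_gt0.
- by rewrite size_trip//; apply: agree_sym; apply: (@blocks_code a false [:: true; true; false]) => // -[|[|[|[]]]].
- rewrite size_trip// shift_code//; congr (code a _).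
Qed.

Lemma admissible_dbl a : adm_spec a -> admissible (dbl a).
Proof.
move=> adm; have a0 := adm_size adm.
apply: (@periodic_admissible _ _ (periodic (dbl a))) => //; first by rewrite size_dbl//; lia.
rewrite size_dbl// periodic_dbl// => i /andP[i0 iL].
rewrite (divn_eq i (size a)); have [r0|r0] := posnP (i %% size a); last first.
  have [||? ?] := @code_inner _ _ adm odd (i %/ size a) (i %% size a) (code a odd).
  - by rewrite r0 ltn_mod.
  - exact: code_start.
  by split => //; exact: ltW.
rewrite r0 addn0 shift_code//; have -> : i %/ size a = 1.
  have : i %/ size a < 2 by rewrite ltn_divLR.
  by have := divn_eq i (size a); rewrite r0; case: (i %/ size a) => [|[]]//; lia.
split; first by apply: (lt_code01 adm).
by rewrite code_refl; apply: (le_code adm) => //= n _; case: (odd n).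
Qed.

Lemma admissible_trip a : adm_spec a -> admissible (trip a).
Proof.
move=> adm; have a0 := adm_size adm.
apply: (@periodic_admissible _ _ (periodic (trip a))) => //; first by rewrite size_trip//; lia.
rewrite size_trip// periodic_trip// => i /andP[i0 iL].
set st := fun k => k %% 3 != 0.
rewrite (divn_eq i (size a)); have [r0|r0] := posnP (i %% size a); last first.
  have [||? ?] := @code_inner _ _ adm st (i %/ size a) (i %% size a) (code a st).
  - by rewrite r0 ltn_mod.
  - exact: code_start.
  by split => //; exact: ltW.
rewrite r0 addn0 shift_code//; set k := i %/ size a.
have kE : k = 1 \/ k = 2.
  have : k < 3 by rewrite ltn_divLR.
  by have := divn_eq i (size a); rewrite -/k r0; case: (k) => [|[|[]]]//; lia.
split; first by apply: (lt_code01 adm) => //; case: kE => ->.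
apply/ltW; rewrite code_refl; case: kE => ->.
  by apply: (@lt_code _ _ adm _ _ 0) => // -[].
by apply: (@lt_code _ _ adm _ _ 1) => // -[|[]].
Qed.

Lemma adm_spec_dbl a : adm_spec a -> adm_spec (dbl a).
Proof. by move/admissible_dbl/admissible_spec. Qed.

Lemma adm_spec_iter_dbl k a : adm_spec a -> adm_spec (iter k dbl a).
Proof. by move=> adm; elim: k => //= k; exact: adm_spec_dbl. Qed.

Lemma size_iter_dbl k a : adm_spec a -> size (iter k dbl a) = 2 ^ k * size a.
Proof.
move=> adm; elim: k => [|k ih] /=; first by rewrite mul1n.
by rewrite size_dbl ?ih ?expnS ?mulnA// muln_gt0 expn_gt0 (adm_size adm).
Qed.

Lemma plus_seq_dbl_lt a : adm_spec a -> (plus_seq (dbl a) < plus_seq a)%O.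
Proof.
move=> adm; have a0 := adm_size adm; rewrite /plus_seq incr_last_dbl//.
rewrite periodic_refl_word ?size_dbl ?muln_gt0// periodic_dbl// code_refl.
rewrite prepend_blocks// -/(plus_seq a) plus_seq_code//.
by apply: (@lt_code _ _ adm _ _ 2) => // -[|[|[]]].
Qed.

Lemma plus_seq_trip_lt a : adm_spec a -> (plus_seq (trip a) < plus_seq a)%O.
Proof.
move=> adm; have a0 := adm_size adm; rewrite /plus_seq incr_last_trip//.
rewrite periodic_refl_word ?size_trip ?muln_gt0// periodic_trip// code_refl.
rewrite prepend_blocks// -/(plus_seq a) plus_seq_code//.
by apply: (@lt_code _ _ adm _ _ 3) => // -[|[|[|[]]]].
Qed.

Lemma plus_seq_dbl_lt_trip a : adm_spec a -> (plus_seq (dbl a) < periodic (trip a))%O.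
Proof.
move=> adm; have a0 := adm_size adm; rewrite /plus_seq incr_last_dbl//.
rewrite periodic_refl_word ?size_dbl ?muln_gt0// periodic_dbl// code_refl.
rewrite prepend_blocks// periodic_trip//.
by apply: (@lt_code _ _ adm _ _ 4) => // -[|[|[|[|[]]]]].
Qed.

Lemma periodic_lt_plus a : adm_spec a -> (periodic a < plus_seq a)%O.
Proof.
move=> adm; rewrite plus_seq_code// -code_const.
by apply: (@lt_code _ _ adm _ _ 0) => // -[].
Qed.

Lemma size_theta_word a k : 0 < size a -> size (theta_word a k) = 2 ^ k * size a.
Proof.
move=> a0; elim: k => [|k ih] /=; first by rewrite size_incr_last// mul1n.
rewrite size_cat size_incr_last size_refl_word ih.
  by rewrite expnS -mulnA mul2n addnn.
by rewrite muln_gt0 expn_gt0.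
Qed.

Lemma theta_word_prefix a k l i : (k <= l)%N -> i < size (theta_word a k) ->
  nth ord0 (theta_word a l) i = nth ord0 (theta_word a k) i.
Proof.
move=> kl ik; have : forall j, nth ord0 (theta_word a (k + j)) i = nth ord0 (theta_word a k) i
    /\ i < size (theta_word a (k + j)).
  elim=> [|j [ih1 ih2]]; first by rewrite addn0.
  by rewrite addnS /= nth_cat ih2 size_cat ltn_addr.
by move=> /(_ (l - k)) []; rewrite subnKC.
Qed.

Lemma theta_agree a k : 0 < size a -> agree (2 ^ k * size a) (theta a) (nth ord0 (theta_word a k)).
Proof.
move=> a0 i ik; rewrite /theta.
have ii : i < 2 ^ i * size a.
  by apply: leq_trans (ltn_expl i (isT : 1 < 2)) _; rewrite leq_pmulr.
have [kl|lk] := leqP k i; first by rewrite (@theta_word_prefix _ k)// size_theta_word.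
by rewrite (@theta_word_prefix _ i k)// ?size_theta_word// ltnW.
Qed.

Lemma theta_word_dbl a k : 0 < size a -> theta_word (dbl a) k = theta_word a k.+1.
Proof.
move=> a0; elim: k => [|k ih]; last by rewrite [LHS]/= ih.
by rewrite /= /dbl /= cats0 incr_last_cat// size_refl_word size_incr_last.
Qed.

Lemma theta_dbl a : 0 < size a -> theta (dbl a) = theta a.
Proof.
move=> a0; apply/funext => i; rewrite {1}/theta theta_word_dbl//.
rewrite -(@theta_agree a i.+1)//.
apply: (@leq_trans (2 ^ i.+1)); last by rewrite leq_pmulr.
by apply: ltn_trans (ltn_expl _ _).
Qed.

Lemma theta_iter_dbl k a : adm_spec a -> theta (iter k dbl a) = theta a.
Proof.
move=> adm; elim: k => //= k <-; rewrite theta_dbl//.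
by apply: adm_size; exact: adm_spec_iter_dbl.
Qed.

(** The first nine states of the Thue-Morse walk, which determine the first eight
    blocks of [theta a]. *)
Definition thue_morse8 := nth true [:: false; true; true; false; true; false; false; true; true].

Lemma theta_word3 a : adm_spec a ->
  theta_word a 3 = blocks a false [:: true; true; false; true; false; false; true; true].
Proof.
move=> adm; have a0 := adm_size adm.
have t0 : 0 < size (incr_last a) by rewrite size_incr_last.
have w1 : theta_word a 1 = incr_last a ++ refl_word a by rewrite /= incr_refl_incr.
have w2 : theta_word a 2 = incr_last a ++ refl_word a ++ refl_word (incr_last a) ++ incr_last a.
  rewrite [LHS]/= -[incr_last a ++ incr_last _]/(theta_word a 1) w1.
  rewrite /refl_word map_cat -!/(refl_word _) incr_last_cat ?size_refl_word//.
  by rewrite incr_refl_refl catA.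
rewrite -[LHS]/(theta_word a 2 ++ incr_last (refl_word (theta_word a 2))) w2.
rewrite /refl_word !map_cat -!/(refl_word _) !incr_last_cat ?size_cat ?size_refl_word ?addn_gt0 ?a0 ?t0//.
by rewrite incr_refl_incr// !refl_wordK /= cats0 -!catA.
Qed.

Lemma theta_code a : adm_spec a -> agree (8 * size a) (theta a) (code a thue_morse8).
Proof.
move=> adm; have a0 := adm_size adm.
apply: (agree_trans (@theta_agree a 3 a0)); rewrite theta_word3//.
apply: (@blocks_code a false [:: true; true; false; true; false; false; true; true]) => //.
by move=> -[|[|[|[|[|[|[|[|[]]]]]]]]].
Qed.

Lemma theta_gt a : adm_spec a -> (periodic a < theta a)%O.
Proof.
move=> adm; have := theta_code adm => /agree_sym ag.
apply/(@lt_within_lt _ (1 * size a)); rewrite -code_const.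
apply: lt_within_agree (@lt_within_code _ _ adm _ thue_morse8 0 _ _ _) => //.
  by apply: agreeW ag; lia.
by case.
Qed.

Lemma theta_lt_plus a : adm_spec a -> (theta a < plus_seq a)%O.
Proof.
move=> adm; have := theta_code adm => /agree_sym ag.
apply/(@lt_within_lt _ (3 * size a)); rewrite plus_seq_code//.
apply: lt_within_agree (@lt_within_code _ _ adm thue_morse8 _ 2 _ _ _) => //.
  by apply: agreeW ag; lia.
by case=> [|[|[]]].
Qed.

Lemma theta_lt_trip a : adm_spec a -> (theta a < periodic (trip a))%O.
Proof.
move=> adm; have := theta_code adm => /agree_sym ag.
apply/(@lt_within_lt _ (5 * size a)); rewrite periodic_trip//.
apply: lt_within_agree (@lt_within_code _ _ adm thue_morse8 _ 4 _ _ _) => //.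
  by apply: agreeW ag; lia.
by case=> [|[|[|[|[]]]]].
Qed.

Lemma theta_trip_agree a : adm_spec a -> agree (size a) (theta a) (periodic (trip a)).
Proof.
move=> adm; rewrite periodic_trip//.
apply: (agree_trans (agreeW _ (theta_code adm))); first by lia.
apply: (@agree_trans _ _ _ (nth ord0 (incr_last a))); first exact: code_start.
by apply: agree_sym; exact: code_start.
Qed.

End Renormalization.

Arguments dbl {M} a.
Arguments trip {M} a.

(** * Sequences in infinitely many basic intervals *)

Section Nested.
Local Open Scope nat_scope.
Variable M : nat.
Implicit Types (a u v : word M) (d e : Omega M) (n k i : nat).

(** The expansions [theta a] and those of the points of [Cinfty] are of this
    kind, and it is all that is needed for a unique expansion of 1. *)
Definition nested d := forall n, exists a,
  [/\ adm_spec a, n <= size a, (periodic a < d)%O & (d <= plus_seq a)%O].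

(** A longer word squeezes its basic interval: the end points agree on all
    digits of the word but the last. *)
Lemma plus_seq_agree_pred a : adm_spec a -> agree (size a).-1 (periodic a) (plus_seq a).
Proof.
move=> admc; apply: (agree_trans (agreeW (leq_pred _) (@periodic_agree _ a))).
apply: (agree_trans (agree_sym (plus_agree admc))); apply: agree_sym.
by apply: (agreeW (leq_pred _)); exact: plus_seq_agree.
Qed.

(** Starting with [a] instead of [a^+] would leave a tail above [periodic a]
    that begins with [a] again, and so on, so that [d] would be
    [periodic a]. *)
Lemma plus_start a d : adm_spec a -> (forall n, (shift_seq n d <= d)%O) ->
  (periodic a < d)%O -> (d <= plus_seq a)%O ->
  agree (size a) d (nth ord0 (incr_last a)) /\
  (shift_seq (size a) d <= refl_seq (periodic a))%O.
Proof.
move=> adm dd wd dR; have a0 := adm_size adm.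
have [[ag _]|//] := decode_step adm (ltW wd) dR.
suff E k : agree (k * size a) (periodic a) d.
  have : periodic a = d.
    apply: agree_eq => n; apply: agreeW (E n); exact: leq_pmulr.
  by move=> e; rewrite e ltxx in wd.
elim: k => [|k ih]; first by rewrite mul0n.
have wk : shift_seq (k * size a) (periodic a) = periodic a.
  exact/iter_shift_eq/shift_periodic.
have lt : (periodic a <= shift_seq (k * size a) d)%O.
  by rewrite -[leLHS]wk le_shift// ltW.
have ag' : agree (size a) (periodic a) d.
  apply: agree_trans (agree_sym ag); exact: periodic_agree.
have {lt}sq := agree_squeeze lt (dd (k * size a)) ag'.
move=> i; rewrite mulSn => iL; have [/ih//|ki] := ltnP i (k * size a).
have := sq (i - k * size a); rewrite shift_seqE subnKC// => <-; last by lia.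
by rewrite -[in RHS]wk shift_seqE subnKC.
Qed.

Lemma plus_start_lt a d i : adm_spec a -> agree (size a) d (nth ord0 (incr_last a)) ->
  0 < i < size a -> lt_within (size a - i) (refl_seq d) (shift_seq i d).
Proof.
move=> adm ag im; apply: lt_within_agree (plus_gt adm im).
  apply: agree_refl_seq; apply: (@agreeW _ (size a).-1); first by lia.
  apply: agree_trans (agree_sym (agreeW (leq_pred _) ag)).
  apply: agree_trans (agree_sym (plus_agree adm)).
  by apply: (agreeW (leq_pred _)); exact: periodic_agree.
by move=> j jL; rewrite !shift_seqE ag//; lia.
Qed.

Lemma nested_refl_lt d n : (forall n, (shift_seq n d <= d)%O) -> nested d -> 0 < n ->
  (refl_seq d < shift_seq n d)%O.
Proof.
move=> dd nd n0; have [a [adm na wd dR]] := nd n.+1.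
have [ag _] := plus_start adm dd wd dR.
by apply/(@lt_within_lt _ (size a - n))/plus_start_lt => //; rewrite n0.
Qed.

(** Such a sequence cannot be periodic: reading it one period into a long
    word [a^+] it would show [refl(a)] where its own prefixes forbid it. *)
Lemma nested_shift_lt d n : (forall n, (shift_seq n d <= d)%O) -> nested d -> 0 < n ->
  (shift_seq n d < d)%O.
Proof.
move=> dd nd n0; rewrite lt_neqAle dd andbT; apply/eqP => dn.
have [a [adm na wd dR]] := nd n.+1; have [ag _] := plus_start adm dd wd dR.
have [b [admb nb wdb dRb]] := nd (size a + 1).
have [agb shb] := plus_start admb dd wdb dRb.
pose j := ((size b).-1 %% n).+1.
have jn : 0 < j <= n by rewrite /= ltn_mod.
have bE : size b = j + (size b).-1 %/ n * n.
  by rewrite /j addSn addnC -divn_eq prednK; lia.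
have sE : shift_seq (size b) d = shift_seq j d.
  by rewrite bE addnC -shift_seqD iter_shift_eq.
rewrite sE in shb.
have lt : lt_within (size b).-1 (refl_seq d) (shift_seq j d).
  apply: (@lt_withinW _ _ (size a - j)); first by lia.
  by apply: plus_start_lt => //; lia.
have ag' : agree (size b).-1 (refl_seq d) (refl_seq (periodic b)).
  apply: agree_refl_seq; apply: (agree_trans (agreeW (leq_pred _) agb)).
  apply: (agree_trans (plus_agree admb)); apply: agree_sym.
  by apply: (agreeW (leq_pred _)); exact: periodic_agree.
have : (shift_seq j d < shift_seq j d)%O.
  apply: le_lt_trans shb _; apply/(@lt_within_lt _ (size b).-1).
  exact: lt_within_agree lt.
by rewrite ltxx.
Qed.

Lemma nested_theta a : adm_spec a -> nested (theta a).
Proof.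
move=> adm n; exists (iter n dbl a); have admn := adm_spec_iter_dbl n adm.
split => //.
- rewrite size_iter_dbl//; apply: (@leq_trans (2 ^ n)); first exact/ltnW/ltn_expl.
  by rewrite leq_pmulr// adm_size.
- by rewrite -(theta_iter_dbl n adm); exact: theta_gt.
- by rewrite -(theta_iter_dbl n adm); apply/ltW/theta_lt_plus.
Qed.

Lemma theta_start a k : adm_spec a ->
  agree (2 ^ k * size a) (theta a) (nth ord0 (incr_last (iter k dbl a))).
Proof.
move=> adm; have admk := adm_spec_iter_dbl k adm.
rewrite -(theta_iter_dbl k adm) -(size_iter_dbl k adm).
by have := @theta_agree _ (iter k dbl a) 0 (adm_size admk); rewrite mul1n.
Qed.

Lemma shift_theta_le a n : adm_spec a -> (shift_seq n (theta a) <= theta a)%O.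
Proof.
move=> adm; case: n => [|n]; first by rewrite shift_seq0.
rewrite leNgt; apply/negP => /ltOP[K lt].
pose k := n.+1 + K; have admk := adm_spec_iter_dbl k adm.
have sk := size_iter_dbl k adm; have ag := @theta_start _ k adm.
have Lk : n.+1 + K < size (iter k dbl a).
  rewrite sk; apply: (@leq_trans (2 ^ k)); first exact: ltn_expl.
  by rewrite leq_pmulr// adm_size.
rewrite -sk in ag.
set b := iter k dbl a in admk sk ag Lk.
have im : 0 < n.+1 < size b by lia.
have sh : agree (size b - n.+1) (shift_seq n.+1 (nth ord0 (incr_last b)))
    (shift_seq n.+1 (theta a)).
  by move=> j jL; rewrite !shift_seqE ag//; lia.
have wE : agree (size b - n.+1) (periodic b) (theta a).
  apply: (@agreeW _ (size b).-1); first by lia.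
  apply: agree_trans (agree_sym (agreeW (leq_pred _) ag)).
  apply: agree_trans (agree_sym (plus_agree admk)).
  by apply: (agreeW (leq_pred _)); exact: periodic_agree.
have lt' : lt_within (size b - n.+1) (theta a) (shift_seq n.+1 (theta a)).
  by apply: lt_withinW lt; lia.
have [ag'|lt''] := plus_le admk im.
  have agT : agree (size b - n.+1) (shift_seq n.+1 (theta a)) (theta a).
    by apply: agree_trans (agree_sym sh) _; apply: agree_trans wE.
  by case: lt' => j jL [_]; rewrite agT// ltnn.
have : (theta a < theta a)%O.
  apply: (@lt_trans _ _ (shift_seq n.+1 (theta a))); first exact: lt_within_lt lt'.
  by apply/(@lt_within_lt _ (size b - n.+1)); apply: lt_within_agree lt''.
by rewrite ltxx.
Qed.

Lemma refl_lt_not_zeros d : (forall n, 0 < n -> (refl_seq d < shift_seq n d)%O) ->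
  ~ ends_with_zeros d.
Proof.
move=> h [N dN]; have := h N.+1 isT; rewrite ltNge => /negP; apply.
rewrite leNgt; apply/negP => /ltOP[_ [k _ [_]]].
by rewrite shift_seqE dN//; lia.
Qed.

Lemma theta_not_zeros a : adm_spec a -> ~ ends_with_zeros (theta a).
Proof.
move=> adm; apply: refl_lt_not_zeros => n n0.
by apply: nested_refl_lt => // [k|]; [exact: shift_theta_le|exact: nested_theta].
Qed.

(** The end points of the larger interval agree on all digits of its word but
    the last one, while those of the smaller interval differ at the last digit
    of its word; so the word of the smaller interval cannot be shorter. *)
Lemma nested_size a b : adm_spec a -> adm_spec b ->
  (periodic a <= periodic b)%O -> (plus_seq b <= plus_seq a)%O ->
  a = b \/ size a < size b.
Proof.
move=> adma admb ab ba; have [lt|le] := ltnP (size a) (size b); [by right|left].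
have bp := periodic_lt_plus admb.
have wP (c : word M) : adm_spec c -> (plus_seq c (size c).-1 : nat) = (periodic c (size c).-1).+1.
  move=> admc; have c0 := adm_size admc.
  rewrite (plus_seq_agree admc) ?(plusE admc) ?eqxx ?addn1; [|lia..].
  by rewrite periodic_agree//; lia.
have a0 := adm_size adma; have b0 := adm_size admb.
have ab1 := agree_squeeze ab (le_trans (ltW bp) ba) (plus_seq_agree_pred adma).
have ab2 := agree_squeeze (le_trans ab (ltW bp)) ba (plus_seq_agree_pred adma).
have sE : size a = size b.
  apply/eqP; rewrite eqn_leq le andbT leqNgt; apply/negP => lt.
  have /ab1 e1 : (size b).-1 < (size a).-1 by lia.
  have /ab2 e2 : (size b).-1 < (size a).-1 by lia.
  by have := wP b admb; rewrite -e2 -e1; lia.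
apply: (@eq_from_nth _ ord0) => // i ia.
rewrite -(@periodic_agree _ a)// -(@periodic_agree _ b) -?sE//.
have [/ab1//|i1] := ltnP i (size a).-1.
have -> : i = (size a).-1 by apply/eqP; rewrite eqn_leq i1 andbT -ltnS prednK.
have := wP a adma; have := wP b admb; rewrite -sE => e1 e2.
have h1 : (periodic a (size a).-1 <= periodic b (size a).-1).
  have : (shift_seq (size a).-1 (periodic a) <= shift_seq (size a).-1 (periodic b))%O.
    by rewrite le_shift.
  by move/le_head; rewrite !shift_seqE addn0.
have h2 : (plus_seq b (size a).-1 <= plus_seq a (size a).-1).
  have : (shift_seq (size a).-1 (plus_seq b) <= shift_seq (size a).-1 (plus_seq a))%O.
    rewrite le_shift//; apply: agree_trans (agree_sym ab2) (plus_seq_agree_pred adma).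
  by move/le_head; rewrite !shift_seqE addn0.
by apply/ord_inj; lia.
Qed.

End Nested.

(** * Basic intervals and the Komornik-Loreti constant *)

Section BasicIntervals.
Variables (R : realType) (M : nat).
Implicit Types (q : R) (a : word M) (d : Omega M) (I : R * R) (n k i : nat).

Lemma shift_periodic_le a n : adm_spec a ->
  (shift_seq n (periodic a) <= periodic a)%O.
Proof.
move=> adm; have a0 := adm_size adm.
rewrite (divn_eq n (size a)) -shift_seqD iter_shift_eq; last exact: shift_periodic.
have [->|r0] := posnP (n %% size a)%N; first by rewrite shift_seq0.
apply/ltW/(@lt_within_lt _ (size a - n %% size a)%N)/adm_upper => //.
by rewrite r0 ltn_mod.
Qed.

Lemma shift_code_le a st n : adm_spec a -> (shift_seq n (code a st) <= plus_seq a)%O.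
Proof.
move=> adm; rewrite plus_seq_code//; apply: code_tails => // k sk.
by apply: le_code => //; rewrite addn0.
Qed.

Lemma shift_plus_seq_le a n : adm_spec a ->
  (shift_seq n (plus_seq a) <= plus_seq a)%O.
Proof. by move=> adm; rewrite {1}plus_seq_code//; exact: shift_code_le. Qed.

Lemma periodic_not_zeros a : adm_spec a -> ~ ends_with_zeros (periodic a).
Proof.
move=> adm [N dN]; have a0 := adm_size adm.
have : periodic a (N * size a)%N = ord0 by apply: dN; rewrite leq_pmulr.
rewrite /periodic modnMl => e; have := adm_first adm; have := adm_last adm.
by rewrite e /=; lia.
Qed.

Lemma plus_seq_not_zeros a : adm_spec a -> ~ ends_with_zeros (plus_seq a).
Proof.
move=> adm [N dN]; have a0 := adm_size adm.
have : plus_seq a (size a + (N * size a + (size a).-1))%N = ord0.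
  by apply: dN; rewrite addnC -addnA; apply: leq_trans (leq_addr _ _); rewrite leq_pmulr.
rewrite -shift_seqE shift_plus_seq// refl_seqE /periodic modnMDl modn_small; last by lia.
move/(congr1 (@nat_of_ord _)); rewrite rev_digitE /= => /eqP.
by rewrite subn_eq0 leqNgt (adm_last adm).
Qed.

Lemma exists_alpha_periodic a : adm_spec a ->
  exists2 q, @bases R M q & alpha M q = periodic a.
Proof.
move=> adm; apply: alpha_surj; first exact: periodic_not_zeros.
by move=> n; exact: shift_periodic_le.
Qed.

Lemma exists_alpha_plus a : adm_spec a ->
  exists2 q, @bases R M q & alpha M q = plus_seq a.
Proof.
move=> adm; apply: alpha_surj; first exact: plus_seq_not_zeros.
by move=> n; exact: shift_plus_seq_le.
Qed.

Lemma exists_alpha_theta a : adm_spec a ->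
  exists2 q, @bases R M q & alpha M q = theta a.
Proof.
move=> adm; apply: alpha_surj; first exact: theta_not_zeros.
by move=> n; exact: shift_theta_le.
Qed.

Lemma exists_generates a : adm_spec a -> exists I : R * R, generates a I.
Proof.
move=> adm; have [q bq qE] := exists_alpha_periodic adm.
by have [q' bq' qE'] := exists_alpha_plus adm; exists (q, q').
Qed.

Lemma generates_lt a I : adm_spec a -> generates a I -> I.1 < I.2.
Proof.
move=> adm [b1 b2 e1 e2]; rewrite -(alpha_lt b1 b2) e1 e2.
exact: periodic_lt_plus.
Qed.

Lemma generates_mem a I q : generates a I -> @bases R M q ->
  itv I q <-> (periodic a <= alpha M q)%O /\ (alpha M q <= plus_seq a)%O.
Proof.
move=> [b1 b2 e1 e2] bq; rewrite -e1 -/(plus_seq a) in e2 *.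
rewrite -e2 !alpha_le// /itv /= in_itv/=; split; first by move/andP.
by case=> -> ->.
Qed.

Lemma bases_between q q1 q2 : @bases R M q1 -> @bases R M q2 ->
  q1 <= q -> q <= q2 -> @bases R M q.
Proof.
move=> /basesP/andP[h1 h2] /basesP/andP[h3 h4] h5 h6; apply/basesP.
by rewrite (lt_le_trans h1 h5) (le_trans h6 h4).
Qed.

Lemma generates_bases a I : generates a I -> itv I `<=` @bases R M.
Proof.
move=> [b1 b2 _ _] q; rewrite /itv /= in_itv/= => /andP[h1 h2].
exact: bases_between h1 h2.
Qed.

Lemma nested_univoque q : @bases R M q -> nested (alpha M q) -> univoque M q.
Proof.
move=> bq nd; apply: univoque_alpha => // n n0.
have dd k := @shift_alpha_le R M q k bq.
by split; [exact: nested_refl_lt|exact: nested_shift_lt].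
Qed.

(** If a sequence starts like an antiperiodic one for two half-periods, its
    later digits are squeezed between its reflected shift and itself, which
    forces it to coincide with the antiperiodic sequence. *)
Lemma antiperiodic_contra L (p d : Omega M) : (0 < L)%N ->
  shift_seq L p = refl_seq p -> (forall n, (shift_seq n d <= d)%O) ->
  (refl_seq d < shift_seq L d)%O -> agree (L + L) d p -> False.
Proof.
move=> L0 Lp dd low ag.
have p2 : shift_seq (L + L) p = p by rewrite -shift_seqD Lp shift_refl Lp refl_seqK.
have low' : (refl_seq (shift_seq L d) < shift_seq (L + L) d)%O.
  have agL : agree L (refl_seq d) (shift_seq L d).
    move=> i iL; rewrite refl_seqE shift_seqE !ag; [|lia..].
    by rewrite -shift_seqE Lp.
  by move: low; rewrite -(lt_shift agL) shift_refl shift_seqD.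
have all j : agree (L + L + j * L) d p.
  elim: j => [|j ih]; first by rewrite mul0n addn0.
  have ag1 : agree (L + j * L) (refl_seq (shift_seq L d)) p.
    move=> i iL; rewrite refl_seqE shift_seqE ih; last by lia.
    by rewrite -shift_seqE Lp refl_seqE rev_ordK.
  have ag2 : agree (L + j * L) (refl_seq (shift_seq L d)) d.
    by apply: agree_trans ag1 _; apply: agree_sym; apply: agreeW ih; lia.
  have ag3 := agree_squeeze (ltW low') (dd (L + L)%N) ag2.
  move=> i; rewrite mulSn => iL; have [iL'|iL'] := ltnP i (L + L); first exact: ag.
  have := ag3 (i - (L + L))%N; rewrite shift_seqE subnKC// => <-; last by lia.
  rewrite ag1; last by lia.
  by rewrite -[in LHS]p2 shift_seqE subnKC.
have E : d = p.
  by apply: agree_eq => n; apply: agreeW (all n); rewrite addnC; nia.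
by rewrite E Lp ltxx in low.
Qed.

(** The word whose limit sequence [theta] is the quasi-greedy expansion in base
    [q_KL]: the middle digit if it exists, and otherwise the two middle ones. *)
Definition root_word : word M :=
  if odd M then [:: inord M./2.+1; inord M./2] else [:: inord M./2].

Lemma root_adm : (1 <= M)%N -> adm_spec root_word.
Proof.
move=> M1; apply: admissible_spec; rewrite /root_word.
have ME := odd_double_half M.
have h0 : (inord M./2 : 'I_M.+1) = M./2 :> nat by rewrite inordK//; lia.
have [oM|eM] := boolP (odd M); rewrite ?oM ?(negbTE eM) in ME *.
- have h1 : (inord M./2.+1 : 'I_M.+1) = M./2.+1 :> nat by rewrite inordK//; lia.
  left; split => // i /= i2; have -> : i = 1%N by lia.
  rewrite /= /refl_word /=; split.
    rewrite le_eqVlt; apply/orP; left; apply/eqP; congr [:: _].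
    by apply/ord_inj; rewrite rev_digitE h0 h1; lia.
  rewrite ltxi_cons ltxx implybF -ltNge ltEord h0 h1 ltnSn andbT.
  by rewrite leEord h0 h1.
- right; split; first by lia.
  by exists (inord M./2); rewrite rev_digitE h0; split => //; lia.
Qed.

(** A smaller expansion would have to follow [theta root_word] for ever: when it
    agrees with it on [2^k] blocks, the bounds [refl d < shift d <= d] leave for
    the next [2^k] blocks either those of [theta root_word] or the antiperiodic
    continuation, which [antiperiodic_contra] excludes. *)
Lemma univoque_root q : (1 <= M)%N -> univoque M q ->
  (theta root_word <= alpha M q)%O.
Proof.
move=> M1 uq; have [bq _] := uq; have adm := root_adm M1.
have low n : (0 < n)%N -> (refl_seq (alpha M q) < shift_seq n (alpha M q))%O.
  exact: univoque_refl_lt.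
have dd n := @shift_alpha_le R M q n bq.
move: (alpha M q) low dd => d low dd; rewrite leNgt; apply/negP => lt.
have a0 := adm_size adm.
suff step k : agree (2 ^ k * size root_word) d (theta root_word).
  have : d = theta root_word.
    apply: agree_eq => n; apply: agreeW (step n).
    by apply: leq_trans (ltnW (ltn_expl n (isT : 1 < 2)%N)) _; rewrite leq_pmulr.
  by move=> e; rewrite e ltxx in lt.
elim: k => [|k ih].
  rewrite mul1n.
  have ag0 : agree (size root_word) (theta root_word) (nth ord0 (incr_last root_word)).
    by have := @theta_start _ root_word 0 adm; rewrite mul1n.
  have d0 n : (M - d 0 <= d n <= d 0)%N.
    have h1 : (d n <= d 0)%N by have := le_head (dd n); rewrite shift_seqE addn0.
    rewrite h1 andbT; case: n h1 => [|n] h1.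
      have := le_head (le_trans (ltW (low 1%N isT)) (dd 1%N)).
      by rewrite refl_seqE rev_digitE.
    by have := le_head (ltW (low n.+1 isT)); rewrite refl_seqE rev_digitE shift_seqE addn0.
  have ME := odd_double_half M.
  have h0 : (inord M./2 : 'I_M.+1) = M./2 :> nat by rewrite inordK//; lia.
  have tE i : (i < size root_word)%N -> (theta root_word i : nat) =
      (nth ord0 root_word i + (i == (size root_word).-1))%N.
    by move=> ir; rewrite ag0// nth_incr_last//; exact: adm_last.
  have dt0 := le_head (ltW lt); rewrite tE// in dt0.
  move: ag0 tE dt0; rewrite /root_word.
  have [oM|eM] := boolP (odd M); rewrite ?oM ?(negbTE eM) in ME *.
  - have h1 : (inord M./2.+1 : 'I_M.+1) = M./2.+1 :> nat by rewrite inordK//; lia.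
    move=> ag0 tE /=; rewrite addn0 h1 => dt0.
    have d0E : (d 0%N : nat) = M./2.+1 by have := d0 0%N; lia.
    have ag1 : agree 1 d (theta root_word).
      move=> i; rewrite ltnS leqn0 => /eqP ->; apply/ord_inj.
      by rewrite /root_word oM tE//= h1 d0E addn0.
    have d1 : (d 1%N <= M./2.+1)%N.
      have : (shift_seq 1 d <= shift_seq 1 (theta root_word))%O by rewrite le_shift// ltW.
      by move/le_head; rewrite !shift_seqE addn0 /root_word oM tE//= h0 addn1.
    have [e|lt1] : (d 1%N : nat) = M./2.+1 \/ (d 1%N : nat) = M./2.
      by have := d0 1%N; lia.
      move=> [|[|//]] _; apply/ord_inj; first by rewrite tE//= h1 d0E addn0.
      by rewrite tE//= h0 e addn1.
    exfalso; apply: (@antiperiodic_contra 1 (periodic root_word) d) => //.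
    + apply/funext => i; rewrite shift_seqE refl_seqE /periodic /root_word oM /=.
      rewrite -modnDmr; apply/ord_inj; rewrite rev_digitE.
      by have := ltn_pmod i (isT : (0 < 2)%N); case: (i %% 2)%N => [|[|]]//=; lia.
    + exact: low.
    + move=> [|[|//]] _; rewrite /periodic /root_word oM /=; apply/ord_inj.
        by rewrite h1 d0E.
      by rewrite h0 lt1.
  - move=> ag0 tE /=; rewrite h0 => dt0.
    have [e|e] : (d 0%N : nat) = M./2.+1 \/ (d 0%N : nat) = M./2.
      by have := d0 0%N; lia.
      by move=> [|//] _; apply/ord_inj; rewrite tE//= h0 e addn1.
    have := low 1%N isT; suff -> : refl_seq d = shift_seq 1 d by rewrite ltxx.
    apply/funext => i; apply/ord_inj; rewrite refl_seqE rev_digitE shift_seqE.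
    by have := d0 i; have := d0 (1 + i)%N; lia.
(* [decode_step] for the next block: it is [refl(c)], as in [theta c], or the
   reflection of [c^+], as in the antiperiodic sequence *)
set c := iter k dbl root_word.
have admk : adm_spec c by exact: adm_spec_iter_dbl.
have tk : theta c = theta root_word by exact: theta_iter_dbl.
have sk : size c = (2 ^ k * size root_word)%N by exact: size_iter_dbl.
have c0 := adm_size admk.
have -> : (2 ^ k.+1 * size root_word = size c + size c)%N.
  by rewrite sk expnS -mulnA mul2n addnn.
rewrite -sk -tk in ih *; rewrite -tk in lt.
have wc : agree (size c) (periodic c) (nth ord0 c) by exact: periodic_agree.
have tcode := theta_code admk.
have t1 : agree (size c) (theta c) (nth ord0 (incr_last c)).
  apply: agree_trans (agreeW _ tcode) _; first by lia.
  exact: code_start.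
have tl : (shift_seq (size c) d <= shift_seq (size c) (theta c))%O.
  by rewrite le_shift// ltW.
have tp : (shift_seq (size c) (theta c) <= refl_seq (periodic c))%O.
  rewrite -(shift_plus_seq admk) le_shift; first exact/ltW/theta_lt_plus.
  by apply: (agree_trans t1); apply: agree_sym; exact: plus_seq_agree.
have := @decode_step _ c admk (refl_seq (shift_seq (size c) d)).
rewrite le_reflC refl_leC (le_trans tl tp) => /(_ isT).
have -> : (refl_seq (plus_seq c) <= shift_seq (size c) d)%O.
  apply: le_trans _ (ltW (low _ c0)); rewrite refl_le.
  exact: le_trans (ltW lt) (ltW (theta_lt_plus admk)).
move=> /(_ isT) [][ag _].
- suff ag' : agree (size c) (shift_seq (size c) d) (shift_seq (size c) (theta c)).
    move=> i iL; have [/ih//|ic] := ltnP i (size c).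
    by have := ag' (i - size c)%N; rewrite !shift_seqE subnKC//; apply; lia.
  apply: (@agree_trans _ _ _ (refl_seq (nth ord0 c))).
    by rewrite -[shift_seq _ d]refl_seqK; exact: agree_refl_seq.
  move=> i iL; rewrite shift_seqE tcode; last by lia.
  have := @code_block _ c admk thue_morse8 1 i iL; rewrite mul1n => ->.
  by [].
- exfalso; apply: (@antiperiodic_contra (size c) (periodic (dbl c)) d c0) => //.
  + rewrite periodic_dbl// code_refl.
    by have := shift_code admk odd 1; rewrite mul1n => ->.
  + exact: low.
  + rewrite periodic_dbl// => i iL; have [ic|ic] := ltnP i (size c).
      by rewrite ih// t1// (code_start admk).
    rewrite -[d i](congr1 d (subnKC ic)) -shift_seqE.
    rewrite -[shift_seq (size c) d]refl_seqK refl_seqE ag; last by lia.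
    rewrite -{2}(subnKC ic).
    have ii : (i - size c < size c)%N by lia.
    by have := @code_block _ c admk odd 1 _ ii; rewrite mul1n => ->.
Qed.

Lemma q_KL_spec : (1 <= M)%N ->
  [/\ univoque M (q_KL R M), alpha M (q_KL R M) = theta root_word &
      forall q, univoque M q -> q_KL R M <= q].
Proof.
move=> M1; have adm := root_adm M1.
have [q bq qE] := exists_alpha_theta adm.
have uq : univoque M q.
  by apply: nested_univoque => //; rewrite qE; exact: nested_theta.
have lq : lbound (univoque M) q.
  move=> q' uq'; have [bq' _] := uq'.
  by rewrite -(@alpha_le R M)// qE; exact: univoque_root.
suff -> : q_KL R M = q by split.
rewrite /q_KL; case: (xgetP 0 _) => [x _ [ux lx]|/(_ q)[]]; last by split.
by apply/eqP; rewrite eq_le lx// lq.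
Qed.

End BasicIntervals.

(** * Expansions with symmetric digits *)

Section Symmetric.
Variables (R : realType) (M : nat).
Implicit Types (b x y : R) (d e : Omega M) (n k i : nat).

(** The value of a digit sequence when the digit [c] stands for [2 c - M], so
    that reflection is negation.  For [q] with entropy [log b] the map
    [phi b] turns the shift on the sequences counted by [Utilde q] into the
    piecewise linear map of slope [b] on [[-1, 1]]. *)
Definition phi b d : R := 2 * qval b d - M%:R / (b - 1).

Definition digits_pm (c : 'I_M.+1) : R := 2 * (c : nat)%:R - M%:R.

Lemma phi_rec b d : 1 < b -> b * phi b d = digits_pm (d 0%N) + phi b (shift_seq 1 d).
Proof.
move=> b1; rewrite /phi mulrBr mulrCA qval_rec// /digits_pm.
have -> : b * (M%:R / (b - 1)) = M%:R + M%:R / (b - 1) by field; lra.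
lra.
Qed.

Lemma phi_rec_shift b d n : 1 < b ->
  b * phi b (shift_seq n d) = digits_pm (d n) + phi b (shift_seq n.+1 d).
Proof. by move=> b1; rewrite phi_rec// shift_seqD addn1 shift_seqE addn0. Qed.

Lemma phi_refl b d : 1 < b -> phi b (refl_seq d) = - phi b d.
Proof. by move=> b1; rewrite /phi qval_refl//; lra. Qed.

Lemma phi_agree b d e n : 1 < b -> agree n d e ->
  phi b d - phi b e = (phi b (shift_seq n d) - phi b (shift_seq n e)) / b ^+ n.
Proof.
move=> b1 ag; rewrite /phi; have := qval_agree b1 ag.
have bn : b ^+ n != 0 by rewrite expf_neq0// gt_eqF; lra.
move: (qval _ _) (qval _ _) (qval _ _) (qval _ _) => v' u' v u h.
have -> : 2 * u - M%:R / (b - 1) - (2 * v - M%:R / (b - 1)) = 2 * (u - v) by lra.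
by rewrite h; field; rewrite bn; lra.
Qed.

Lemma phi_first_diff b d e k : 1 < b -> agree k d e -> (d k < e k)%N ->
  phi b d - phi b e <=
  (phi b (shift_seq k.+1 d) - phi b (shift_seq k.+1 e) - 2) / b ^+ k.+1.
Proof.
move=> b1 ag lt; have := qval_first_diff b1 ag lt; rewrite /phi.
move: (qval _ _) (qval _ _) (qval _ _) (qval _ _) => v' u' v u h.
have -> : 2 * u - M%:R / (b - 1) - (2 * v - M%:R / (b - 1)) = 2 * (u - v) by lra.
have -> : 2 * u' - M%:R / (b - 1) - (2 * v' - M%:R / (b - 1)) - 2 = 2 * (u' - v' - 1).
  by lra.
by rewrite -mulrA ler_pM2l.
Qed.

Definition tails_in b d := forall n, `|phi b (shift_seq n d)| <= 1.

Lemma tails_in_shift b d n : tails_in b d -> tails_in b (shift_seq n d).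
Proof. by move=> h k; rewrite shift_seqD. Qed.

Lemma tails_in_refl b d : 1 < b -> tails_in b d -> tails_in b (refl_seq d).
Proof. by move=> b1 h k; rewrite shift_refl phi_refl// normrN. Qed.

Lemma tails_in0 b d : tails_in b d -> `|phi b d| <= 1.
Proof. by move=> /(_ 0%N); rewrite shift_seq0. Qed.

Lemma phi_mono b d e : 1 < b -> tails_in b d -> tails_in b e -> (d <= e)%O ->
  phi b d <= phi b e.
Proof.
move=> b1 hd he; rewrite le_eqVlt => /predU1P[->//|/ltOP[_ [k _ [ag lt]]]].
rewrite -subr_le0; apply: le_trans (phi_first_diff b1 ag lt) _.
have b0 : 0 < b by lra.
rewrite pmulr_lle0 ?invr_gt0 ?exprn_gt0//.
by have := hd k.+1; have := he k.+1; rewrite !ler_norml => /andP[? ?] /andP[? ?]; lra.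
Qed.

(** Taking the largest digit that keeps the tail at least [-1] also keeps it at
    most [1]; [ymin] and [ymin + 1] correspond to the values [-1] and [1]. *)
Let ymin b : R := (M%:R / (b - 1) - 1) / 2.

Definition greedy_digit b y : 'I_M.+1 :=
  [arg max_(i > ord0 | (i : nat)%:R <= b * y - ymin b) (i : nat)].

Definition greedy b x : Omega M :=
  orbit_digits (greedy_digit b) b ((x + M%:R / (b - 1)) / 2).

Lemma ymin_ge0 b : @bases R M b -> 0 <= ymin b.
Proof.
move=> bb; have b1 := bases_gt1 bb; have := bases_le bb; rewrite -natr1 => bM.
suff : 1 <= M%:R / (b - 1) by rewrite /ymin; lra.
by rewrite ler_pdivlMr; lra.
Qed.

Lemma greedy_digitP b y : @bases R M b -> ymin b <= y <= ymin b + 1 ->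
  [/\ ymin b <= b * y - (greedy_digit b y : nat)%:R,
      b * y - (greedy_digit b y : nat)%:R <= ymin b + 1,
      forall c : 'I_M.+1, (c : nat)%:R <= b * y - ymin b -> (c <= greedy_digit b y)%N &
      (greedy_digit b y < M)%N -> b * y - (greedy_digit b y : nat)%:R < ymin b + 1].
Proof.
move=> bb /andP[y0 y1]; have b1 := bases_gt1 bb; have m0 := ymin_ge0 bb.
rewrite /greedy_digit; case: arg_maxnP => [|c cy cmax].
  rewrite /= subr_ge0; apply: (le_trans y0); rewrite ler_peMl//; first exact: le_trans y0.
  exact: ltW.
have lt : (c < M)%N -> b * y - (c : nat)%:R < ymin b + 1.
  move=> cM; have := cmax (Ordinal (n:=M.+1) (m:=c.+1) cM) => /=.
  have [le /(_ isT)|lt _] := leP (c.+1%:R) (b * y - ymin b); first by rewrite ltnn.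
  by rewrite -natr1 in lt; lra.
split => //; first by lra.
have [/lt/ltW//|Mc] := ltnP c M.
have -> : (c : nat) = M by apply/eqP; rewrite eqn_leq Mc -ltnS ltn_ord.
have : b * y <= b * (ymin b + 1) by rewrite ler_pM2l//; lra.
have h : b * (ymin b + 1) - M%:R = ymin b + 1 - (M%:R / (b - 1) - 1) * (b - 1) / 2.
  by rewrite /ymin; field; lra.
have : 0 <= (M%:R / (b - 1) - 1) * (b - 1).
  by rewrite mulr_ge0//; [move: m0; rewrite /ymin; lra|lra].
lra.
Qed.

Lemma greedy_spec b x : @bases R M b -> `|x| <= 1 ->
  [/\ tails_in b (greedy b x), phi b (greedy b x) = x &
      forall n, shift_seq n (greedy b x) = greedy b (phi b (shift_seq n (greedy b x)))].
Proof.
move=> bb; have b1 := bases_gt1 bb; rewrite ler_norml => /andP[x0 x1].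
pose P := [set y : R | ymin b <= y <= ymin b + 1].
have m0 := ymin_ge0 bb.
have PB y : P y -> `|y| <= ymin b + 1.
  by move=> /andP[h0 h1]; rewrite ger0_norm//; exact: le_trans h0.
have PD y : P y -> P (b * y - (greedy_digit b y : nat)%:R).
  by move=> Py; have [h1 h2 _ _] := greedy_digitP bb Py; rewrite /P/= h1 h2.
have Pof z : -1 <= z -> z <= 1 -> P ((z + M%:R / (b - 1)) / 2).
  by move=> z0 z1; rewrite /P/= /ymin; apply/andP; split; lra.
have Px := Pof x x0 x1.
have [v Pn] := orbit_digitsP b1 PB PD Px.
have tl n : phi b (shift_seq n (greedy b x)) =
    2 * orbit_point (greedy_digit b) b ((x + M%:R / (b - 1)) / 2) n - M%:R / (b - 1).
  rewrite /phi shift_orbit_digits.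
  by have [-> _] := orbit_digitsP b1 PB PD (Pn n).
split.
- move=> n; rewrite tl; have := Pn n; rewrite /P/= /ymin => /andP[h0 h1].
  by rewrite ler_norml; apply/andP; split; lra.
- by rewrite /phi /greedy v; lra.
- move=> n; rewrite tl shift_orbit_digits /greedy; congr orbit_digits.
  by lra.
Qed.

Lemma greedy_step b x n : @bases R M b -> `|x| <= 1 ->
  greedy b x n = greedy_digit b (qval b (shift_seq n (greedy b x))) /\
  ymin b <= qval b (shift_seq n (greedy b x)) <= ymin b + 1.
Proof.
move=> bb x1; have [tl _ sh] := greedy_spec bb x1.
have h := sh n; have := tl n; rewrite ler_norml => /andP[h0 h1].
split; last by rewrite /phi in h0 h1; rewrite /ymin; apply/andP; split; lra.
have -> : greedy b x n = shift_seq n (greedy b x) 0%N by rewrite shift_seqE addn0.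
rewrite {1}h /greedy /orbit_digits /=; congr greedy_digit.
by rewrite /phi subrK mulrC mulKf.
Qed.

Lemma greedy_tail_lt1 b x n : @bases R M b -> `|x| <= 1 -> (greedy b x n < M)%N ->
  phi b (shift_seq n.+1 (greedy b x)) < 1.
Proof.
move=> bb x1; have b1 := bases_gt1 bb; have [gE Py] := greedy_step n bb x1.
have [_ _ _ lt] := greedy_digitP bb Py.
have := qval_rec (shift_seq n (greedy b x)) b1.
rewrite shift_seqD addn1 shift_seqE addn0 => E; rewrite gE => /lt.
by rewrite E gE /phi /ymin; lra.
Qed.

Lemma greedy_max b d : @bases R M b -> tails_in b d -> (d <= greedy b (phi b d))%O.
Proof.
move=> bb td; have b1 := bases_gt1 bb; have x1 := tails_in0 td.
have [_ gphi _] := greedy_spec bb x1.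
rewrite leNgt; apply/negP => /ltOP[_ [k _ [ag lt]]].
have [gE Py] := greedy_step k bb x1; have [_ _ gmax _] := greedy_digitP bb Py.
have : (d k <= greedy b (phi b d) k)%N.
  rewrite gE; apply: gmax.
  have : phi b (shift_seq k (greedy b (phi b d))) = phi b (shift_seq k d).
    have := phi_agree b1 ag; rewrite gphi subrr => /esym/eqP.
    rewrite mulf_eq0 invr_eq0 expf_eq0 [b == 0]gt_eqF ?andbF ?orbF ?subr_eq0; last by lra.
    by move/eqP.
  rewrite /phi => /addIr/(mulfI (_ : 2 != 0)) -> //.
  have := qval_rec (shift_seq k d) b1; rewrite shift_seqD addn1 shift_seqE addn0 => ->.
  by have := td k.+1; rewrite ler_norml /phi /ymin => /andP[? ?]; lra.
by rewrite leqNgt lt.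
Qed.

(** The largest and the smallest expansions of 1 with tails in [[-1, 1]]; the
    smallest one is the reflection of the largest expansion of [-1]. *)
Definition upper_one b := greedy b 1.
Definition lower_one b := refl_seq (greedy b (-1)).

Let n11 : `|1 : R| <= 1. Proof. by rewrite normr1. Qed.
Let n11' : `|- 1 : R| <= 1. Proof. by rewrite normrN1. Qed.

Lemma upper_one_in b : @bases R M b -> tails_in b (upper_one b).
Proof. by move=> bb; case: (greedy_spec bb n11). Qed.

Lemma phi_upper_one b : @bases R M b -> phi b (upper_one b) = 1.
Proof. by move=> bb; case: (greedy_spec bb n11). Qed.

Lemma lower_one_in b : @bases R M b -> tails_in b (lower_one b).
Proof.
move=> bb; apply: tails_in_refl; first exact: bases_gt1 bb.
by case: (greedy_spec bb n11').
Qed.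

Lemma phi_lower_one b : @bases R M b -> phi b (lower_one b) = 1.
Proof.
move=> bb; rewrite phi_refl ?(bases_gt1 bb)//; case: (greedy_spec bb n11') => _ -> _.
by rewrite opprK.
Qed.

Lemma le_upper_one b d : @bases R M b -> tails_in b d -> (d <= upper_one b)%O.
Proof.
move=> bb td; have b1 := bases_gt1 bb; rewrite leNgt; apply/negP => lt.
have h1 := phi_mono b1 (upper_one_in bb) td (ltW lt).
have := tails_in0 td; rewrite phi_upper_one// in h1.
rewrite ler_norml => /andP[_ h2]; have e : phi b d = 1 by lra.
by have := greedy_max bb td; rewrite e leNgt lt.
Qed.

Lemma refl_upper_one_le b d : @bases R M b -> tails_in b d -> (refl_seq (upper_one b) <= d)%O.
Proof.
move=> bb td; rewrite refl_leC; apply: le_upper_one => //; apply: tails_in_refl => //.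
exact: bases_gt1 bb.
Qed.

Lemma lower_one_le b d : @bases R M b -> tails_in b d -> phi b d = 1 -> (lower_one b <= d)%O.
Proof.
move=> bb td d1; have b1 := bases_gt1 bb; rewrite refl_leC.
by have := greedy_max bb (tails_in_refl b1 td); rewrite phi_refl// d1.
Qed.

Lemma lower_upper b : @bases R M b -> (lower_one b <= upper_one b)%O.
Proof. by move=> bb; apply: le_upper_one => //; exact: lower_one_in. Qed.

Lemma lt_lower_one b d : @bases R M b -> tails_in b d -> phi b d < 1 -> (d < lower_one b)%O.
Proof.
move=> bb td d1; rewrite ltNge; apply/negP => le.
have := phi_mono (bases_gt1 bb) (lower_one_in bb) td le.
by rewrite phi_lower_one// leNgt d1.
Qed.

Lemma lower_one_tail b n : @bases R M b -> (0 < lower_one b n)%N ->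
  -1 < phi b (shift_seq n.+1 (lower_one b)).
Proof.
move=> bb; rewrite /lower_one refl_seqE rev_digitE => h.
have := @greedy_tail_lt1 b (-1) n bb n11'; rewrite shift_refl phi_refl ?(bases_gt1 bb)//.
by move=> /(_ _)h'; rewrite ltrN2 h'//; lia.
Qed.

(** Sequences with all tails between [refl (upper_one b)] and [upper_one b]
    have tails in [[-1, 1]]: an excess over 1 would be passed on, enlarged, to a
    later tail. *)
Lemma tails_in_between b d : @bases R M b ->
  (forall n, (refl_seq (upper_one b) <= shift_seq n d)%O /\
             (shift_seq n d <= upper_one b)%O) -> tails_in b d.
Proof.
move=> bb h n; have b1 := bases_gt1 bb; have b0 : 0 < b by lra.
rewrite -subr_le0.
have nb e : `|phi b e| <= 2 * (M%:R / (b - 1)) + M%:R / (b - 1).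
  apply: (le_trans (ler_normB _ _)); have v0 := qval_ge0 e b1; have v1 := qval_le e b1.
  have m0 : 0 <= M%:R / (b - 1) by exact: le_trans v1.
  have v2 : 0 <= 2 * qval b e by lra.
  by rewrite (ger0_norm v2) (ger0_norm m0); lra.
have key e n0 : (e <= upper_one b)%O -> (forall k, `|phi b (shift_seq k e)| =
    `|phi b (shift_seq (n0 + k) d)|) -> phi b e - 1 <= 0 \/ exists k r,
    [/\ 0 <= r, r <= b^-1 & phi b e - 1 <= r * (`|phi b (shift_seq k d)| - 1)].
  rewrite le_eqVlt => /predU1P[->|/ltOP[_ [k _ [ag lt]]]] ee.
    by left; rewrite phi_upper_one// subrr.
  right; exists (n0 + k.+1)%N, (b ^+ k.+1)^-1; split.
  - by rewrite invr_ge0 exprn_ge0// ltW.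
  - rewrite lef_pV2 ?posrE ?exprn_gt0// -{1}[b]mulr1 exprS ler_pM2l//.
    by rewrite exprn_ege1// ltW.
  - have := phi_first_diff b1 ag lt; rewrite phi_upper_one// => /le_trans; apply.
    rewrite mulrC ler_wpM2l ?invr_ge0 ?exprn_ge0//; first exact: ltW.
    have := upper_one_in bb k.+1; rewrite ler_norml => /andP[? _].
    by rewrite -ee; have := ler_norm (phi b (shift_seq k.+1 e)); lra.
apply: (@contraction_le0 _ (fun n => `|phi b (shift_seq n d)| - 1)
  (2 * (M%:R / (b - 1)) + M%:R / (b - 1) - 1) b^-1).
- by rewrite invr_ge0 ltW//= invf_lt1.
- by move=> k; rewrite lerB.
- move=> k; have [h1 h2] := h k; have [p0|p0] := leP 0 (phi b (shift_seq k d)).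
    rewrite ger0_norm//; apply: (key _ k) => // j; by rewrite shift_seqD.
  rewrite ltr0_norm// -phi_refl//; apply: (key _ k); first by rewrite refl_leC.
  by move=> j; rewrite shift_refl phi_refl// normrN shift_seqD.
Qed.

End Symmetric.

(** ** The first return of the orbit of 1 *)

Section FirstReturn.
Variables (R : realType) (M : nat).
Implicit Types (b : R) (d e : Omega M) (a : word M) (n k i : nat).

Lemma shift_lower_one b n : @bases R M b -> phi b (shift_seq n (lower_one M b)) = 1 ->
  shift_seq n (lower_one M b) = lower_one M b.
Proof.
move=> bb; have b1 := bases_gt1 bb; rewrite /lower_one shift_refl phi_refl//.
have n1 : `|- 1 : R| <= 1 by rewrite normrN1.
have [_ _ sh] := greedy_spec bb n1; rewrite {2}sh => h.
by have -> : phi b (shift_seq n (greedy M b (-1))) = -1 by lra.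
Qed.

Lemma shift_lower_oneN b n : @bases R M b -> phi b (shift_seq n (lower_one M b)) = -1 ->
  shift_seq n (lower_one M b) = refl_seq (upper_one M b).
Proof.
move=> bb; have b1 := bases_gt1 bb; rewrite /lower_one shift_refl phi_refl//.
have n1 : `|- 1 : R| <= 1 by rewrite normrN1.
have [_ _ sh] := greedy_spec bb n1; rewrite {2}sh => h.
by have -> : phi b (shift_seq n (greedy M b (-1))) = 1 by lra.
Qed.

Lemma shift_upper_one b n : @bases R M b -> phi b (shift_seq n (upper_one M b)) = 1 ->
  shift_seq n (upper_one M b) = upper_one M b.
Proof.
move=> bb h; have n1 : `|1 : R| <= 1 by rewrite normr1.
by have [_ _ sh] := greedy_spec bb n1; rewrite /upper_one sh h.
Qed.

Lemma shift_upper_oneN b n : @bases R M b -> phi b (shift_seq n (upper_one M b)) = -1 ->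
  shift_seq n (upper_one M b) = refl_seq (lower_one M b).
Proof.
move=> bb h; have n1 : `|1 : R| <= 1 by rewrite normr1.
have [_ _ sh] := greedy_spec bb n1.
by rewrite /upper_one sh h /lower_one refl_seqK.
Qed.

(** If 1 has several expansions with tails in [[-1, 1]], then the orbit of 1
    returns to 1 along a word [a]; the smallest expansion repeats [a] forever,
    and the largest one leaves through [a^+] to [-1], from where it repeats the
    reflection of [a].  So the expansions of 1 span a basic interval. *)
Lemma first_return b : @bases R M b -> lower_one M b <> upper_one M b ->
  exists a, [/\ admissible a, lower_one M b = periodic a, upper_one M b = plus_seq a,
    phi b (shift_seq (size a) (lower_one M b)) = 1 &
    forall i, (0 < i < size a)%N -> `|phi b (shift_seq i (lower_one M b))| < 1].
Proof.
move=> bb neq; have b1 := bases_gt1 bb; have b0 : 0 < b by lra.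
have Lin := lower_one_in bb; have Uin := upper_one_in bb.
have LE := shift_lower_one bb; have LN := shift_lower_oneN bb.
have UE := shift_upper_one bb; have UN := shift_upper_oneN bb.
have L1 := phi_lower_one bb; have U1 := phi_upper_one bb.
have Lmin d : tails_in b d -> phi b d < 1 -> (d < lower_one M b)%O.
  exact: lt_lower_one.
have Rle d : tails_in b d -> (refl_seq (upper_one M b) <= d)%O.
  exact: refl_upper_one_le.
have : (lower_one M b < upper_one M b)%O.
  by rewrite lt_neqAle lower_upper// andbT; apply/eqP.
move: (lower_one M b) (upper_one M b) Lin Uin LE LN UE UN L1 U1 Lmin Rle {neq}.
move=> L U Lin Uin LE LN UE UN L1 U1 Lmin Rle /ltOP[_ [k _ [ag lt]]].
have Lk : phi b (shift_seq k.+1 L) = 1 /\ phi b (shift_seq k.+1 U) = -1.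
  have := phi_first_diff b1 ag lt; rewrite L1 U1 subrr.
  rewrite pmulr_lge0 ?invr_gt0 ?exprn_gt0// => h.
  have := Lin k.+1; have := Uin k.+1; rewrite !ler_norml => /andP[? ?] /andP[? ?].
  by split; lra.
have [Lk1 Uk1] := Lk.
have sL := LE _ Lk1; have sU := UN _ Uk1.
have agphi i : (i <= k)%N -> phi b (shift_seq i L) = phi b (shift_seq i U).
  move=> ik; have := phi_agree b1 (agreeW ik ag); rewrite L1 U1 subrr => /esym/eqP.
  rewrite mulf_eq0 invr_eq0 expf_eq0 [b == 0]gt_eqF// andbF orbF subr_eq0.
  by move/eqP.
have mid i : (0 < i <= k)%N -> `|phi b (shift_seq i L)| < 1.
  move=> /andP[i0 ik]; rewrite lt_neqAle Lin andbT; apply/negP => /eqP.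
  have agk := ag (k - i)%N.
  have ki : (k - i < k)%N by lia.
  have Li : shift_seq i L (k - i)%N = L k by rewrite shift_seqE subnKC.
  have Ui : shift_seq i U (k - i)%N = U k by rewrite shift_seqE subnKC.
  have [p|p] := leP 0 (phi b (shift_seq i L)).
    rewrite ger0_norm// => e; have e' := e; rewrite agphi// in e'.
    by rewrite (LE _ e) in Li; rewrite (UE _ e') in Ui; rewrite -Li -Ui agk// ltnn in lt.
  rewrite ltr0_norm// => e; have e1 : phi b (shift_seq i L) = -1 by lra.
  have e' := e1; rewrite agphi// in e'.
  rewrite (LN _ e1) refl_seqE in Li; rewrite (UN _ e') refl_seqE in Ui.
  by rewrite -Li -Ui agk// ltnn in lt.
have Uk : (U k : nat) = (L k).+1.
  have h1 := phi_rec_shift L k b1; have h2 := phi_rec_shift U k b1.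
  rewrite Lk1 in h1; rewrite Uk1 -agphi// h1 in h2.
  apply/eqP; rewrite -(eqr_nat R) -natr1; apply/eqP; move: h2; rewrite /digits_pm; lra.
pose a : word M := mkseq L k.+1.
have sa : size a = k.+1 by rewrite size_mkseq.
have aL : agree k.+1 (nth ord0 a) L by move=> i ik; rewrite nth_mkseq.
have LP : L = periodic a.
  by apply: periodic_eq; rewrite sa//; exact: agree_sym.
have UP : U = plus_seq a.
  apply/funext => i; rewrite /plus_seq /prepend periodic_refl_word ?sa// -LP.
  rewrite size_incr_last ?sa//; case: ltnP => ik; last first.
    by rewrite -sU shift_seqE subnKC.
  have lastM : (nth ord0 a k < M)%N.
    by rewrite aL//=; have := ltn_ord (U k); lia.
  apply/ord_inj; rewrite nth_incr_last ?sa// aL//=.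
  move: ik; rewrite ltnS leq_eqVlt => /predU1P[->|ik]; first by rewrite eqxx addn1.
  by rewrite ag// ltn_eqF// addn0.
exists a; split => //; last 2 first.
- by rewrite sa.
- by move=> i; rewrite sa ltnS; exact: mid.
have [k0|kp] := posnP k.
- have aE : a = [:: L 0%N] by rewrite /a k0.
  rewrite k0 in Lk1 Uk.
  have := phi_rec L b1; rewrite L1 mulr1 Lk1 /digits_pm => bE.
  have h : (M < 2 * L 0)%N by rewrite -(ltr_nat R) natrM; lra.
  have := ltn_ord (U 0%N); rewrite Uk => hU.
  right; split; first by lia.
  by exists (L 0%N); split => //; rewrite ?rev_digitE; lia.
- apply: (@periodic_admissible _ _ U); rewrite ?sa//.
    by rewrite -LP; apply: agree_sym.
  move=> i ik; rewrite -LP; split.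
    apply: Lmin; first exact: tails_in_shift.
    apply: (le_lt_trans (ler_norm _)); apply: mid; lia.
  by apply: Rle; exact: tails_in_shift.
Qed.

End FirstReturn.

(** The period of a first return satisfies [b^m >= 2].  Let [1 - r] be the
    largest absolute value of the intermediate orbit points, and follow the
    interval [(1 - r, 1)] along the orbit of 1; its left end point is again an
    orbit point up to sign.  If the interval ever covers [-1], it contains a
    neighbourhood of radius [r] of a boundary point on both sides, so that its
    length has at least doubled.  Otherwise its left end point after [m] steps
    is minus the [k]-th orbit point, which forces [r > 2/3] and leaves no room
    for the first two orbit points. *)
Lemma return_time_ge2 (R : realType) (M m : nat) (b : R) (x : nat -> R) (l : nat -> nat) :
  1 < b -> (0 < m)%N -> (forall i, (i < m)%N -> b * x i = 2 * (l i)%:R - M%:R + x i.+1) ->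
  x 0%N = 1 -> x m = 1 -> (forall i, (0 < i < m)%N -> `|x i| < 1) ->
  2 <= b ^+ m.
Proof.
move=> b1 m0 rec x0 xm xlt; have b0 : 0 < b by lra.
have [m1|m2] := leqP m 1.
  have mE : m = 1%N by lia.
  have x1 : x 1%N = 1 by rewrite -xm mE.
  rewrite mE expr1; have := rec 0%N m0; rewrite x1 x0 mulr1 => bE.
  have h : (M.+1 < 2 * l 0 + 1)%N.
    by rewrite -(ltr_nat R) natrD natrM -natr1; lra.
  have : (M.+2 <= 2 * l 0 + 1)%N by [].
  by rewrite -(ler_nat R) natrD natrM -natr1 -natr1; lra.
rewrite leNgt; apply/negP => bm2.
have bpow j : (j <= m)%N -> b ^+ j < 2.
  move=> jm; apply: le_lt_trans bm2; apply: ler_weXn2l => //; exact: ltW.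
have [k kP ymax] : exists2 k, (0 < k < m)%N & forall i, (0 < i < m)%N -> `|x i| <= `|x k|.
  have i1 : (1 < m)%N by [].
  pose K := [arg max_(i > Ordinal i1 | (0 < i)%N) `|x i| ]%O.
  have [kk kk0 kmax] : exists2 k : 'I_m, (0 < k)%N & forall i : 'I_m, (0 < i)%N -> `|x i| <= `|x k|.
    case: (@arg_maxP _ _ _ (Ordinal i1) (fun i : 'I_m => (0 < i)%N) (fun i => `|x i|)) => //= k k0 kmax.
    by exists k.
  exists kk; first by rewrite kk0 ltn_ord.
  by move=> i /andP[i0 im]; have := kmax (Ordinal im) i0.
set y := `|x k| in ymax.
have y1 : y < 1 by exact: xlt.
have y0 : 0 <= y by exact: normr_ge0.
pose r := 1 - y; have r0 : 0 < r by rewrite /r; lra.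
pose e i := x i - b ^+ i * r.
have eS i : (i < m)%N -> e i.+1 = b * e i - (2 * (l i)%:R - M%:R).
  by move=> im; have := rec i im; rewrite /e exprS; lra.
have xle i : (i <= m)%N -> -y <= x i /\ x i <= 1.
  move=> im; have [->|i0] := posnP i; first by rewrite x0; split; lra.
  move: im; rewrite leq_eqVlt => /predU1P[->|im]; first by rewrite xm; split; lra.
  have := ymax i; rewrite i0 im => /(_ isT); rewrite ler_norml => /andP[? ?].
  by split => //; lra.
have elt1 i : (i <= m)%N -> e i < 1.
  move=> im; have [_ ?] := xle i im.
  have : 0 < b ^+ i * r by rewrite mulr_gt0 ?exprn_gt0.
  rewrite /e; lra.
(* an interval that covers [-1] has at least doubled *)
have esmall i : (i <= m)%N -> y - 2 < e i.
  move=> im; have [? _] := xle i im; have := bpow i im => h.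
  have : b ^+ i * r < 2 * r by rewrite ltr_pM2r.
  rewrite /e /r in r0 *; lra.
pose s : R := if 0 <= x k then 1 else -1.
have sx : s * x k = y.
  by rewrite /s /y; case: leP => h; [rewrite ger0_norm ?mul1r|rewrite ltr0_norm ?mulN1r].
have sP : s = 1 \/ s = -1 by rewrite /s; case: ifP; [left|right].
have sint i j : exists t : int, s * (2 * (l i)%:R - M%:R) - (2 * (l j)%:R - M%:R) = 2 * t%:~R :> R.
  case: sP => ->.
    exists ((l i)%:Z - (l j)%:Z); rewrite intrB -!pmulrn; lra.
  exists (M%:Z - (l i)%:Z - (l j)%:Z); rewrite !intrB -!pmulrn; lra.
have int_cases (t : int) : [\/ t%:~R <= -1 :> R, t%:~R = 0 :> R | 1 <= t%:~R :> R].
  have [t0|t0|->] := ltgtP t 0; [apply: Or31|apply: Or33|exact: Or32].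
    by rewrite -[-1](@mulrN1z R 1) ler_int; lia.
  by rewrite -[1](mulr1z 1) ler_int; lia.
have km : (k < m)%N by case/andP: kP.
have k0 : (0 < k)%N by case/andP: kP.
(* both sides follow the orbit up to even integers, and the bounds on [e] allow
   no other even integer than 0 *)
have phase1 i : (i < m - k)%N -> e i = s * x (k + i)%N.
  elim: i => [|i ih] im; first by rewrite /e x0 expr0 mul1r addn0 sx /r; lra.
  have im' : (i < m)%N by lia.
  have [t tE] := sint (k + i)%N i.
  have E : e i.+1 = s * x (k + i.+1)%N + 2 * t%:~R.
    rewrite eS// ih; last by lia.
    rewrite mulrCA rec; last by lia.
    by rewrite addnS mulrDr -tE; lra.
  have : `|s * x (k + i.+1)%N| <= y.
    by rewrite normrM (_ : `|s| = 1) ?mul1r ?ymax//; [lia|case: sP => ->; rewrite ?normrN1 ?normr1].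
  rewrite ler_norml => /andP[h1 h2]; have h3 := elt1 i.+1 im'; have h4 := esmall i.+1 im'.
  rewrite E in h3 h4 *; move: (int_cases t) h1 h2 h3 h4 y1.
  by clear; case=> h h1 h2 h3 h4 y1; lra.
(* when [s * x] reaches [x m = 1] up to sign, the left end must be at [-1] *)
have bdry : e (m - k)%N = -1.
  have iS : (m - k = (m - k).-1.+1)%N by lia.
  rewrite iS; set i := (m - k).-1 in iS *.
  have im' : (i < m)%N by lia.
  have [t tE] := sint (k + i)%N i.
  have E : e i.+1 = s + 2 * t%:~R.
    rewrite eS// phase1; last by lia.
    rewrite mulrCA rec; last by lia.
    have -> : (k + i).+1 = m by lia.
    by rewrite xm mulrDr -tE; lra.
  have h3 := elt1 i.+1 im'; have h4 := esmall i.+1 im'; rewrite E in h3 h4 *.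
  move: (int_cases t) sP h3 h4 y0 y1; clear.
  case=> h; case=> sE; rewrite sE => h3 h4 y0 y1; try lra.
  have [t1|t1] := leP t (-2).
    by have : t%:~R <= (-2)%:~R :> R; [rewrite ler_int|rewrite mulrNz; lra].
  have : (-1)%:~R <= t%:~R :> R by rewrite ler_int; lia.
  by rewrite mulrN1z; lra.
have phase2 i : (i <= k)%N -> e (m - k + i)%N = - x i.
  elim: i => [|i ih] ik; first by rewrite addn0 bdry x0.
  have im' : (m - k + i < m)%N by lia.
  have [t tE] : exists t : int, - (2 * (l i)%:R - M%:R) - (2 * (l (m - k + i)%N)%:R - M%:R) = 2 * t%:~R :> R.
    exists (M%:Z - (l i)%:Z - (l (m - k + i)%N)%:Z); rewrite !intrB -!pmulrn; lra.
  have E : e (m - k + i.+1)%N = - x i.+1 + 2 * t%:~R.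
    rewrite addnS eS// ih; last by lia.
    rewrite mulrN rec; last by lia.
    by rewrite -tE; lra.
  have : `|x i.+1| <= y by apply: ymax; lia.
  rewrite ler_norml => /andP[h1 h2].
  have im2 : (m - k + i.+1 <= m)%N by lia.
  have h3 := elt1 _ im2; have h4 := esmall _ im2; rewrite E in h3 h4 *.
  move: (int_cases t) h1 h2 h3 h4 y1.
  by clear; case=> h h1 h2 h3 h4 y1; lra.
have := phase2 k (leqnn k); rewrite subnK; last by lia.
rewrite /e xm => em.
have bm1 : 1 < b ^+ m by rewrite exprn_egt1// gt_eqF.
(* the case [s = -1] would give [b ^+ m * r = r]; otherwise [r = 2 / (1 + b ^+ m)] *)
have y3 : y < 3^-1.
  have : b ^+ m * r < 2 * r by rewrite ltr_pM2r.
  case: sP => sE; rewrite sE in sx.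
    by rewrite /r in r0 em *; lra.
  have : b ^+ m * r = r by rewrite /r in em *; lra.
  by move=> h; have : 1 * r < b ^+ m * r; [rewrite ltr_pM2r|lra].
have b32 : b < 3 / 2.
  rewrite ltNge; apply/negP => h; have : b ^+ 2 <= b ^+ m by apply: ler_weXn2l => //; exact: ltW.
  move: h bm2; rewrite expr2; clear => h bm2 b2.
  have : 3 / 2 * (3 / 2) <= b * b by apply: ler_pM; lra.
  lra.
clear - rec x0 xm ymax m2 b1 b32 y3.
have r1 := rec 0%N (ltnW m2); rewrite x0 mulr1 in r1.
have : `|x 1%N| <= y by exact: ymax.
rewrite ler_norml => /andP[h1 h2].
(* [x 1] determines the digit at position 0, and then no digit fits at position 1 *)
have c0 : (2 * l 0 = M.+1)%N.
  have lo : (M < 2 * l 0)%N by rewrite -(ltr_nat R) natrM; lra.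
  have hi : (2 * l 0 < M + 2)%N by rewrite -(ltr_nat R) natrM natrD; lra.
  by move: lo hi; clear; lia.
have x1E : x 1%N = b - 1.
  by have : (2 * l 0)%:R = M.+1%:R :> R by [rewrite c0]; rewrite natrM -natr1; lra.
have r2 := rec 1%N m2; rewrite x1E in r2.
have bb : 0 < b * (b - 1) < 4 / 9.
  have b43 : b < 4 / 3 by rewrite x1E in h2; lra.
  move: b1 b43; clear => b1 b43; rewrite mulr_gt0//=; [|lra..].
  have : b * (b - 1) < 4 / 3 * 3^-1 by apply: ltr_pM; lra.
  lra.
have /andP[bb0 bb1] := bb.
have [m3|m3] := ltnP 2 m; last first.
  have mE : m = 2%N by apply/eqP; rewrite eqn_leq m3.
  have x2 : x 2%N = 1 by rewrite -xm mE.
  rewrite x2 in r2; clear - r2 bb0 bb1.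
  have lo : (M < 2 * l 1 + 1)%N by rewrite -(ltr_nat R) natrD natrM; lra.
  have hi : (2 * l 1 < M)%N by rewrite -(ltr_nat R) natrM; lra.
  by move: lo hi; clear; lia.
have : `|x 2%N| <= y by exact: ymax.
rewrite ler_norml => /andP[h3 h4]; clear - h3 h4 r2 bb0 bb1 y3 c0.
have lo : (M < 2 * l 1 + 1)%N by rewrite -(ltr_nat R) natrD natrM; lra.
have hi : (2 * l 1 < M + 1)%N by rewrite -(ltr_nat R) natrD natrM; lra.
by move: lo hi c0; clear; lia.
Qed.

(** * Entropy *)

Section EntropyBounds.
Variables (R : realType) (M : nat).
Implicit Types (b q : R) (X : set (Omega M)) (n : nat) (l : \bar R).

Lemma limn_einf_ge (u : nat -> \bar R) (x : R) :
  (forall e : R, 0 < e -> exists N, forall n, (N <= n)%N -> ((x - e)%:E <= u n)%E) ->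
  (x%:E <= limn_einf u)%E.
Proof.
move=> h; rewrite limn_einf_lim (cvg_lim _ (@cvg_einfs_sup _ u))//.
apply/lee_addgt0Pr => e e0; have [N hN] := h e e0.
rewrite -leeBlDr// -EFinB; apply: (@le_trans _ _ (einfs u N)).
  by apply: le_ereal_inf_tmp => _ [k /= Nk <-]; exact: hN.
by apply: ereal_sup_ubound; exists N.
Qed.

Lemma limn_einf_le (u : nat -> \bar R) (x : R) :
  (forall e : R, 0 < e -> exists N, forall n, (N <= n)%N -> (u n <= (x + e)%:E)%E) ->
  (limn_einf u <= x%:E)%E.
Proof.
move=> h; rewrite limn_einf_lim (cvg_lim _ (@cvg_einfs_sup _ u))//.
apply/lee_addgt0Pr => e e0; have [N hN] := h e e0.
apply: ge_ereal_sup => _ [k _ <-]; rewrite -EFinD.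
apply: le_trans (hN (maxn N k) (leq_maxl _ _)).
by apply: ereal_inf_lbound; exists (maxn N k) => //=; rewrite leq_maxr.
Qed.

Lemma div_small (c e : R) : 0 < e -> exists N, forall n, (N <= n)%N ->
  (0 < n)%N /\ `|c| / n%:R <= e.
Proof.
move=> e0; exists (Num.truncn (`|c| / e)).+1 => n Nn.
have n0 : (0 < n)%N by exact: leq_trans Nn.
split => //; rewrite ler_pdivrMr ?ltr0n// -ler_pdivrMl// mulrC.
have ce : 0 <= `|c| / e by rewrite divr_ge0// ltW.
apply/ltW; rewrite -truncn_lt_nat//.
Qed.

Lemma entropy_ge X b (c : R) : 0 < b -> 0 < c ->
  (forall n, c * b ^+ n <= (num_words X n)%:R) -> ((ln b)%:E <= entropy R X)%E.
Proof.
move=> b0 c0 h; apply: limn_einf_ge => e e0.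
have [N hN] := div_small (ln c) e0; exists N => n Nn; have [n0 small] := hN n Nn.
have cb0 : 0 < c * b ^+ n by rewrite mulr_gt0// exprn_gt0.
have N0 : 0 < (num_words X n)%:R :> R by exact: lt_le_trans (h n).
rewrite lne_EFin// -EFinM lee_fin.
have : ln (c * b ^+ n) <= ln (num_words X n)%:R by rewrite ler_ln ?posrE.
rewrite lnM ?posrE ?exprn_gt0// lnXn// => hl.
have n0' : 0 < n%:R :> R by rewrite ltr0n.
rewrite -(ler_pM2l n0') mulVKf ?gt_eqF//; apply: le_trans hl.
rewrite mulrBr mulr_natl lerBlDr.
have : `|ln c| <= n%:R * e by rewrite -ler_pdivrMl// mulrC.
have : - ln c <= `|ln c| by rewrite -normrN ler_norm.
lra.
Qed.

Lemma entropy_le X b (c : R) : 0 < b -> 0 < c ->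
  (forall n, (num_words X n)%:R <= c * b ^+ n) -> (entropy R X <= (ln b)%:E)%E.
Proof.
move=> b0 c0 h; apply: limn_einf_le => e e0.
have [N hN] := div_small (ln c) e0; exists N => n Nn; have [n0 small] := hN n Nn.
have cb0 : 0 < c * b ^+ n by rewrite mulr_gt0// exprn_gt0.
have n0' : 0 < n%:R :> R by rewrite ltr0n.
have [z|nz] := posnP (num_words X n).
  by rewrite z le0_lneNy// gt0_muleNy ?leNye// lte_fin invr_gt0.
have N0 : 0 < (num_words X n)%:R :> R by rewrite ltr0n.
rewrite lne_EFin// -EFinM lee_fin.
have : ln (num_words X n)%:R <= ln (c * b ^+ n) by rewrite ler_ln ?posrE.
rewrite lnM ?posrE ?exprn_gt0// lnXn// => hl.
rewrite -(ler_pM2l n0') mulVKf ?gt_eqF//; apply: (le_trans hl).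
rewrite mulrDr mulr_natl.
have : `|ln c| <= n%:R * e by rewrite -ler_pdivrMl// mulrC.
have := ler_norm (ln c).
lra.
Qed.

Lemma num_words_le X n : (num_words X n <= M.+1 ^ n)%N.
Proof.
apply: leq_trans (max_card _) _.
by rewrite card_tuple card_ord.
Qed.

Lemma entropy_pos_ln q : (0 < M)%N -> (0 < entropy R (@Utilde R M q))%E ->
  exists2 b, @bases R M b & entropy R (@Utilde R M q) = (ln b)%:E.
Proof.
move=> M0 h0.
have hM : (entropy R (@Utilde R M q) <= (ln M.+1%:R)%:E)%E.
  apply: (@entropy_le _ _ 1) => //; rewrite ?ltr0n// => n.
  by rewrite mul1r -natrX ler_nat; exact: num_words_le.
move: h0 hM; case: (entropy R _) => [x| |]//=.
rewrite lte_fin lee_fin => x0 xM; exists (expR x); last by rewrite expRK.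
apply/basesP; rewrite expR_gt1 x0/= -[leRHS]lnK ?posrE ?ltr0n//.
by rewrite ler_expR.
Qed.

(** If the tails stay away from [-1] and [1], then sequences with different
    prefixes of length [n] have values at distance at least a constant times
    [b ^- n], which bounds the number of prefixes. *)
Lemma num_words_separated X b (eta : R) : 1 < b -> 0 < eta ->
  (forall d n, X d -> `|phi b (shift_seq n d)| <= 1 - eta) ->
  forall n, (num_words X n)%:R <= (eta^-1 + 1) * b ^+ n.
Proof.
move=> b1 eta0 h n; have b0 : 0 < b by lra.
have bn0 : 0 < b ^+ n by rewrite exprn_gt0.
have bn1 : 1 <= b ^+ n by rewrite exprn_ege1// ltW.
pose A := [pred w : n.-tuple 'I_M.+1 | `[< occurs X w >] ].
have ex (w : n.-tuple 'I_M.+1) : exists e : Omega M, w \in A ->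
    (forall k, `|phi b (shift_seq k e)| <= 1 - eta) /\ forall i : 'I_n, tnth w i = e i.
  have [/asboolP[d [k [Xd wE]]]|_] := boolP (w \in A); last by exists (fun=> ord0).
  exists (shift_seq k d) => _; split => // j; by rewrite shift_seqD; exact: h.
have [E EP] := choice ex.
pose t w : R := (phi b (E w) + 1) * b ^+ n / (2 * eta).
have tb w : w \in A -> 0 <= t w < eta^-1 * b ^+ n.
  move=> /EP[/(_ 0%N) + _]; rewrite shift_seq0 ler_norml => /andP[h1 h2].
  rewrite /t; apply/andP; split.
    by rewrite !mulr_ge0 ?invr_ge0 ?mulr_ge0// ?ltW//; lra.
  rewrite ltr_pdivrMr ?mulr_gt0// [ltRHS](_ : _ = 2 * b ^+ n); last by field; lra.
  by rewrite ltr_pM2r//; lra.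
set K := Num.truncn (eta^-1 * b ^+ n).
have tK w : w \in A -> (Num.truncn (t w) < K.+1)%N.
  move=> /tb/andP[h1 h2]; rewrite ltnS; apply: le_truncn.
  exact: ltW.
pose f w : 'I_K.+1 := inord (Num.truncn (t w)).
have finj : {in A &, injective f}.
  move=> w w' Aw Aw' /(congr1 (@nat_of_ord _)); rewrite !inordK ?tK// => fe.
  have [wt wE] := EP w Aw; have [wt' wE'] := EP w' Aw'.
  have sep e e' : (forall k, `|phi b (shift_seq k e)| <= 1 - eta) ->
      (forall k, `|phi b (shift_seq k e')| <= 1 - eta) ->
      lt_within n e e' -> 2 * eta / b ^+ n <= phi b e' - phi b e.
    move=> he he' [j jn [ag lt]]; have := phi_first_diff b1 ag lt.
    have := he j.+1; have := he' j.+1; rewrite !ler_norml => /andP[h1 h2] /andP[h3 h4] h5.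
    have bj0 : 0 < b ^+ j.+1 by rewrite exprn_gt0.
    apply: (@le_trans _ _ (2 * eta / b ^+ j.+1)).
      rewrite ler_pM2l ?mulr_gt0// lef_pV2 ?posrE//.
      by apply: ler_weXn2l => //; exact: ltW.
    suff : (phi b (shift_seq j.+1 e) - phi b (shift_seq j.+1 e') - 2) / b ^+ j.+1 <=
      - (2 * eta / b ^+ j.+1) by lra.
    by rewrite -mulNr ler_pM2r ?invr_gt0//; lra.
  have close : `|phi b (E w) - phi b (E w')| < 2 * eta / b ^+ n.
    have /andP[t0 _] := tb w Aw; have /andP[t0' _] := tb w' Aw'.
    have /andP[h1 h2] := truncn_itv t0; have /andP[h3 h4] := truncn_itv t0'.
    rewrite fe in h1 h2; have : `|t w - t w'| < 1.
      by rewrite ltr_norml -natr1 in h2 h4 *; apply/andP; split; lra.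
    have -> : t w - t w' = (phi b (E w) - phi b (E w')) / (2 * eta / b ^+ n).
      by rewrite /t; field; rewrite !gt_eqF.
    have c0 : 0 < 2 * eta / b ^+ n by rewrite divr_gt0// mulr_gt0.
    by rewrite normrM normfV (gtr0_norm c0) ltr_pdivrMr// mul1r.
  apply: eq_from_tnth => i; rewrite wE wE'.
  have [->//|[/sep|/sep]] := agree_or n (E w) (E w').
  - move=> /(_ wt wt') hs; have := ler_norm (phi b (E w') - phi b (E w)).
    by move: hs close; rewrite [X in X < _]distrC => ? ? ?; exfalso; lra.
  - move=> /(_ wt' wt) hs; have := ler_norm (phi b (E w) - phi b (E w')).
    by move=> ?; exfalso; lra.
have := @leq_card_in _ 'I_K.+1 f A finj; rewrite card_ord -/(num_words X n).
rewrite -(ler_nat R) => /le_trans; apply.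
rewrite -natr1 mulrDl mul1r lerD// /K.
have t0 : 0 <= eta^-1 * b ^+ n by rewrite mulr_ge0 ?invr_ge0 ?ltW.
by have /andP[] := truncn_itv t0.
Qed.

(** Only countably many points have an orbit that meets [-1] or [1], since such
    a point is determined by a finite word and a sign. *)
Lemma countable_bad b : @bases R M b ->
  countable [set x : R | `|x| <= 1 /\ exists n, `|phi b (shift_seq n (greedy M b x))| = 1].
Proof.
move=> bb; have b1 := bases_gt1 bb.
pose F (p : seq 'I_M.+1 * bool) : R := phi b (prepend (p.1 : word M)
   (if p.2 then upper_one M b else refl_seq (upper_one M b))).
apply: (@sub_countable _ _ _ (range F)); last first.
  exact: sub_countable (card_image_le F setT) (countableP _).
apply: subset_card_le => x [x1 [n xn]].
have [tl gx _] := greedy_spec bb x1.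
set d := greedy M b x in xn tl gx.
have [s sE] : exists s : bool, phi b (shift_seq n d) = (if s then 1 else -1).
  have [p|p] := leP 0 (phi b (shift_seq n d)); first by exists true; rewrite -xn ger0_norm.
  by exists false; rewrite -xn ltr0_norm// opprK.
exists (mkseq d n, s) => //=; rewrite /F /= -gx.
set u := if s then _ else _.
have uE : phi b u = if s then 1 else -1.
  by rewrite /u; case: (s); rewrite ?phi_refl// phi_upper_one.
have ag : agree n (prepend (mkseq d n : word M) u) d.
  by move=> i ni; rewrite /prepend size_mkseq ni nth_mkseq.
have sh : shift_seq n (prepend (mkseq d n : word M) u) = u.
  by rewrite -[n in shift_seq n _](size_mkseq d n) shift_prepend.
have := phi_agree b1 ag; rewrite sh uE sE subrr mul0r => /eqP.
by rewrite subr_eq0 => /eqP.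
Qed.

Lemma exists_good b (x y : R) : @bases R M b -> -1 <= x -> x < y -> y <= 1 ->
  exists z, [/\ x < z, z < y & forall n, `|phi b (shift_seq n (greedy M b z))| < 1].
Proof.
move=> bb x1 xy y1; apply: contrapT => h.
have sub : `]x, y[ `<=` [set x : R | `|x| <= 1 /\
    exists n, `|phi b (shift_seq n (greedy M b x))| = 1].
  move=> z; rewrite /= in_itv/= => /andP[xz zy].
  have z1 : `|z| <= 1 by rewrite ler_norml; apply/andP; split; lra.
  split => //; apply: contrapT => hn; apply: h; exists z; split => // n.
  have [tl _ _] := greedy_spec bb z1.
  by rewrite lt_neqAle tl andbT; apply/eqP => e; apply: hn; exists n.
have := countable_lebesgue_measure0 (sub_countable (subset_card_le sub) (countable_bad bb)).
rewrite lebesgue_measure_itv/= lte_fin xy -EFinB => -[] /eqP.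
by rewrite subr_eq0 gt_eqF.
Qed.

(** Points of [[-1, 1]] at distance more than [2 b ^- n] have expansions with
    different prefixes of length [n]. *)
Lemma num_words_cover X b : @bases R M b ->
  (forall d, (forall n, `|phi b (shift_seq n d)| < 1) -> X d) ->
  forall n, 4^-1 * b ^+ n <= (num_words X n)%:R.
Proof.
move=> bb h n; have b1 := bases_gt1 bb; have b0 : 0 < b by lra.
have bn0 : 0 < b ^+ n by rewrite exprn_gt0.
have bn1 : 1 <= b ^+ n by rewrite exprn_ege1// ltW.
set K := (Num.truncn (b ^+ n / 4)).+1.
have /andP[K1 K2] : K%:R - 1 <= b ^+ n / 4 < K%:R.
  have t0 : 0 <= b ^+ n / 4 by lra.
  by have /andP[h1 h2] := truncn_itv t0; rewrite /K h2 andbT -natr1 addrK.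
pose l (j : nat) : R := -1 + (3 * j%:R) / b ^+ n.
have lb (j : 'I_K) : -1 <= l j /\ l j + (2 * b ^+ n)^-1 <= 1.
  split; first by rewrite /l lerDl divr_ge0 ?mulr_ge0// ltW.
  have jK : (j : nat)%:R <= K%:R - 1 :> R.
    by have := ltn_ord j; rewrite -(ler_nat R) -natr1; lra.
  rewrite /l invfM -addrA; set w := (b ^+ n)^-1.
  have w0 : 0 < w by rewrite invr_gt0.
  have h1 : (j : nat)%:R * w <= 4^-1.
    have : (j : nat)%:R * w <= (b ^+ n / 4) * w by rewrite ler_pM2r//; lra.
    by rewrite mulrAC mulfV ?mul1r// gt_eqF.
  have h2 : w <= 1 by rewrite /w invf_le1.
  by move: h1 h2; rewrite -mulrA; clear; lra.
have ex (j : 'I_K) : exists z, [/\ l j < z, z < l j + (2 * b ^+ n)^-1 &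
    forall n, `|phi b (shift_seq n (greedy M b z))| < 1].
  have [l0 l1] := lb j; apply: exists_good => //.
  by rewrite ltrDl invr_gt0 mulr_gt0.
have [z zP] := choice ex.
pose g j := greedy M b (z j).
pose f (j : 'I_K) : n.-tuple 'I_M.+1 := [tuple g j i | i < n].
have z1 j : `|z j| <= 1.
  have [l0 l1] := lb j; have [h1 h2 _] := zP j.
  rewrite ler_norml (ltW (le_lt_trans l0 h1)) /=; exact: ltW (lt_le_trans h2 l1).
have fX j : f j \in [pred w : n.-tuple 'I_M.+1 | `[< occurs X w >] ].
  apply/asboolP; exists (g j), 0%N; split; first by apply: h; case: (zP j).
  by move=> i; rewrite tnth_mktuple.
have far (i j : 'I_K) : (i < j)%N -> 2 / b ^+ n < z j - z i.
  move=> ij; have [h1 h2 _] := zP i; have [h3 h4 _] := zP j.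
  have : (i : nat)%:R + 1 <= (j : nat)%:R :> R by rewrite natr1 ler_nat.
  have w0 : 0 < (b ^+ n)^-1 by rewrite invr_gt0.
  rewrite -(ler_pM2r w0); move: h1 h2 h3 h4; rewrite /l invfM -!mulrA; lra.
have finj : injective f.
  have main (i j : 'I_K) : (i < j)%N -> f i <> f j.
    move=> ij fij; have ag : agree n (g j) (g i).
      by move=> k kn; have := congr1 (fun t => tnth t (Ordinal kn)) fij; rewrite !tnth_mktuple.
    have [tli gi _] := greedy_spec bb (z1 i); have [tlj gj _] := greedy_spec bb (z1 j).
    have := phi_agree b1 ag; rewrite gi gj => E; have := far i j ij; rewrite E.
    rewrite ltr_pM2r ?invr_gt0//; have := tli n; have := tlj n.
    rewrite -/(g i) -/(g j); move: (phi b (shift_seq n (g j))) (phi b (shift_seq n (g i))).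
    by clear; move=> u v; rewrite !ler_norml => /andP[? ?] /andP[? ?] ?; lra.
  clearbody f; move=> i j fij; have [lt|lt|e] := ltngtP i j.
  - by case: (main i j lt fij).
  - by case: (main j i lt (esym fij)).
  - exact: ord_inj e.
have : (K <= num_words X n)%N.
  rewrite -[K in (K <= _)%N]card_ord -(card_codom finj) /num_words.
  by apply: subset_leq_card; apply/fintype.subsetP => _ /codomP[j ->]; exact: fX.
by rewrite -(ler_nat R); lra.
Qed.

End EntropyBounds.

(** ** The bases of a given entropy *)

Section EntropyLevels.
Variables (R : realType) (M : nat).
Implicit Types (b q : R) (d e f : Omega M) (n k i : nat).

Lemma phi_lipschitz b0 b b' d : 1 < b0 -> b0 <= b -> b0 <= b' ->
  `|phi b d - phi b' d| <= 3 * (M%:R / (b0 - 1) ^+ 2) * `|b - b'|.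
Proof.
move=> b01 bb bb'; have := qval_lipschitz d b01 bb bb'.
set C := M%:R / (b0 - 1) ^+ 2; have C0 : 0 <= C by rewrite divr_ge0// sqr_ge0.
have h : `|M%:R / (b' - 1) - M%:R / (b - 1)| <= C * `|b - b'|.
  have -> : M%:R / (b' - 1) - M%:R / (b - 1) = M%:R / ((b - 1) * (b' - 1)) * (b - b').
    by field; apply/andP; split; lra.
  have p0 : 0 < (b - 1) * (b' - 1) by rewrite mulr_gt0//; lra.
  rewrite normrM ler_wpM2r// ger0_norm; last by rewrite divr_ge0// ltW.
  rewrite /C ler_wpM2l//.
  rewrite lef_pV2 ?posrE// ?exprn_gt0//; last by lra.
  by rewrite expr2 ler_pM//; lra.
have -> : phi b d - phi b' d =
    2 * (qval b d - qval b' d) + (M%:R / (b' - 1) - M%:R / (b - 1)) by rewrite /phi; lra.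
move=> h'; apply: (le_trans (ler_normD _ _)); rewrite normrM ger0_norm//; lra.
Qed.

Lemma positive_lower_bound (f : nat -> R) (P : pred nat) n :
  (forall j, (j <= n)%N -> P j -> 0 < f j) ->
  exists2 eta : R, 0 < eta & forall j, (j <= n)%N -> P j -> eta <= f j.
Proof.
elim: n => [|n ih] h.
  have [P0|nP0] := boolP (P 0%N).
    by exists (f 0%N) => [|j]; [exact: h|rewrite leqn0 => /eqP->].
  by exists 1 => // j; rewrite leqn0 => /eqP->; rewrite (negbTE nP0).
have [|eta eta0 hn] := ih; first by move=> j jn; apply: h; exact: leqW.
have [P0|nP0] := boolP (P n.+1).
  exists (Num.min eta (f n.+1)) => [|j]; first by rewrite lt_min eta0 h.
  rewrite leq_eqVlt => /predU1P[->|jn Pj]; first by rewrite ge_min lexx orbT.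
  by rewrite ge_min hn.
exists eta => // j; rewrite leq_eqVlt => /predU1P[->|]; first by rewrite (negbTE nP0).
exact: hn.
Qed.

Lemma lt_within_le n d e f : lt_within n d e -> (e <= f)%O -> lt_within n d f.
Proof.
move=> de ef; have [df|[//|/lt_within_lt fd]] := agree_or n d f.
  by have /lt_within_lt := lt_within_agree df (fun i _ => erefl (e i)) de; rewrite ltNge ef.
by have := lt_trans fd (lt_within_lt de); rewrite ltNge ef.
Qed.

Lemma le_lt_within n d e f : (d <= e)%O -> lt_within n e f -> lt_within n d f.
Proof.
move=> de ef; have [df|[//|/lt_within_lt fd]] := agree_or n d f.
  have /lt_within_lt := lt_within_agree (fun i _ => erefl (e i)) (agree_sym df) ef.
  by rewrite ltNge de.
by have := lt_trans (lt_within_lt ef) fd; rewrite ltNge de.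
Qed.

(** A sequence with all tails strictly inside [(-1, 1)] is below [lower_one b],
    and so is its reflection; hence it is counted by [Utilde q]. *)
Lemma entropy_lower_one_le b q : @bases R M b -> (lower_one M b <= alpha M q)%O ->
  ((ln b)%:E <= entropy R (@Utilde R M q))%E.
Proof.
move=> bb le; have b1 := bases_gt1 bb.
apply: (@entropy_ge _ _ _ _ 4^-1); [lra|by []|].
apply: num_words_cover => // d h n.
have tl : tails_in b (shift_seq n d).
  by move=> k; rewrite shift_seqD; exact: ltW.
have := h n; rewrite ltr_norml => /andP[h1 h2].
split; last by apply: lt_le_trans le; exact: lt_lower_one.
rewrite refl_ltC; apply: lt_le_trans le; apply: lt_lower_one => //.
  exact: tails_in_refl.
by rewrite phi_refl//; lra.
Qed.

(** The sequences below [alpha q] first differ from [lower_one b] within a fixed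
    number of digits, and [lower_one_tail] turns this into a distance of their
    values from 1.  The distance survives a small decrease of [b], and
    [num_words_separated] applies in the smaller base. *)
Lemma entropy_lt_lower_one b q : (0 < M)%N -> @bases R M b -> (alpha M q < lower_one M b)%O ->
  (entropy R (@Utilde R M q) < (ln b)%:E)%E.
Proof.
move=> M0 bb lt; have b1 := bases_gt1 bb; have b0 : 0 < b by lra.
have [_ [k _ [ag ltk]]] := (ltOP _ _).1 lt.
have ltw : lt_within k.+1 (alpha M q) (lower_one M b) by exists k.
have [|eta eta0 etaP] := @positive_lower_bound
    (fun j => 1 + phi b (shift_seq j.+1 (lower_one M b)))
    (fun j => 0 < lower_one M b j)%N k.
  by move=> j _ j0; have := lower_one_tail bb j0; lra.
pose eta' := eta / b ^+ k.+1.
have eta'0 : 0 < eta' by rewrite divr_gt0// exprn_gt0.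
have away d n : @Utilde R M q d -> `|phi b (shift_seq n d)| <= 1 - eta'.
  have main e : tails_in b e -> (e < alpha M q)%O -> phi b e <= 1 - eta'.
    move=> te ea; have [j jk [agj ltj]] := le_lt_within (ltW ea) ltw.
    have := phi_first_diff b1 agj ltj; rewrite phi_lower_one//.
    have := te j.+1; rewrite ler_norml => /andP[_ t1].
    have lj0 : (0 < lower_one M b j)%N by exact: leq_ltn_trans ltj.
    have := etaP j jk lj0 => /= he.
    have bj0 : 0 < b ^+ j.+1 by rewrite exprn_gt0.
    have le : eta' <= eta / b ^+ j.+1.
      rewrite /eta' ler_pM2l// lef_pV2 ?posrE ?exprn_gt0//.
      by apply: ler_weXn2l => //; exact: ltW.
    have : (phi b (shift_seq j.+1 e) - phi b (shift_seq j.+1 (lower_one M b)) - 2) /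
        b ^+ j.+1 <= - (eta / b ^+ j.+1).
      by rewrite -mulNr ler_pM2r ?invr_gt0//; lra.
    by lra.
  move=> Ud; have td : tails_in b d.
    apply: tails_in_between => // i; have [U1 U2] := Ud i.
    have le := ltW (lt_le_trans lt (lower_upper bb)).
    split; first by apply: le_trans (ltW U1); rewrite refl_le.
    exact: le_trans (ltW U2) le.
  have [U1 U2] := Ud n; have h1 := main _ (tails_in_shift n td) U2.
  rewrite refl_ltC in U1.
  have := main _ (tails_in_refl b1 (tails_in_shift n td)) U1; rewrite phi_refl// => h2.
  by rewrite ler_norml; apply/andP; split; lra.
pose b0' := (1 + b) / 2.
pose C := 3 * (M%:R / (b0' - 1) ^+ 2) + 1.
have C0 : 0 < C.
  by rewrite ltr_wpDl// mulr_ge0// divr_ge0// sqr_ge0.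
(* [phi] moves by at most [C * (b - b')], which leaves the distance [eta' / 2] *)
pose b' := b - Num.min (b - b0') (eta' / 2 / C).
have m0 : 0 < Num.min (b - b0') (eta' / 2 / C).
  by rewrite lt_min; apply/andP; split; [rewrite /b0'; lra|by do 2?rewrite divr_gt0//].
have m1 : Num.min (b - b0') (eta' / 2 / C) <= b - b0' by rewrite ge_min lexx.
have m2 : Num.min (b - b0') (eta' / 2 / C) <= eta' / 2 / C by rewrite ge_min lexx orbT.
have b'b : b' < b by rewrite /b'; lra.
have b0b' : b0' <= b' by rewrite /b'; lra.
have b01 : 1 < b0' by rewrite /b0'; lra.
have away' d n : @Utilde R M q d -> `|phi b' (shift_seq n d)| <= 1 - eta' / 2.
  move=> Ud; have h1 := away d n Ud.
  have h2 := @phi_lipschitz b0' b' b (shift_seq n d) b01 b0b' (le_trans b0b' (ltW b'b)).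
  have h3 : 3 * (M%:R / (b0' - 1) ^+ 2) * `|b' - b| <= eta' / 2.
    apply: (@le_trans _ _ (C * `|b' - b|)); first by rewrite ler_wpM2r// /C; lra.
    rewrite mulrC -ler_pdivlMr// distrC gtr0_norm; last by lra.
    by rewrite /b' opprB addrC subrK.
  have := ler_normD (phi b' (shift_seq n d) - phi b (shift_seq n d)) (phi b (shift_seq n d)).
  by rewrite subrK; lra.
apply: (@le_lt_trans _ _ (ln b')%:E); last by rewrite lte_fin ltr_ln// posrE; lra.
apply: (@entropy_le _ _ _ _ ((eta' / 2)^-1 + 1)); first by lra.
  by rewrite addr_gt0// invr_gt0; lra.
by apply: num_words_separated => //; lra.
Qed.

Lemma upper_one_top b n : @bases R M b -> b = M.+1%:R -> upper_one M b n = M :> nat.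
Proof.
move=> bb bM; have b1 := bases_gt1 bb; have tl := upper_one_in bb.
have step k : phi b (shift_seq k (upper_one M b)) = 1 ->
    upper_one M b k = M :> nat /\ phi b (shift_seq k.+1 (upper_one M b)) = 1.
  move=> h; have := phi_rec_shift (upper_one M b) k b1; rewrite h mulr1 {1}bM -natr1 /digits_pm.
  have := tl k.+1; rewrite ler_norml => /andP[_ t1].
  have cM := digit_le R (upper_one M b k) => E.
  have cE : (upper_one M b k : nat)%:R = M%:R :> R by lra.
  by split; [apply/eqP; rewrite -(eqr_nat R) cE|lra].
have all k : phi b (shift_seq k (upper_one M b)) = 1.
  elim: k => [|k ih]; first by rewrite shift_seq0 phi_upper_one.
  by have [] := step k ih.
by have [] := step n (all n).
Qed.

(** For [b'] slightly above [b] a sequence with tails in [[-1, 1]] for [b'] is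
    still below [alpha q]: if it exceeded [upper_one b] at one of the first
    digits, then [greedy_tail_lt1] would make its value larger than 1.  So
    [entropy_lower_one_le] applies to [b']. *)
Lemma entropy_gt_upper_one b q : @bases R M b -> (upper_one M b < alpha M q)%O ->
  ((ln b)%:E < entropy R (@Utilde R M q))%E.
Proof.
move=> bb lt; have b1 := bases_gt1 bb; have b0 : 0 < b by lra.
have [_ [k _ [ag ltk]]] := (ltOP _ _).1 lt.
have ltw : lt_within k.+1 (upper_one M b) (alpha M q) by exists k.
have bM : b < M.+1%:R.
  rewrite lt_neqAle (bases_le bb) andbT; apply/eqP => bM.
  by have := ltn_ord (alpha M q k); rewrite (upper_one_top k bb bM) in ltk; lia.
have n1 : `|1 : R| <= 1 by rewrite normr1.
have [|eta eta0 etaP] := @positive_lower_bound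
    (fun j => 1 - phi b (shift_seq j.+1 (upper_one M b)))
    (fun j => upper_one M b j < M)%N k.
  by move=> j _ jM; have := greedy_tail_lt1 bb n1 jM; rewrite -/(upper_one M b); lra.
pose C := 3 * (M%:R / (b - 1) ^+ 2) + 1.
have C0 : 0 < C by rewrite ltr_wpDl// mulr_ge0// divr_ge0// sqr_ge0.
have bk0 : 0 < b ^+ k.+1 by rewrite exprn_gt0.
(* small enough for the Lipschitz error, before and after division by
   [b ^+ j.+1], to stay below [eta] *)
pose del := Num.min (M.+1%:R - b) (eta / 2 / (C * (b ^+ k.+1 + 1))).
have d0 : 0 < del.
  by rewrite lt_min subr_gt0 bM/= divr_gt0 ?divr_gt0// mulr_gt0//; lra.
have d1 : del <= M.+1%:R - b by rewrite ge_min lexx.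
have d2 : C * del * (b ^+ k.+1 + 1) <= eta / 2.
  rewrite mulrAC mulrC -ler_pdivlMr ?mulr_gt0//; last by lra.
  by rewrite ge_min lexx orbT.
pose b' := b + del.
have b'b : @bases R M b' by apply/basesP/andP; split; rewrite /b'; lra.
have below d : tails_in b' d -> (d < alpha M q)%O.
  move=> td; rewrite ltNge; apply/negP => ad.
  have [j jk [agj ltj]] := lt_within_le ltw ad.
  have lip f : phi b' f - C * del <= phi b f /\ phi b f <= phi b' f + C * del.
    have bb' : b <= b' by rewrite /b'; lra.
    have := @phi_lipschitz b b b' f b1 (lexx b) bb'.
    have -> : b - b' = - del by rewrite /b'; lra.
    rewrite normrN (gtr0_norm d0) => h.
    have h' : 3 * (M%:R / (b - 1) ^+ 2) * del <= C * del by rewrite ler_pM2r// /C; lra.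
    have := le_trans h h'; rewrite ler_norml => /andP[? ?].
    by split; lra.
  have := phi_first_diff b1 agj ltj; rewrite phi_upper_one//.
  have [_ l2] := lip d; have [l1 _] := lip (shift_seq j.+1 d).
  have := td j.+1; rewrite ler_norml => /andP[t1 _].
  have := tails_in0 td; rewrite ler_norml => /andP[_ t2].
  have uM : (upper_one M b j < M)%N by rewrite (leq_trans ltj)// -ltnS.
  have := etaP j jk uM => /= he h.
  have bj0 : 0 < b ^+ j.+1 by rewrite exprn_gt0.
  have bjk : b ^+ j.+1 <= b ^+ k.+1 by apply: ler_weXn2l => //; exact: ltW.
  have : - (C * del) * b ^+ j.+1 <= (phi b (shift_seq j.+1 (upper_one M b)) -
      phi b (shift_seq j.+1 d) - 2).
    by rewrite -ler_pdivlMr//; apply: le_trans h; lra.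
  have : C * del * b ^+ j.+1 <= C * del * b ^+ k.+1 by rewrite ler_wpM2l// mulr_ge0// ltW.
  by rewrite mulrDr mulr1 in d2; lra.
apply: (@lt_le_trans _ _ (ln b')%:E).
  by rewrite lte_fin ltr_ln ?posrE /b'; lra.
by apply: entropy_lower_one_le => //; apply/ltW/below; exact: lower_one_in.
Qed.

(** So the bases with entropy [log b] are the [q] for which [alpha q] lies
    between the smallest and the largest expansion of 1. *)
Lemma entropy_level b q : (0 < M)%N -> @bases R M b ->
  entropy R (@Utilde R M q) = (ln b)%:E ->
  (lower_one M b <= alpha M q)%O /\ (alpha M q <= upper_one M b)%O.
Proof.
move=> M0 bb h; split; rewrite leNgt; apply/negP => lt.
- by have := entropy_lt_lower_one M0 bb lt; rewrite h ltxx.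
- by have := entropy_gt_upper_one bb lt; rewrite h ltxx.
Qed.

(** Concatenating the blocks of [c] according to an arbitrary sequence of
    states gives exponentially many words. *)
Lemma entropy_pos_block (c : word M) q : adm_spec c -> (plus_seq c < alpha M q)%O ->
  (0 < entropy R (@Utilde R M q))%E.
Proof.
move=> adm lt; have m0 := adm_size adm; set m := size c in m0.
pose b : R := expR (ln 2 / m%:R).
have b1 : 1 < b by rewrite expR_gt1 divr_gt0 ?ltr0n// ln_gt0// ltr1n.
have bm : b ^+ m = 2.
  rewrite /b -expRM_natl; have -> : m%:R * (ln 2 / m%:R) = ln 2 :> R.
    by rewrite mulrCA mulfV ?mulr1// pnatr_eq0 -lt0n.
  by rewrite lnK// posrE.
have tl st n := @shift_code_le _ c st n adm.
have inU st : @Utilde R M q (code c st).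
  move=> n; split; last exact: le_lt_trans (tl st n) lt.
  by rewrite refl_ltC -shift_refl code_refl//; exact: le_lt_trans (tl _ n) lt.
apply: (@lt_le_trans _ _ (ln b)%:E); first by rewrite lte_fin ln_gt0.
apply: (@entropy_ge _ _ _ _ 2^-1) => // [|n]; first by lra.
set K := (n %/ m)%N.
pose st (w : K.-tuple bool) : nat -> bool := fun i => nth false (false :: w) i.
pose f (w : K.-tuple bool) : n.-tuple 'I_M.+1 := [tuple code c (st w) i | i < n].
have fX w : f w \in [pred w : n.-tuple 'I_M.+1 | `[< occurs (@Utilde R M q) w >] ].
  apply/asboolP; exists (code c (st w)), 0%N; split; first exact: inU.
  by move=> i; rewrite tnth_mktuple.
have Kn : (K * m <= n)%N by exact: leq_divM.
have finj : injective f.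
  move=> w w' fe.
  have ag : agree n (code c (st w)) (code c (st w')).
    by move=> k kn; have := congr1 (fun t => tnth t (Ordinal kn)) fe; rewrite !tnth_mktuple.
  have no (s s' : nat -> bool) i : agree n (code c s) (code c s') -> (i < K)%N ->
      (forall j, (j <= i)%N -> s j = s' j) -> s i.+1 = false -> s' i.+1 = true -> False.
    move=> ags iK h1 h2 h3; have [k ki [_]] := lt_within_code adm h1 h2 h3.
    rewrite ags ?ltnn//; apply: leq_trans ki _; apply: leq_trans Kn.
    by rewrite leq_mul2r iK orbT.
  have same i : (i <= K)%N -> forall j, (j <= i)%N -> st w j = st w' j.
    elim: i => [_ j|i ih iK j]; first by rewrite leqn0 => /eqP ->.
    rewrite leq_eqVlt => /predU1P[->|]; last exact: ih (ltnW iK) _.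
    have hi := ih (ltnW iK).
    case e: (st w i.+1); case e': (st w' i.+1) => //; exfalso.
      exact: (@no (st w') (st w) i (agree_sym ag) iK (fun j ji => esym (hi j ji)) e' e).
    exact: (@no (st w) (st w') i ag iK hi e e').
  apply/val_inj/(@eq_from_nth _ false); first by rewrite !size_tuple.
  move=> i; rewrite size_tuple => iK; exact: (same K (leqnn K) i.+1 iK).
have : (2 ^ K <= num_words (@Utilde R M q) n)%N.
  have := card_codom finj; rewrite card_tuple card_bool => <-.
  by apply: subset_leq_card; apply/fintype.subsetP => _ /codomP[j ->]; exact: fX.
rewrite -(ler_nat R) natrX; apply: le_trans.
rewrite {1}(divn_eq n m) exprD mulnC exprM bm -/K mulrCA ger_pMr ?exprn_gt0//.
have : b ^+ (n %% m) <= b ^+ m by apply: ler_weXn2l; [exact: ltW|exact/ltnW/ltn_pmod].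
by rewrite bm; lra.
Qed.

End EntropyLevels.

(** ** Entropy plateaus are basic intervals *)

Section Plateaus.
Variables (R : realType) (M : nat).
Implicit Types (b q : R) (a : word M) (d : Omega M) (I K : R * R) (n k i : nat).

(** Both sides start with [a], up to 1 in its last digit, and go on with
    sequences that are reflections of each other. *)
Lemma phi_plus_seq b a : 1 < b -> adm_spec a ->
  phi b (plus_seq a) - 1 = (1 - 2 / b ^+ size a) * (phi b (periodic a) - 1).
Proof.
move=> b1 adm; have b0 : 0 < b by lra.
have sE : size a = (size a).-1.+1 by rewrite prednK// adm_size.
have ag := agree_sym (plus_seq_agree_pred adm).
have sP : b ^+ size a = b * b ^+ (size a).-1 by rewrite -exprS -sE.
have := phi_agree b1 ag; rewrite sP.
have r1 := phi_rec_shift (plus_seq a) (size a).-1 b1.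
have r2 := phi_rec_shift (periodic a) (size a).-1 b1.
rewrite -sE shift_plus_seq// phi_refl// in r1; rewrite -sE shift_periodic in r2.
have dE : (plus_seq a (size a).-1 : nat)%:R = (periodic a (size a).-1 : nat)%:R + 1 :> R.
  have lt : ((size a).-1 < size a)%N by rewrite [ltnRHS]sE.
  by rewrite plus_seq_agree// plusE// eqxx periodic_agree// natrD.
move: r1 r2; rewrite /digits_pm dE.
have : 0 < b ^+ (size a).-1 by rewrite exprn_gt0.
move: (b ^+ (size a).-1) (phi b (shift_seq _ (plus_seq a))) (phi b (shift_seq _ (periodic a))).
move: (phi b (plus_seq a)) (phi b (periodic a)) ((periodic a (size a).-1 : nat)%:R) => X Y p c u v c0 r1 r2 h.
have uv : u - v = (2 - 2 * Y) / b.
  by rewrite -[LHS](mulfK (lt0r_neq0 b0)); congr (_ / _); lra.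
have -> : X = Y + (u - v) / c by lra.
by rewrite uv; field; rewrite !gt_eqF.
Qed.

Lemma plus_seq_in b a : @bases R M b -> adm_spec a -> (plus_seq a <= upper_one M b)%O ->
  tails_in b (plus_seq a).
Proof.
move=> bb adm le; apply: tails_in_between => // n; rewrite refl_leC.
rewrite plus_seq_code// -shift_refl code_refl//.
by split; apply: le_trans le; exact: shift_code_le.
Qed.

Lemma level_word b : @bases R M b -> lower_one M b <> upper_one M b ->
  exists a, [/\ admissible a, lower_one M b = periodic a, upper_one M b = plus_seq a &
    2 <= b ^+ size a].
Proof.
move=> bb neq; have b1 := bases_gt1 bb.
have [a [adm Lw Up ret mid]] := first_return bb neq; exists a; split => //.
pose x i := phi b (shift_seq i (lower_one M b)).
apply: (@return_time_ge2 R M _ b x (fun i => lower_one M b i) b1) => [|i _|||].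
- exact: adm_size (admissible_spec adm).
- by rewrite /x phi_rec_shift.
- by rewrite /x shift_seq0 phi_lower_one.
- exact: ret.
- exact: mid.
Qed.

(** The entropy is constant on the basic interval spanned by the expansions of
    1: if its right end had a larger entropy [log g], then the right end of the
    interval would still be an expansion of 1 in base [g], hence so would be the
    left end by [phi_plus_seq], and the entropy would be at least [log g] on
    the whole interval. *)
Lemma level_interval b q0 : (0 < M)%N -> @bases R M b -> @bases R M q0 ->
  entropy R (@Utilde R M q0) = (ln b)%:E -> lower_one M b <> upper_one M b ->
  exists K, [/\ basic_interval M K, itv K q0,
    forall q, itv K q -> entropy R (@Utilde R M q) = (ln b)%:E &
    forall q, @bases R M q -> entropy R (@Utilde R M q) = (ln b)%:E -> itv K q].
Proof.
move=> M0 bb bq0 h0 neq; have b1 := bases_gt1 bb; have b0 : 0 < b by lra.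
have [a [adm' Lw Up bm]] := level_word bb neq; have adm := admissible_spec adm'.
have [K gK] := exists_generates R adm.
have inK q : @bases R M q -> entropy R (@Utilde R M q) = (ln b)%:E -> itv K q.
  by move=> bq hq; apply/(generates_mem gK bq); rewrite -Lw -Up; exact: entropy_level.
exists K; split; [by exists a|exact: inK| |exact: inK].
move=> q Kq.
have bq := generates_bases gK Kq; have [K1 K2 a1 a2] := gK.
have [q1 q2] := (generates_mem gK bq).1 Kq.
have [q01 q02] := (generates_mem gK bq0).1 (inK _ bq0 h0).
have lnb0 : (0 < (ln b)%:E)%E by rewrite lte_fin ln_gt0.
have hge q' : @bases R M q' -> (periodic a <= alpha M q')%O ->
    ((ln b)%:E <= entropy R (@Utilde R M q'))%E.
  by move=> bq' le; apply: entropy_lower_one_le => //; rewrite Lw.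
have K2ge : (periodic a <= alpha M K.2)%O by rewrite a2 ltW// periodic_lt_plus.
have [g bg hg] := entropy_pos_ln M0 (lt_le_trans lnb0 (hge _ K2 K2ge)).
have [g1 g2] := entropy_level M0 bg hg; rewrite a2 -/(plus_seq a) in g1 g2.
have g1' := bases_gt1 bg; have g0 : 0 < g by lra.
have gb : b <= g.
  by have := hge _ K2 K2ge; rewrite hg lee_fin ler_ln ?posrE.
(* no increase of the entropy at the right end *)
have gE : g = b.
  apply/eqP; rewrite eq_le gb andbT leNgt; apply/negP => bg'.
  have tQ := plus_seq_in bg adm g2.
  have Q1 : phi g (plus_seq a) = 1.
    apply/le_anti; have := tails_in0 tQ; rewrite ler_norml => /andP[_ ->] /=.
    by rewrite -(phi_lower_one bg); apply: phi_mono => //; exact: lower_one_in.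
  have P1 : phi g (periodic a) = 1.
    have := phi_plus_seq g1' adm; rewrite Q1 subrr => /esym/eqP.
    rewrite mulf_eq0 => /orP[/eqP e|/eqP e]; last by lra.
    have : 2 < g ^+ size a.
      by apply: le_lt_trans bm _; rewrite ltr_pXn2r ?adm_size ?nnegrE ?(ltW b0) ?(ltW g0).
    have gm0 : 0 < g ^+ size a by rewrite exprn_gt0.
    rewrite -[X in _ < X]mul1r -ltr_pdivrMr//; lra.
  have tP : tails_in g (periodic a).
    rewrite -[periodic a]refl_seqK; apply: tails_in_refl => //.
    by rewrite -shift_plus_seq//; exact: tails_in_shift.
  have le := lower_one_le bg tP P1.
  have := entropy_lower_one_le bg (le_trans le q01).
  by rewrite h0 lee_fin ler_ln ?posrE//; lra.
have [h hb hh] := entropy_pos_ln M0 (lt_le_trans lnb0 (hge _ bq q1)).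
have h1 := bases_gt1 hb; have hpos : 0 < h by lra.
have [l1 _] := entropy_level M0 hb hh.
have : ((ln h)%:E <= entropy R (@Utilde R M K.2))%E.
  by apply: entropy_lower_one_le => //; rewrite a2; exact: le_trans q2.
have := hge _ bq q1; rewrite hh hg gE !lee_fin => e1 e2; congr (_%:E).
by apply/le_anti; rewrite e1 e2.
Qed.

Lemma itv_subP I K : I.1 <= I.2 -> itv I `<=` itv K <-> K.1 <= I.1 /\ I.2 <= K.2.
Proof.
move=> I12; rewrite /itv; split => [IK|[k1 k2] q /=].
  have := IK I.1; have := IK I.2; rewrite /= !in_itv /= !lexx I12.
  by move=> /(_ isT)/andP[_ ->] /(_ isT)/andP[->].
by rewrite !in_itv /= => /andP[h1 h2]; rewrite (le_trans k1)//= (le_trans h2).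
Qed.

Lemma itv_inj I K : I.1 <= I.2 -> itv I `<=` itv K -> itv K `<=` itv I -> K = I.
Proof.
move=> I12 /(itv_subP _ I12)[k1 k2].
move=> /(itv_subP _ (le_trans k1 (le_trans I12 k2)))[k3 k4].
rewrite [K]surjective_pairing [I]surjective_pairing.
by congr (_, _); apply/le_anti; rewrite ?k1 ?k2 ?k3 ?k4.
Qed.

(** On a nondegenerate plateau of entropy [log b] the expansion [alpha q] takes
    different values, so 1 has several expansions in base [b] and the plateau
    fills the interval of [level_interval]. *)
Lemma entropy_plateau_basic I : (0 < M)%N -> entropy_plateau M I -> basic_interval M I.
Proof.
move=> M0 [I12 IB [c c0 cI] Imax].
have in1 : itv I I.1 by rewrite /itv /= in_itv /= lexx ltW.
have in2 : itv I I.2 by rewrite /itv /= in_itv /= lexx ltW.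
have [b bb hb] : exists2 b, @bases R M b & entropy R (@Utilde R M I.1) = (ln b)%:E.
  by apply: entropy_pos_ln => //; rewrite cI.
have neq : lower_one M b <> upper_one M b.
  move=> e; have [l1 u1] := entropy_level M0 bb hb.
  have hb2 : entropy R (@Utilde R M I.2) = (ln b)%:E by rewrite cI// -(cI _ in1).
  have [_ u2] := entropy_level M0 bb hb2.
  have := alpha_mono (IB _ in1) (IB _ in2) I12.
  by rewrite ltNge (le_trans u2)// -e.
have [K [Kbasic _ Kc Kin]] := level_interval M0 bb (IB _ in1) hb neq.
suff <- : K = I by [].
apply: Imax.
- by have [a [_ gK]] := Kbasic; exact: generates_bases gK.
- by exists c => // q /Kc ->; rewrite -hb cI.
- by move=> q Iq; apply: Kin; [exact: IB|rewrite cI// -(cI _ in1)].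
Qed.

(** If 1 had only one expansion in the base given by the entropy, this would be
    the greedy sequence [periodic a]; but a greedy expansion of 1 cannot return
    to 1 after a digit that is less than [M]. *)
Lemma exists_plateau a q : (0 < M)%N -> adm_spec a -> @bases R M q -> alpha M q = periodic a ->
  (0 < entropy R (@Utilde R M q))%E -> exists2 K, entropy_plateau M K & itv K q.
Proof.
move=> M0 adm bq aq h; have [b bb hb] := entropy_pos_ln M0 h.
have b1 := bases_gt1 bb.
have neq : lower_one M b <> upper_one M b.
  move=> e; have [l1 u1] := entropy_level M0 bb hb; rewrite e in l1.
  have uE : upper_one M b = periodic a by rewrite -aq; apply/le_anti; rewrite l1 u1.
  have n1 : `|1 : R| <= 1 by rewrite normr1.
  have sE : size a = (size a).-1.+1 by rewrite prednK// adm_size.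
  have := @greedy_tail_lt1 R M b 1 (size a).-1 bb n1; rewrite -/(upper_one M b) -sE.
  rewrite uE shift_periodic -uE phi_upper_one// ltxx uE periodic_agree; last by rewrite [ltnRHS]sE.
  by move=> /(_ (adm_last adm)).
have [K [[a' [adm' gK]] Kq Kc Kin]] := level_interval M0 bb bq hb neq.
have K12 := generates_lt (admissible_spec adm') gK.
exists K => //; split => //; first exact: generates_bases gK.
  by exists (ln b)%:E => //; rewrite lte_fin ln_gt0.
move=> I' IB [c c0 cI] KI; apply: itv_inj => //; first exact: ltW.
move=> q' Iq'; apply: Kin; first exact: IB.
by rewrite cI// -hb cI//; exact: KI.
Qed.

Lemma exp_unbounded b (c : R) : 1 < b -> exists n, c <= b ^+ n.
Proof.
move=> b1; have h n : 1 + n%:R * (b - 1) <= b ^+ n.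
  elim: n => [|n ih]; first by rewrite mul0r addr0 expr0.
  have : 0 <= n%:R * (b - 1) * (b - 1) by rewrite !mulr_ge0//; lra.
  have : b * (1 + n%:R * (b - 1)) <= b * b ^+ n by rewrite ler_pM2l//; lra.
  by rewrite exprS -natr1; lra.
exists (Num.truncn (`|c| / (b - 1))).+1; apply: le_trans (h _).
have t0 : 0 <= `|c| / (b - 1) by rewrite divr_ge0//; lra.
have /andP[_] := truncn_itv t0; rewrite ltr_pdivrMr; last by lra.
by have := ler_norm c; lra.
Qed.

Lemma theta_block a i : adm_spec a -> (i < size a)%N ->
  (theta a i : nat) = (nth ord0 a i + (i == (size a).-1))%N /\
  theta a (size a + i)%N = rev_ord (nth ord0 a i).
Proof.
move=> adm im; have h := theta_code adm; split.
  have -> : theta a i = nth ord0 (incr_last a) i.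
    rewrite h; last by lia.
    by have := code_block adm thue_morse8 0 im; rewrite mul0n add0n.
  by rewrite plusE.
rewrite h; last by lia.
by have := code_block adm thue_morse8 1 im; rewrite mul1n.
Qed.

(** The second half of a prefix [w refl(w)^+] of [theta a] is the reflection of
    the first half up to 1 in the last digit. *)
Lemma phi_theta_step b a : 1 < b -> adm_spec a -> phi b (theta a) = 1 ->
  1 + phi b (shift_seq (2 * size a) (theta a)) =
  (b ^+ size a - 1) * (1 + phi b (shift_seq (size a) (theta a))).
Proof.
move=> b1 adm t1; have b0 : 0 < b by lra.
have sE : size a = (size a).-1.+1 by rewrite prednK// adm_size.
have ag : agree (size a).-1 (shift_seq (size a) (theta a)) (refl_seq (theta a)).
  move=> i im; have im' : (i < size a)%N by rewrite sE; exact: ltnW.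
  have [h1 h2] := theta_block adm im'; rewrite shift_seqE h2 refl_seqE.
  apply/ord_inj; rewrite !rev_digitE h1.
  by rewrite ltn_eqF// addn0.
have lt : ((size a).-1 < size a)%N by rewrite [ltnRHS]sE.
have [h1 h2] := theta_block adm lt; rewrite eqxx in h1.
have := phi_agree b1 ag; rewrite phi_refl// t1.
have r1 := phi_rec_shift (shift_seq (size a) (theta a)) (size a).-1 b1.
have r2 := phi_rec_shift (refl_seq (theta a)) (size a).-1 b1.
rewrite -sE [shift_seq (size a) (shift_seq _ _)]shift_seqD addnn -mul2n shift_seqE h2 in r1.
rewrite -sE [shift_seq (size a) _]shift_refl phi_refl// in r2.
move: r1 r2; rewrite /digits_pm refl_seqE !rev_digitE h1 addn1.
have lM := adm_last adm; rewrite !natrB//; last exact: ltnW.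
rewrite -natr1; have -> : b ^+ size a = b * b ^+ (size a).-1 by rewrite -exprS -sE.
have : 0 < b ^+ (size a).-1 by rewrite exprn_gt0.
move: (b ^+ (size a).-1) (phi b (shift_seq (2 * _) (theta a))) => c T2 c0.
move: (phi b (shift_seq _ (theta a))) (phi b (shift_seq _ (shift_seq _ _))).
move: (phi b (shift_seq _ _)) => v T1 u r1 r2 h.
have uv : u - v = (2 + T2 + T1) / b.
  by rewrite -[LHS](mulfK (lt0r_neq0 b0)); congr (_ / _); lra.
have : (T1 + 1) * (b * c) = 2 + T2 + T1.
  have -> : T1 + 1 = (u - v) / c by lra.
  by rewrite uv; field; rewrite !gt_eqF.
lra.
Qed.

Lemma phi_theta_root b : (1 <= M)%N -> 1 < b -> phi b (theta (root_word M)) = 1 ->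
  0 < 1 + phi b (shift_seq (size (root_word M)) (theta (root_word M))).
Proof.
move=> M1 b1 t1; have adm := root_adm M1; have d k := @theta_block _ k adm.
move: (theta (root_word M)) t1 d => t t1 d.
have r0 := phi_rec_shift t 0 b1; have r1 := phi_rec_shift t 1 b1.
rewrite shift_seq0 t1 /digits_pm in r0; rewrite /digits_pm in r1.
move: (d 0%N) (d 1%N); rewrite /root_word; case: ifP => oM /=; last first.
  move=> /(_ isT)[e0 _] _; rewrite inordK in e0; last by lia.
  have ME : M%:R = 2 * (M./2)%:R :> R by rewrite -natrM; congr (_%:R); lia.
  by rewrite e0 natrD in r0; lra.
move=> /(_ isT)[e0 _] /(_ isT)[e1 _].
rewrite inordK in e0; last by lia.
rewrite inordK in e1; last by lia.
rewrite e0 addn0 -natr1 in r0; rewrite e1 natrD in r1.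
have ME : M%:R = 2 * (M./2)%:R + 1 :> R by rewrite -natrM natr1; congr (_%:R); lia.
have tE : phi b (shift_seq 1 t) = b - 1 by lra.
rewrite tE in r1; have : 0 < b * (b - 1) by rewrite mulr_gt0//; lra.
lra.
Qed.

(** Otherwise [phi_theta_step], applied to all doublings of [root_word], would
    make the distance of the tails from [-1] grow without bound. *)
Lemma phi_theta_root_neq1 b : (1 <= M)%N -> 1 < b -> tails_in b (theta (root_word M)) ->
  phi b (theta (root_word M)) <> 1.
Proof.
move=> M1 b1 tl t1; have adm := root_adm M1.
pose r k := 1 + phi b (shift_seq (2 ^ k * size (root_word M)) (theta (root_word M))).
have rS k : r k.+1 = (b ^+ (2 ^ k * size (root_word M)) - 1) * r k.
  have admk := adm_spec_iter_dbl k adm; have thk := theta_iter_dbl k adm.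
  have := @phi_theta_step b _ b1 admk; rewrite thk (size_iter_dbl k adm) => /(_ t1).
  by rewrite mulnA -expnS.
have m0 := adm_size adm.
have bL k : 1 < b ^+ (2 ^ k * size (root_word M)).
  by rewrite exprn_egt1// -lt0n muln_gt0 expn_gt0.
have r0 k : 0 < r k.
  elim: k => [|k ih]; first by rewrite /r mul1n phi_theta_root.
  by rewrite rS mulr_gt0// subr_gt0.
have r2 k : r k <= 2.
  by have := tl (2 ^ k * size (root_word M))%N; rewrite /r ler_norml => /andP[_ ?]; lra.
have [N bN] := exp_unbounded 3 b1.
have : r (N + 0)%N <= 0.
  apply: (@contraction_le0 _ (fun k => r (N + k)%N) 2 2^-1) => // [|k].
    by apply/andP; split; lra.
  right; exists k.+1, 2^-1; split; [lra|by []|].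
  rewrite addnS rS; have := r0 (N + k)%N.
  have : 3 <= b ^+ (2 ^ (N + k) * size (root_word M)).
    apply: (le_trans bN); apply: ler_weXn2l; first exact: ltW.
    apply: (@leq_trans (2 ^ (N + k))); last by rewrite leq_pmulr.
    by apply: leq_trans (ltnW (ltn_expl _ (ltnSn 1))); exact: leq_addr.
  by move=> h1 h2; nra.
by have := r0 (N + 0)%N; lra.
Qed.

(** If the entropy were [log b] with [b > 1], then [theta root_word] would be one
    of the expansions of 1 in base [b]. *)
Lemma entropy_q_KL : (1 <= M)%N -> ~ (0 < entropy R (@Utilde R M (q_KL R M)))%E.
Proof.
move=> M1 h; have [[bq _] aq _] := q_KL_spec R M1; have adm := root_adm M1.
have [b bb hb] := entropy_pos_ln M1 h; have b1 := bases_gt1 bb.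
have [l u] := entropy_level M1 bb hb; rewrite aq in l u.
have tl : tails_in b (theta (root_word M)).
  have th n : (shift_seq n (theta (root_word M)) <= theta (root_word M))%O.
    exact: shift_theta_le.
  apply: tails_in_between => // n; split; last exact: le_trans (th n) u.
  apply: (@le_trans _ _ (refl_seq (theta (root_word M)))); first by rewrite refl_le.
  have [->|n0] := posnP n; last exact/ltW/nested_refl_lt/n0/nested_theta.
  rewrite shift_seq0; apply: (@le_trans _ _ (refl_seq (periodic (root_word M)))).
    by rewrite refl_le ltW// theta_gt.
  by apply: le_trans (refl_le_periodic adm) _; rewrite ltW// theta_gt.
apply: (phi_theta_root_neq1 M1 b1 tl); apply/le_anti.
have := tails_in0 tl; rewrite ler_norml => /andP[_ ->] /=.
by rewrite -(phi_lower_one bb); apply: phi_mono => //; exact: lower_one_in.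
Qed.

Lemma q_KL_lt_plateau I : (1 <= M)%N -> entropy_plateau M I -> q_KL R M < I.1.
Proof.
move=> M1 [I12 IB [c c0 cI] _]; have [[bq _] _ _] := q_KL_spec R M1.
have in1 : itv I I.1 by rewrite /itv /= in_itv /= lexx ltW.
rewrite ltNge; apply/negP => le; apply: (entropy_q_KL M1).
have h1 : (0 < entropy R (@Utilde R M I.1))%E by rewrite cI.
have [b bb hb] := entropy_pos_ln M1 h1.
have [l _] := entropy_level M1 bb hb.
apply: lt_le_trans (entropy_lower_one_le bb (le_trans l _)).
  by rewrite lte_fin ln_gt0// (bases_gt1 bb).
by rewrite alpha_le//; exact: IB.
Qed.

End Plateaus.

(** * Relative plateaus *)

Section RelativePlateaus.
Variables (R : realType) (M : nat).
Hypothesis M1 : (1 <= M)%N.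
Implicit Types (x q : R) (a b c : word M) (I K : R * R) (n k i : nat).
Local Notation plateau := (@relative_plateaus R M).
Local Notation qKL := (q_KL R M).

Lemma generates_unique a b I : adm_spec a -> adm_spec b -> generates a I -> generates b I ->
  a = b.
Proof.
move=> adm admb [_ _ a1 a2] [_ _ b1 b2].
have e1 : periodic a = periodic b by rewrite -a1.
have e2 : plus_seq a = plus_seq b by rewrite /plus_seq -a2.
have [//|lt] : a = b \/ (size a < size b)%N by apply: nested_size; rewrite ?e1 ?e2.
have [//|] : b = a \/ (size b < size a)%N by apply: nested_size; rewrite ?e1 ?e2.
by rewrite ltnNge ltnW.
Qed.

Lemma generates_same a I K : generates a I -> generates a K -> I = K.
Proof.
move=> [b1 b2 a1 a2] [b3 b4 a3 a4].
rewrite [I]surjective_pairing [K]surjective_pairing; congr (_, _).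
  by apply: (alpha_inj b1 b3); rewrite a1.
by apply: (alpha_inj b2 b4); rewrite a2.
Qed.

Lemma generates_sub a b I K : adm_spec a -> adm_spec b -> generates a I -> generates b K ->
  itv I `<=` itv K -> b = a \/ (size b < size a)%N.
Proof.
move=> adm admb ga gb; have I12 := ltW (generates_lt adm ga).
move=> /(itv_subP _ I12)[k1 k2]; move: ga gb => [p1 p2 a1 a2] [p3 p4 a3 a4].
apply: nested_size => //; first by rewrite -a1 -a3 alpha_le.
by rewrite /plus_seq -a2 -a4 alpha_le.
Qed.

Lemma q_c_spec a I : admissible a -> generates a I ->
  @bases R M (q_c M I) /\ alpha M (q_c M I) = theta a.
Proof.
move=> adm ga; rewrite /q_c; case: ifPn => [/eqP IE|_].
  have [/basesP + _ _ _] := ga; by rewrite IE /J_empty /= ltxx.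
have ex : exists q, [set q | @bases R M q /\
    exists a : word M, [/\ admissible a, generates a I & alpha M q = theta a]] q.
  have [q bq aq] := exists_alpha_theta R (admissible_spec adm).
  by exists q; split => //; exists a.
have [bq [b [admb gb ->]]] := xgetPex 0 ex; split => //.
by rewrite (generates_unique (admissible_spec admb) (admissible_spec adm) gb ga).
Qed.

Lemma q_c_between a I : admissible a -> generates a I -> I.1 < q_c M I < I.2.
Proof.
move=> adm ga; have [bq aq] := q_c_spec adm ga; have [b1 b2 a1 a2] := ga.
have adm' := admissible_spec adm.
rewrite -!(@alpha_lt R M)// a1 aq a2 theta_gt//=; exact: theta_lt_plus.
Qed.

Lemma theta_neq_periodic a b : adm_spec a -> adm_spec b -> theta a <> periodic b.
Proof.
move=> adm admb e.
have := nested_shift_lt (fun n => shift_theta_le n adm) (nested_theta adm) (adm_size admb).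
by rewrite e shift_periodic ltxx.
Qed.

(** An interval of minimal word length is maximal, because larger basic
    intervals have shorter words. *)
Lemma exists_maximal_basic (D : set R) I : basic_interval M I -> itv I `<=` D ->
  exists2 K, maximal_basic_in M D K & itv I `<=` itv K.
Proof.
move=> bI ID.
pose P n := `[< exists K a, [/\ admissible a, generates a K, size a = n, itv K `<=` D &
  itv I `<=` itv K] >].
have ex : exists n, P n.
  by have [a [adm ga]] := bI; exists (size a); apply/asboolP; exists I, a; split => //.
case: (ex_minnP ex) => n /asboolP[K [a [adm ga sa KD IK]]] nmin.
exists K => //; split => //; first by exists a.
move=> K' [b [admb gb]] K'D KK'.
have [e|lt] := generates_sub (admissible_spec adm) (admissible_spec admb) ga gb KK'.
  by rewrite -e in ga; exact: generates_same gb ga.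
have := nmin (size b); rewrite leqNgt -sa lt => h; exfalso.
by have /h : P (size b) by apply/asboolP; exists K', b; split => //; exact: subset_trans KK'.
Qed.

Lemma child_spec c I b K : admissible c -> generates c I -> admissible b -> generates b K ->
  maximal_basic_in M `[q_c M I, I.2] K ->
  [/\ q_c M I < K.1, itv K `<=` itv I & (size c < size b)%N].
Proof.
move=> admc gc admb gb [_ KD _]; have [bq aq] := q_c_spec admc gc.
have /andP[q1 _] := q_c_between admc gc.
have K12 := generates_lt (admissible_spec admb) gb.
have [|k1 k2] := (@itv_subP _ K (q_c M I, I.2) _).1 KD; first exact: ltW.
have [b1 b2 a1 a2] := gb; have adm := admissible_spec admb.
have lt : q_c M I < K.1.
  rewrite lt_neqAle k1 andbT; apply/eqP => e.
  by apply: (theta_neq_periodic (admissible_spec admc) adm); rewrite -a1 -aq e.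
have sub : itv K `<=` itv I.
  by apply/(itv_subP _ (ltW K12)); split => //; exact/ltW/(lt_trans q1).
split => //.
have [e|//] := generates_sub adm (admissible_spec admc) gb gc sub.
by have e' := generates_same gc; rewrite e in e'; move: lt q1; rewrite (e' _ gb) => /lt_trans h /h; rewrite ltxx.
Qed.

Lemma plateau_word n I : plateau n.+1 I ->
  exists a, [/\ admissible a, generates a I, (n < size a)%N & qKL < I.1].
Proof.
elim: n I => [I pI|n ih I [K pK [[a [adm ga]] IK Imax]]].
  have [a [adm ga]] := entropy_plateau_basic M1 pI; exists a; split => //.
    exact: adm_size (admissible_spec adm).
  exact: q_KL_lt_plateau.
have [c [admc gc sc qK]] := ih K pK.
have [lt _ lts] := child_spec admc gc adm ga (And3 (ex_intro _ a (conj adm ga)) IK Imax).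
exists a; split => //; first exact: leq_ltn_trans sc lts.
have /andP[h _] := q_c_between admc gc; exact: lt_trans qK (lt_trans h lt).
Qed.

(** [theta a] is not periodic, so a periodic sequence can agree with it for long
    only if its period is long. *)
Lemma agree_periodic_size a P : adm_spec a ->
  exists N, forall b, adm_spec b -> agree N (theta a) (periodic b) -> (P < size b)%N.
Proof.
move=> adm; elim: P => [|P [N hN]].
  by exists 0%N => b admb _; exact: adm_size.
have := nested_shift_lt (fun n => shift_theta_le n adm) (nested_theta adm) (ltn0Sn P).
move=> /ltOP[N' lt]; exists (maxn N (P.+1 + N')) => b admb ag.
have := hN b admb (agreeW (leq_maxl _ _) ag).
rewrite leq_eqVlt => /predU1P[e|//]; exfalso.
have ag' := agreeW (leq_maxr N (P.+1 + N')) ag.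
have : lt_within N' (periodic b) (periodic b).
  apply: lt_within_agree lt; last by apply: agreeW ag'; exact: leq_addl.
  move=> i iN; rewrite -(shift_periodic b) -e !shift_seqE ag'//.
  by rewrite ltn_add2l.
by move=> /lt_within_lt; rewrite ltxx.
Qed.

(** The intervals of [trip (iter k dbl c)] approach [q_c] from the right.  Each
    meets an interval of the next level: among the maximal basic intervals
    there is one that contains it, and among the entropy plateaus there is one
    that contains its left end point, where the entropy is positive because
    the blocks of [dbl (iter k dbl c)] can be concatenated freely. *)
Lemma plateau_children n I : plateau n I -> exists c, [/\ adm_spec c, @bases R M (q_c M I),
  alpha M (q_c M I) = theta c & forall k, exists K b, [/\ plateau n.+1 K,
    (0 < n)%N -> itv K `<=` itv I, admissible b /\ generates b K, q_c M I < K.1 &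
    (periodic b <= periodic (trip (iter k dbl c)))%O]].
Proof.
have [[bKL _] aKL _] := q_KL_spec R M1; case: n => [->|n pI].
  have admr := root_adm M1; exists (root_word M); rewrite /q_c eqxx; split => // k.
  have admk := adm_spec_iter_dbl k admr.
  have adt := admissible_spec (admissible_trip admk).
  have [q bq aq] := exists_alpha_periodic R adt.
  have h : (0 < entropy R (@Utilde R M q))%E.
    apply: (entropy_pos_block (adm_spec_dbl admk)); rewrite aq.
    exact: plus_seq_dbl_lt_trip.
  have [K pK Kq] := exists_plateau M1 adt bq aq h.
  have [b [admb gb _ qK]] := @plateau_word 0 K pK.
  exists K, b; split => //; have [bK _ aK _] := gb; rewrite -aK -aq alpha_le//.
  by move: Kq; rewrite /itv /= in_itv /= => /andP[].
have [c [admc gc _ _]] := plateau_word pI; have adm := admissible_spec admc.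
have [bq aq] := q_c_spec admc gc; exists c; split => // k.
have admk := adm_spec_iter_dbl k adm; have [_ b2 _ a2] := gc.
have adt := admissible_trip admk; have adt' := admissible_spec adt.
have [I' gI'] := exists_generates R adt'; have [b3 b4 a3 a4] := gI'.
have I'12 := generates_lt adt' gI'.
have sub : itv I' `<=` `[q_c M I, I.2].
  apply/(@itv_subP _ I' (q_c M I, I.2) (ltW I'12)) => /=; split.
    by rewrite -(@alpha_le R M)// aq a3 -(theta_iter_dbl k adm) ltW// theta_lt_trip.
  rewrite -(@alpha_le R M)// a4 a2 -/(plus_seq _) -/(plus_seq _).
  apply: (le_trans (ltW (plus_seq_trip_lt admk))).
  elim: (k) => [//|j ih] /=; apply: le_trans ih; apply/ltW/plus_seq_dbl_lt.
  exact: adm_spec_iter_dbl.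
have [K mK I'K] := exists_maximal_basic (ex_intro _ _ (conj adt gI')) sub.
have [[b [admb gb]] _ _] := mK; have [lt sub' _] := child_spec admc gc admb gb mK.
exists K, b; split => //; first by exists I.
have [k1 _] := (itv_subP K (ltW I'12)).1 I'K.
by have [bK _ aK _] := gb; rewrite -aK -a3 alpha_le.
Qed.

Lemma exp_inv_small q (C e : R) : 1 < q -> 0 < e ->
  exists n, forall k, (n <= k)%N -> C / q ^+ k < e.
Proof.
move=> q1 e0; have [n hn] := exp_unbounded (C / e + 1) q1; exists n => k nk.
have qn : 0 < q ^+ k by rewrite exprn_gt0//; lra.
have : q ^+ n <= q ^+ k by apply: ler_weXn2l nk; exact: ltW.
move: hn => hn hk.
by rewrite ltr_pdivrMr// mulrC -ltr_pdivrMr//; lra.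
Qed.

(** The words of the intervals found above get arbitrarily long, hence not only
    their left end points but the whole intervals approach [q_c]. *)
Lemma plateaus_near_q_c n I (e : R) : plateau n I -> 0 < e ->
  exists K, [/\ plateau n.+1 K, (0 < n)%N -> itv K `<=` itv I, q_c M I < K.1 &
    K.2 < q_c M I + e].
Proof.
move=> pI e0; have [c [adm bq aq ch]] := plateau_children pI.
have q1 := bases_gt1 bq.
(* agreement on [P] digits makes the bases [e]-close *)
have [P hP] := exp_inv_small (M.+1%:R * (M%:R / (q_c M I - 1))) q1 e0.
have [N hN] := agree_periodic_size P.+1 adm.
have Nk : (maxn N P < 2 ^ maxn N P)%N by rewrite ltn_expl.
have [K [b [pK sub [admb gb] lt le]]] := ch (maxn N P); exists K; split => //.
have admb' := admissible_spec admb; have [b1 b2 a1 a2] := gb.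
have admk := adm_spec_iter_dbl (maxn N P) adm.
have ag : agree (maxn N P) (theta c) (periodic b).
  apply: (@agreeW _ (size (iter (maxn N P) dbl c))).
    rewrite size_iter_dbl//; apply: leq_trans (ltnW Nk) _.
    by rewrite leq_pmulr// adm_size.
  apply: agree_squeeze le _; first by rewrite -aq -a1 ltW// alpha_mono.
  by rewrite -(theta_iter_dbl (maxn N P) adm); exact: theta_trip_agree.
have sb := hN b admb' (agreeW (leq_maxl _ _) ag).
have ag2 : agree P (alpha M (q_c M I)) (alpha M K.2).
  rewrite aq a2; apply: agree_trans (agreeW (leq_maxr _ _) ag) _.
  by apply: agreeW (plus_seq_agree_pred admb'); lia.
have K12 := generates_lt admb' gb; have qK2 : q_c M I < K.2 by exact: lt_trans lt K12.
have := alpha_dist q1 bq b2 (lexx _) (ltW qK2) ag2.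
rewrite distrC gtr0_norm ?subr_gt0// => h.
by rewrite addrC -ltrBlDr; exact: le_lt_trans (hP P (leqnn P)).
Qed.

(** ** The bifurcation set lies in [univoque] *)

(** A point of [Cinfty] lies to the right of [q_c I], strictly, because it lies
    in some child of [I]. *)
Lemma Cinfty_plateau x n : Cinfty M x ->
  exists I a, [/\ plateau n.+1 I, admissible a, generates a I, (n < size a)%N &
    q_c M I < x <= I.2].
Proof.
move=> /(_ n.+2 isT)[K [I pI mK] Kx].
have [a [adm ga sa _]] := plateau_word pI; have [[b [admb gb]] _ _] := mK.
have [lt sub _] := child_spec adm ga admb gb mK.
exists I, a; split => //; have := sub _ Kx; move: Kx; rewrite /itv /= !in_itv /=.
by move=> /andP[h1 h2] /andP[_ ->]; rewrite (lt_le_trans lt).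
Qed.

Lemma Cinfty_bases x : Cinfty M x -> @bases R M x.
Proof.
move=> Cx; have [I [a [_ adm ga _ /andP[h1 h2]]]] := Cinfty_plateau 0 Cx.
have [_ b2 _ _] := ga; have [bq _] := q_c_spec adm ga.
by apply: bases_between bq b2 (ltW h1) h2.
Qed.

Lemma Cset_univoque : Cset M `<=` @univoque R M.
Proof.
move=> x [[n _ [I pI <-]]|Cx].
- case: n pI => [->|n pI]; first by rewrite /q_c eqxx; case: (q_KL_spec R M1).
  have [a [adm ga _ _]] := plateau_word pI; have [bq aq] := q_c_spec adm ga.
  by apply: nested_univoque => //; rewrite aq; exact/nested_theta/admissible_spec.
- have bx := Cinfty_bases Cx; apply: nested_univoque => // n.
  have [I [a [_ adm ga sa /andP[h1 h2]]]] := Cinfty_plateau n Cx.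
  have adm' := admissible_spec adm; have [bq aq] := q_c_spec adm ga.
  have [_ b2 _ a2] := ga; exists a; split => //; first exact: ltnW.
    by apply: lt_trans (theta_gt adm') _; rewrite -aq alpha_mono.
  by rewrite /plus_seq -a2 alpha_le.
Qed.

(** ** Topology of the bifurcation set *)

(** A point [q_c I] is approached by the [q_c K] for intervals [K] of the next
    level, and a point of [Cinfty] by the [q_c I] for the shrinking intervals
    [I] around it. *)
Lemma isolated_Cset : isolated (@Cset R M) = set0.
Proof.
have no x : Cset M x -> (forall e : R, 0 < e -> exists y, [/\ Cset M y, y <> x & `|x - y| < e]) ->
    ~ isolated (@Cset R M) x.
  move=> _ h [_ [V /nbhs_ballP[e /= e0 eV] VE]].
  have [y [Cy yx xy]] := h e e0.
  have : (V `&` Cset M) y by split => //; apply: eV.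
  by rewrite VE => /yx.
apply/seteqP; split => // x ix; have Cx : Cset M x by have [/set_mem] := ix.
apply: no ix => // e e0; case: Cx => [[n _ [I pI <-]]|Cx].
- have [K [pK _ K1 K2]] := plateaus_near_q_c pI e0.
  have [a [adm ga _ _]] := plateau_word pK; have /andP[q1 q2] := q_c_between adm ga.
  exists (q_c M K); split; first by left; exists n.+1 => //; exists K.
    by move=> h; move: q1; rewrite h ltNge ltW.
  by rewrite distrC gtr0_norm ?subr_gt0 1?(lt_trans K1)//; lra.
- have [[bKL _] _ _] := q_KL_spec R M1; have b1 := bases_gt1 bKL.
  have [P hP] := exp_inv_small (M.+1%:R * (M%:R / (qKL - 1))) b1 e0.
  have [I [a [pI adm ga sa /andP[h1 h2]]]] := Cinfty_plateau P Cx.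
  have adm' := admissible_spec adm; have [bq aq] := q_c_spec adm ga.
  have bx := Cinfty_bases Cx; have [bI b2 a1 a2] := ga.
  have [a' [_ _ _ qI]] := plateau_word pI.
  exists (q_c M I); split; first by left; exists P.+1 => //; exists I.
    by move=> h; move: h1; rewrite h ltxx.
  have /andP[q1 q2] := q_c_between adm ga.
  have agP y : @bases R M y -> I.1 < y -> y <= I.2 -> agree P (periodic a) (alpha M y).
    move=> by_ y1 y2; apply: (@agreeW _ (size a).-1); first by lia.
    apply: (@agree_squeeze _ _ _ _ (plus_seq a)); last exact: plus_seq_agree_pred.
      by rewrite -a1 ltW// alpha_mono.
    by rewrite /plus_seq -a2 alpha_le.
  have ag := agree_trans (agree_sym (agP x bx (lt_trans q1 h1) h2)) (agP _ bq q1 (ltW q2)).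
  apply: le_lt_trans (hP P (leqnn P)); apply: alpha_dist ag => //; rewrite ltW//.
    exact: lt_trans qI (lt_trans q1 h1).
  exact: lt_trans qI q1.
Qed.

Lemma plateau_child_avoid n I y : plateau n.+1 I ->
  exists K, [/\ plateau n.+2 K, itv K `<=` itv I & ~ itv K y].
Proof.
move=> pI; have [e e0 he] : exists2 e : R, 0 < e & q_c M I < y -> q_c M I + e <= y.
  have [lt|le] := ltP (q_c M I) y; last by exists 1.
  by exists (y - q_c M I); rewrite ?subr_gt0// addrC subrK.
have [K [pK sub K1 K2]] := plateaus_near_q_c pI e0; exists K; split; [by []|exact: sub|].
rewrite /itv /= in_itv /= => /andP[h1 h2].
by have := he (lt_le_trans K1 h1); lra.
Qed.

(** Any enumeration of points can be avoided along a nested sequence of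
    relative plateaus, one point at each level. *)
Lemma uncountable_Cinfty : ~ countable (@Cinfty R M).
Proof.
move=> /countable_injP[f finj].
pose g n := xget 0 [set x | @Cinfty R M x /\ f x = n].
have ex (p : nat * (R * R)) : exists K, plateau p.1.+1 p.2 ->
    [/\ plateau p.1.+2 K, itv K `<=` itv p.2 & ~ itv K (g p.1)].
  have [pI|nI] := pselect (plateau p.1.+1 p.2); last by exists p.2.
  by have [K h] := plateau_child_avoid (g p.1) pI; exists K.
have [F FP] := choice ex.
have [I0 [pI0 _ _ _]] := @plateaus_near_q_c 0 (@J_empty R M) 1 erefl ltr01.
pose J := fix J n := if n is k.+1 then F (k, J k) else I0.
have pJ n : plateau n.+1 (J n).
  by elim: n => [//|n ih]; have [] := FP (n, J n) ih.
have sub m k : itv (J (m + k)%N) `<=` itv (J m).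
  elim: k => [|k ih]; first by rewrite addn0.
  by rewrite addnS; have [_ h _] := FP (_, _) (pJ (m + k)%N); exact: subset_trans ih.
have J12 n : (J n).1 <= (J n).2.
  have [a [adm ga _ _]] := plateau_word (pJ n).
  exact/ltW/(generates_lt (admissible_spec adm)).
have le n m : (J n).1 <= (J m).2.
  have [h1 _] := (itv_subP _ (J12 (n + m)%N)).1 (sub n m).
  have := sub m n; rewrite addnC => /(itv_subP _ (J12 (n + m)%N))[_ h2].
  exact: le_trans h1 (le_trans (J12 _) h2).
pose x := sup (range (fun n => (J n).1)).
have xJ n : itv (J n) x.
  rewrite /itv /= in_itv /=; apply/andP; split.
    apply: ub_le_sup; last by exists n.
    by exists (J 0%N).2 => _ [m _ <-].
  by apply: ge_sup; [exists (J 0%N).1, 0%N|move=> _ [m _ <-]].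
have Cx : Cinfty M x by case=> [//|n] _; exists (J n).
have [Cg fg] := xgetPex 0 (ex_intro (fun y => @Cinfty R M y /\ f y = f x) x (conj Cx erefl)).
have gx : g (f x) = x by apply: finj => //; exact: mem_set.
by have [_ _] := FP (_, _) (pJ (f x)); rewrite /= gx; apply; exact: (xJ (f x).+1).
Qed.

End RelativePlateaus.

(** * Hausdorff dimension *)

Section HausdorffNull.
Variable R : realType.
Implicit Types (A : set R) (U : nat -> set R) (s e r x y : R).

Definition hausdorff_null s A := forall delta e : R, 0 < delta -> 0 < e ->
  exists U, [/\ A `<=` \bigcup_k U k, forall k, (diam (U k) <= delta%:E)%E &
    (\sum_(k <oo) hausdorff_weight s (U k) <= e%:E)%E].

Lemma hausdorff_weight_ge0 s A : (0 <= hausdorff_weight s A)%E.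
Proof. by rewrite /hausdorff_weight; case: ifP => // _; exact: poweR_ge0. Qed.

Lemma hausdorff_weight_set0 s : hausdorff_weight s (set0 : set R) = 0%E.
Proof. by rewrite /hausdorff_weight; case: ifPn => // /asboolP. Qed.

Lemma diam_le A r : (forall x y, A x -> A y -> `|x - y| <= r) -> (diam A <= r%:E)%E.
Proof. by move=> h; apply: ge_ereal_sup => _ [[x y] [/= Ax Ay] <-]; rewrite lee_fin h. Qed.

Lemma hausdorff_weight_le s A r : 0 < s -> 0 <= r ->
  (forall x y, A x -> A y -> `|x - y| <= r) -> (hausdorff_weight s A <= (r `^ s)%:E)%E.
Proof.
move=> s0 r0 h; rewrite /hausdorff_weight; case: ifPn => [_|/asboolPn/eqP/set0P[x Ax]].
  by rewrite lee_fin powR_ge0.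
have d0 : (0 <= diam A)%E.
  by apply: ereal_sup_ubound; exists (x, x) => //=; rewrite subrr normr0.
rewrite -poweR_EFin; apply: gt0_ler_poweR; rewrite ?in_itv/= ?d0 ?lee_fin ?r0 ?leey ?(ltW s0)//.
exact: diam_le.
Qed.

Lemma hausdorff_null_sub s A B : A `<=` B -> hausdorff_null s B -> hausdorff_null s A.
Proof.
move=> AB h delta e d0 e0; have [U [BU dU sU]] := h delta e d0 e0.
by exists U; split => //; exact: subset_trans BU.
Qed.

Lemma hausdorff_null_finite s A : 0 < s ->
  (forall e : R, 0 < e -> exists N U r, [/\ 0 <= r <= e,
     A `<=` \bigcup_(k in `I_N) U k,
     forall k x y, U k x -> U k y -> `|x - y| <= r & N%:R * r `^ s <= e]) ->
  hausdorff_null s A.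
Proof.
move=> s0 h delta e d0 e0; have m0 : 0 < Num.min delta e by rewrite lt_min d0.
have [N [U [r [/andP[r0 rm] AU dU Nr]]]] := h _ m0.
pose V k := if (k < N)%N then U k else set0; exists V; split.
- by move=> x /AU[k kN Ux]; exists k => //; rewrite /V; move: kN => /= ->.
- move=> k; rewrite /V; case: ifP => _; apply: diam_le => x y; last by [].
  move=> Ux Uy; apply: le_trans (dU k x y Ux Uy) _; apply: (le_trans rm).
  by rewrite ge_min lexx.
- rewrite (@nneseries_split _ _ 0%N N); last by move=> k _; exact: hausdorff_weight_ge0.
  rewrite add0n eseries0 ?adde0; last first.
    by move=> k Nk _; rewrite /V ltnNge Nk; exact: hausdorff_weight_set0.
  apply: (@le_trans _ _ (\sum_(0 <= k < N) (r `^ s)%:E)%E).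
    rewrite !big_mkord; apply: lee_sum => k _; rewrite /V ltn_ord.
    by apply: hausdorff_weight_le => //; exact: dU.
  rewrite sumEFin sumr_const_nat subn0 lee_fin -mulr_natl; apply: (le_trans Nr).
  by rewrite ge_min lexx orbT.
Qed.

(** Covers with weights [e / 2], [e / 4], ... are merged along an enumeration of
    the pairs of natural numbers. *)
Lemma hausdorff_null_bigcup s (A : nat -> set R) :
  (forall n, hausdorff_null s (A n)) -> hausdorff_null s (\bigcup_n A n).
Proof.
move=> h delta e d0 e0.
have en n : 0 < e / (2 ^ n.+1)%:R by rewrite divr_gt0// ltr0n expn_gt0.
have [G GP] := choice (fun n => h n delta _ d0 (en n)).
have /card_esym/ppcard_eqP[f] := card_nat2.
pose w (p : nat * nat) := hausdorff_weight s (G p.1 p.2).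
have w0 p : (0 <= w p)%E by exact: hausdorff_weight_ge0.
exists (fun k => G (f k).1 (f k).2); split.
- move=> x [n _ Ax]; have [GA _ _] := GP n; have [k _ Gx] := GA _ Ax.
  by exists (f^-1%FUN (n, k)) => //; rewrite invK ?inE.
- by move=> k; have [_ + _] := GP (f k).1; exact.
have -> : (\sum_(k <oo) hausdorff_weight s (G (f k).1 (f k).2) = \sum_(k <oo) w (f k))%E by [].
rewrite nneseries_esumT; last by move=> n; exact: w0.
rewrite -(@reindex_esum _ _ _ setT setT f w); last exact: bij.
have -> : [set: nat * nat] = setT `*`` (fun=> setT) by apply/seteqP; split.
rewrite -(@esum_esum _ _ _ setT (fun=> setT) (fun i j => w (i, j))) => [|i j _ _]; last exact: w0.
rewrite -nneseries_esumT; last by move=> n; apply: esum_ge0 => k _; exact: w0.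
apply: le_trans (epsilon_trick0 xpredT (ltW e0)); apply: lee_nneseries => n _ //.
  by move=> _; apply: esum_ge0 => k _; exact: w0.
rewrite -nneseries_esumT => [|k]; last exact: w0.
by have [_ _] := GP n.
Qed.

Lemma hausdorff_null_countable s A : 0 < s -> countable A -> hausdorff_null s A.
Proof.
move=> s0 /countable_injP[f finj].
apply: (@hausdorff_null_sub s _ (\bigcup_n [set x | A x /\ f x = n])).
  by move=> x Ax; exists (f x).
apply: hausdorff_null_bigcup => n; apply: hausdorff_null_finite => // e e0.
exists 1%N, (fun=> [set x | A x /\ f x = n]), 0; split; first by rewrite lexx ltW.
- by move=> x Ax; exists 0%N.
- move=> _ x y [Ax fx] [Ay fy]; rewrite (_ : x = y) ?subrr ?normr0//.
  by apply: finj; rewrite ?inE// fx.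
- by rewrite powR0 ?gt_eqF// mulr0 ltW.
Qed.

Lemma hausdorff_nullU s A B : hausdorff_null s A -> hausdorff_null s B ->
  hausdorff_null s (A `|` B).
Proof.
move=> hA hB; apply: (@hausdorff_null_sub s _ (\bigcup_n (if n is 0 then A else B))).
  by move=> x [Ax|Bx]; [exists 0%N|exists 1%N].
by apply: hausdorff_null_bigcup => -[].
Qed.

Lemma hausdorff_null_measure s A : hausdorff_null s A -> hausdorff_measure s A = 0%E.
Proof.
move=> h.
have pre delta : 0 < delta -> hausdorff_premeasure s delta A = 0%E.
  move=> d0; apply/le_anti/andP; split.
    apply/lee_addgt0Pr => e e0; rewrite add0e; have [U [AU dU sU]] := h delta e d0 e0.
    by apply: le_trans sU; apply: ereal_inf_lbound; exists U.
  apply: le_ereal_inf_tmp => _ [U _ <-]; apply: nneseries_ge0 => k _ _.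
  exact: hausdorff_weight_ge0.
apply/le_anti/andP; split.
  by apply: ge_ereal_sup => _ [delta /= d0 <-]; rewrite pre.
by apply: ereal_sup_ubound; exists 1; [exact: ltr01|exact: pre].
Qed.

Lemma hausdorff_dim0 A : (forall s, 0 < s -> hausdorff_null s A) -> hausdorff_dim A = 0%E.
Proof.
move=> h; apply/le_anti/andP; split; last first.
  by apply: le_ereal_inf_tmp => _ [s [s0 _] <-]; rewrite lee_fin.
apply/lee_addgt0Pr => e e0; rewrite add0e; apply: ereal_inf_lbound; exists e => //.
by split; [exact: ltW|exact/hausdorff_null_measure/h].
Qed.

End HausdorffNull.

Section DimensionZero.
Variables (R : realType) (M : nat).
Hypothesis M1 : (1 <= M)%N.
Implicit Types (s x q : R) (a : word M) (n k : nat).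
Local Notation qKL := (q_KL R M).

(** The part of [univoque] in the basic interval of [a]: there the expansions
    are coded by 0-1 sequences, one new symbol for every block of length
    [size a]. *)
Definition coded a : set R := [set x | [/\ @bases R M x, qKL <= x,
  (periodic a <= alpha M x)%O /\ (alpha M x <= plus_seq a)%O &
  forall n, (refl_seq (alpha M x) <= shift_seq n (alpha M x))%O /\
    (shift_seq n (alpha M x) <= alpha M x)%O]].

Lemma code_agree a (st st' : nat -> bool) n : adm_spec a -> (forall i, (i <= n)%N -> st i = st' i) ->
  agree (n * size a) (code a st) (code a st').
Proof.
move=> adm h i im; have lt : (i %/ size a < n)%N by rewrite ltn_divLR// adm_size.
by rewrite /code !h// ltnW.
Qed.

(** The first [n] symbols of the code split the set into [2^n] pieces of diameter
    at most [C / qKL ^ (n * size a)]; under the hypothesis the sum of their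
    weights is at most a constant times [2 ^ n / 4 ^ n]. *)
Lemma coded_null s a : 0 < s -> adm_spec a -> 4 <= (qKL ^+ size a) `^ s ->
  hausdorff_null s (coded a).
Proof.
move=> s0 adm h4; have [[bKL _] _ _] := q_KL_spec R M1; have b1 := bases_gt1 bKL.
have m0 := adm_size adm; set Q := qKL ^+ size a in h4.
have Q1 : 1 < Q by rewrite exprn_egt1// -lt0n.
have Q0 : 0 < Q by lra.
pose C := M.+1%:R * (M%:R / (qKL - 1)).
have C0 : 0 <= C by rewrite mulr_ge0// divr_ge0//; lra.
apply: hausdorff_null_finite => // e e0.
have [n1 hn1] := exp_inv_small C Q1 e0.
have [n2 hn2] := exp_inv_small (C `^ s) (ltr1n R 2) e0.
pose n := maxn n1 n2.
pose U j := [set x | coded a x /\ exists st', [/\ alpha M x = code a st', st' 0%N = false &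
  forall i : 'I_n, st' i.+1 = tnth (nth [tuple of nseq n false] (enum {: n.-tuple bool}) j) i]].
exists (2 ^ n)%N, U, (C / Q ^+ n); split.
- have Qn : 0 < Q ^+ n by rewrite exprn_gt0.
  by rewrite divr_ge0 ?(ltW Qn)//= (ltW (hn1 _ (leq_maxl _ _))).
- move=> x cx; have [bx xq [x1 x2] tl] := cx.
  have [st' st0 xE] := decode adm x1 x2 tl.
  pose w := [tuple st' i.+1 | i < n].
  exists (index w (enum {: n.-tuple bool})) => /=.
    have := card_tuple n bool; rewrite card_bool => <-.
    by rewrite cardE index_mem mem_enum.
  split => //; exists st'; split => // i.
  by rewrite nth_index ?mem_enum// tnth_mktuple.
- move=> k x y [[bx xq _ _] [s1 [e1 z1 t1]]] [[by_ yq _ _] [s2 [e2 z2 t2]]].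
  have same i : (i <= n)%N -> s1 i = s2 i.
    case: i => [_|i iN]; first by rewrite z1.
    by have := t1 (Ordinal iN); have := t2 (Ordinal iN) => /= -> ->.
  have ag : agree (n * size a) (alpha M x) (alpha M y).
    by rewrite e1 e2; exact: code_agree.
  have := alpha_dist b1 bx by_ xq yq ag.
  by rewrite mulnC exprM.
- have -> : (C / Q ^+ n) `^ s = C `^ s / (Q `^ s) ^+ n.
    have Qn : 0 <= Q ^+ n by rewrite exprn_ge0// ltW.
    rewrite powRM ?invr_ge0//; congr (_ * _).
    rewrite -powR_inv1// -powRrM mulrC powRrM -powR_inv1 ?powR_ge0//; last first.
      by rewrite exprn_ge0// powR_ge0.
    by congr (_ `^ _); rewrite -powR_mulrn ?(ltW Q0)// -powRrM mulrC powRrM powR_mulrn// powR_ge0.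
  have q40 : 0 < Q `^ s by lra.
  apply: (@le_trans _ _ (C `^ s / 2 ^+ n)); last exact: ltW (hn2 _ (leq_maxr _ _)).
  rewrite mulrCA ler_wpM2l ?powR_ge0// ler_pdivrMr ?exprn_gt0// natrX.
  rewrite -exprVn -exprMn; apply: lerXn2r; rewrite ?nnegrE; lra.
Qed.

Lemma Cinfty_coded x n : @Cinfty R M x ->
  exists a, [/\ adm_spec a, (n < size a)%N & coded a x].
Proof.
move=> Cx; have [I [a [pI adm ga sa /andP[h1 h2]]]] := Cinfty_plateau M1 n Cx.
have adm' := admissible_spec adm; have [bq aq] := q_c_spec adm ga.
have bx := Cinfty_bases M1 Cx; have [_ b2 _ a2] := ga.
have [_ [_ _ _ qI]] := plateau_word M1 pI; have /andP[q1 _] := q_c_between adm ga.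
have lt : (periodic a < alpha M x)%O.
  by apply: lt_trans (theta_gt adm') _; rewrite -aq alpha_mono.
exists a; split => //; split => //.
- by apply/ltW/(lt_trans qI)/(lt_trans q1).
- by rewrite ltW//= /plus_seq -a2 alpha_le.
- move=> k; split; last exact: shift_alpha_le.
  have [->|k0] := posnP k.
    rewrite shift_seq0; apply: (@le_trans _ _ (refl_seq (periodic a))).
      by rewrite refl_le ltW.
    by apply: le_trans (refl_le_periodic adm') _; exact: ltW.
  apply/ltW/univoque_refl_lt => //; apply: (Cset_univoque M1); by right.
Qed.

Lemma countable_C0 : countable (@C0 R M).
Proof.
pose f (o : option (seq 'I_M.+1)) : R := if o is Some a then
  xget 0 [set q | @bases R M q /\ alpha M q = theta (a : word M)] else qKL.
apply: (@sub_countable _ _ _ (range f)); last first.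
  exact: sub_countable (card_image_le f setT) (countableP _).
apply: subset_card_le => _ [n _ [I pI <-]]; case: n pI => [->|n pI].
  by exists None => //; rewrite /q_c eqxx.
have [a [adm ga _ _]] := plateau_word M1 pI; exists (Some (a : seq 'I_M.+1)) => //.
have [bq aq] := q_c_spec adm ga.
have [bf af] := xgetPex 0 (ex_intro (fun q => @bases R M q /\ alpha M q = theta a) _ (conj bq aq)).
by apply: (alpha_inj bf bq); rewrite af.
Qed.

(** For given [s] only words so long that [coded_null] applies are needed to
    cover [Cinfty], and there are countably many words. *)
Lemma hausdorff_dim_Cset : hausdorff_dim (@Cset R M) = 0%E.
Proof.
apply: hausdorff_dim0 => s s0; apply: hausdorff_nullU.
  by apply: hausdorff_null_countable => //; exact: countable_C0.
have [[bKL _] _ _] := q_KL_spec R M1; have b1 := bases_gt1 bKL.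
have qs : 1 < qKL `^ s by have : 1 `^ s < qKL `^ s; [rewrite gt0_ltr_powR ?nnegrE//; lra|rewrite powR1].
have [N hN] := exp_unbounded 4 qs.
pose A k := if @unpickle (seq 'I_M.+1) k is Some a then
  [set x | [/\ adm_spec (a : word M), (N < size a)%N & coded a x]] else set0.
apply: (@hausdorff_null_sub _ s _ (\bigcup_k A k)).
  move=> x /(Cinfty_coded N)[a [adm Na cx]].
  by exists (pickle (a : seq 'I_M.+1)) => //; rewrite /A pickleK.
apply: hausdorff_null_bigcup => k; rewrite /A; case: unpickle => [a|]; last first.
  by apply: hausdorff_null_countable.
have [[adm Na]|no] := pselect (adm_spec (a : word M) /\ (N < size a)%N).
  apply: (@hausdorff_null_sub _ s _ (coded a)); first by move=> x [].
  apply: coded_null => //; apply: (le_trans hN).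
  have -> : (qKL ^+ size a) `^ s = (qKL `^ s) ^+ size a.
    rewrite -powR_mulrn; last by lra.
    by rewrite -powRrM mulrC powRrM powR_mulrn// powR_ge0.
  by apply: ler_weXn2l; [exact: ltW|exact: ltnW].
apply: (@hausdorff_null_sub _ s _ set0); last by apply: hausdorff_null_countable.
by move=> x [adm Na _]; apply: no.
Qed.

End DimensionZero.

Theorem proposition1p4 (R : realType) (M : nat) (hM : (1 <= M)%N) :
  [/\ @Cset R M `<=` @univoque R M,
      ~ countable (@Cset R M) /\ isolated (@Cset R M) = set0 &
      hausdorff_dim (@Cset R M) = 0%E].
Proof.
split; [exact: Cset_univoque|split; last exact: isolated_Cset|exact: hausdorff_dim_Cset].
move=> /(sub_countable (subset_card_le (@subsetUr _ (@C0 R M) (@Cinfty R M)))).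
exact: uncountable_Cinfty.
Qed.
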